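(* Let $\mathcal E$ be an equation $y''=a^3(x,y)y'^3+a^2(x,y)y'^2+a^1(x,y)y'+a^0(x,y)$. Then $\mathcal E$ can be (locally) reduced to the linear form by a point transformation if and only if $\omega^2_{\mathcal E}=0$, where $\omega^2_{\mathcal E}$ is the restriction of the tensor field $\omega^2:\theta_2\mapsto\omega_{\theta_2}$ on $J^2\pi$ to the image of the section $j_2S_{\mathcal E}$.
   Context: All manifolds and maps are smooth. Let $\pi:\mathbb R^2\times\mathbb R^4\to\mathbb R^2$ be the product bundle with base coordinates $(x^1,x^2)=(x,y)$ and fibre coordinates $u^1,\dots,u^4$. The equation $\mathcal E$ is identified with the (local) section $S_{\mathcal E}(p)=(p,a^0(p),a^1(p),a^2(p),a^3(p))$ of $\pi$. A point transformation is a diffeomorphism $f$ of an open subset of $\mathbb R^2$ onto an open subset of $\mathbb R^2$. Its lift $f^{(0)}$ sends $(p,u)$ to $(f(p),\tilde u)$, where, with $g=(g^1,g^2)=f^{-1}$, subscripts denoting partial derivatives at $f(p)$, $A=g^1_1+g^1_2t$, $B=g^2_1+g^2_2t$, $Q^i=g^i_{11}+2g^i_{12}t+g^i_{22}t^2$, $J=g^1_1g^2_2-g^1_2g^2_1$, the $\tilde u^i$ are determined by the identity in $t$: $\sum_{i=0}^3\tilde u^{i+1}t^i=J^{-1}\bigl(\sum_{i=0}^3u^{i+1}B^iA^{3-i}-AQ^2+BQ^1\bigr)$. The change of variables $f$ transforms $\mathcal E$ into the equation with section $f^{(0)}\circ S_{\mathcal E}\circ f^{-1}$. A linear equation is one of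 the form $y''=a(x)y'+b(x)y+c(x)$. $J^k\pi$ is the bundle of $k$-jets of sections of $\pi$, $\pi_k:J^k\pi\to\mathbb R^2$; $j_kS:p\mapsto j^k_pS$; $f^{(k)}(j^k_pS)=j^k_{f(p)}(f^{(0)}\circ S\circ f^{-1})$. A vector field $X$ on the base with flow $f_t$ lifts to the vector field $X^{(k)}$ on $J^k\pi$ with flow $f_t^{(k)}$. $W_p$ is the Lie algebra of $\infty$-jets at $p$ of vector fields on $\mathbb R^2$, $L^k_p\subset W_p$ the jets with zero $k$-jet; $W_p/L^k_p$ is the space of $k$-jets, $T_p=W_p/L^0_p$, $\rho_{i,j}:W_p/L_p^i\to W_p/L_p^j$ the projection; the Lie bracket induces $[\cdot,\cdot]:W_p/L^k_p\times W_p/L^k_p\to W_p/L^{k-1}_p$. For $\theta_2=j^2_pS$, $\theta_1=j^1_pS$, let $\mathcal K_{\theta_2}$ be the tangent space at $\theta_1$ to the image of $j_1S$, and $\mathcal A_{\theta_2}=\{j^3_pX\in W_p/L_p^3: X^{(1)}_{\theta_1}\in\mathcal K_{\theta_2}\}$. A 2-dimensional subspace $H\subset\mathcal A_{\theta_2}$ is horizontal if $\rho_{3,0}|_H:H\to T_p$ is an isomorphism; then $\omega_H(X_p,Y_p)=[(\rho_{3,0}|_H)^{-1}(X_p),(\rho_{3,0}|_H)^{-1}(Y_p)]\in W_p/L_p^2$. For every $\theta_2$ there exist horizontal $H\subset\mathcal A_{\theta_2}$ with $\rho_{2,1}([j_p^3X,j_p^3Y])=0$ for all $j^3_pX,j^3_pY\in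 H$, and for all such $H$ the form $\omega_H$ is the same; it is denoted $\omega_{\theta_2}$. It takes values in a 2-dimensional subspace of $L_p^1/L_p^2\cong T_p\otimes S^2T^*_p$. In coordinates $$\omega^2=\Bigl(F^1\bigl(2\partial_{x^1}\otimes(dx^1\odot dx^1)+\partial_{x^2}\otimes(dx^1\odot dx^2)\bigr)+F^2\bigl(2\partial_{x^2}\otimes(dx^2\odot dx^2)+\partial_{x^1}\otimes(dx^1\odot dx^2)\bigr)\Bigr)\otimes(dx^1\wedge dx^2),$$ $F^1=3u^1_{22}-2u^2_{12}+u^3_{11}+3u^4u^1_1-3u^3u^1_2+2u^2u^2_2-u^2u^3_1-3u^1u^3_2+6u^1u^4_1$, $F^2=u^2_{22}-2u^3_{12}+3u^4_{11}-3u^1u^4_2+3u^2u^4_1-2u^3u^3_1+u^3u^2_2+3u^4u^2_1-6u^4u^1_2$. ''Locally reduced'' means: every point of the domain of $S_{\mathcal E}$ has a neighborhood on which some point transformation takes $\mathcal E$ to a linear equation. *)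

(* Defs.v *)
From Stdlib Require Import Reals ClassicalEpsilon.
From Coquelicot Require Import Coquelicot.
Open Scope R_scope.

(* All iterated directional derivatives of order <= k exist and are continuous
   on D; for D open in a finite-dimensional space this is the usual C^k. *)
Fixpoint Ck (k : nat) {V W : NormedModule R_AbsRing}
    (D : V -> Prop) (F : V -> W) : Prop :=
  (forall p, D p -> continuous F p) /\
  match k with
  | O => True
  | S k' => forall v : V, exists G : V -> W,
      (forall p, D p -> is_derive (fun t : R => F (plus p (scal t v))) 0 (G p))
      /\ Ck k' D G
  end.

Definition smooth {V W : NormedModule R_AbsRing} (D : V -> Prop) (F : V -> W) :=
  forall k, Ck k D F.

Definition smooth_near {V W : NormedModule R_AbsRing} (p : V) (F : V -> W) :=
  exists D : V -> Prop, open D /\ D p /\ smooth D F.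

Definition R2 : Type := (R * R)%type.
Definition R4 : Type := (R * R * R * R)%type.

Definition u1 (u : R4) : R := fst (fst (fst u)).
Definition u2 (u : R4) : R := snd (fst (fst u)).
Definition u3 (u : R4) : R := snd (fst u).
Definition u4 (u : R4) : R := snd u.

Definition d1 (f : R2 -> R) (p : R2) : R := Derive (fun s => f (s, snd p)) (fst p).
Definition d2 (f : R2 -> R) (p : R2) : R := Derive (fun s => f (fst p, s)) (snd p).

Definition on_R2 (d : (R2 -> R) -> R2 -> R) (X : R2 -> R2) (p : R2) : R2 :=
  (d (fun q => fst (X q)) p, d (fun q => snd (X q)) p).
Definition on_R4 (d : (R2 -> R) -> R2 -> R) (S : R2 -> R4) (p : R2) : R4 :=
  (d (fun q => u1 (S q)) p, d (fun q => u2 (S q)) p,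
   d (fun q => u3 (S q)) p, d (fun q => u4 (S q)) p).

(* A section p |-> (p, S p) of the product bundle is given by S : R2 -> R4; the
   equation y'' = a3 y'^3 + a2 y'^2 + a1 y' + a0 has S = (a0, a1, a2, a3). *)
Definition section_of (a0 a1 a2 a3 : R2 -> R) (p : R2) : R4 :=
  (a0 p, a1 p, a2 p, a3 p).

Definition diffeo (V V' : R2 -> Prop) (f g : R2 -> R2) : Prop :=
  open V /\ open V' /\ smooth V f /\ smooth V' g /\
  (forall p, V p -> V' (f p) /\ g (f p) = p) /\
  (forall q, V' q -> V (g q) /\ f (g q) = q).

(* Fibre part of the lift of f = g^-1, with derivatives of g taken at q = f(p):
   the coefficients of t^0, ..., t^3 in the right-hand side of [lift0_spec]. *)
Definition lift0 (g : R2 -> R2) (q : R2) (u : R4) : R4 :=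
  let g1 := fun z => fst (g z) in
  let g2 := fun z => snd (g z) in
  let A0 := d1 g1 q in let A1 := d2 g1 q in
  let B0 := d1 g2 q in let B1 := d2 g2 q in
  let J := A0 * B1 - A1 * B0 in
  let P0 := d1 (d1 g1) q in let P1 := 2 * d1 (d2 g1) q in let P2 := d2 (d2 g1) q in
  let Q0 := d1 (d1 g2) q in let Q1 := 2 * d1 (d2 g2) q in let Q2 := d2 (d2 g2) q in
  ( / J * (u1 u * A0 ^ 3 + u2 u * (B0 * A0 ^ 2) + u3 u * (B0 ^ 2 * A0)
           + u4 u * B0 ^ 3
           - A0 * Q0 + B0 * P0),
    / J * (u1 u * (3 * A0 ^ 2 * A1) + u2 u * (B1 * A0 ^ 2 + 2 * B0 * A0 * A1)
           + u3 u * (2 * B0 * B1 * A0 + B0 ^ 2 * A1) + u4 u * (3 * B0 ^ 2 * B1)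
           - (A0 * Q1 + A1 * Q0) + (B0 * P1 + B1 * P0)),
    / J * (u1 u * (3 * A0 * A1 ^ 2) + u2 u * (2 * B1 * A0 * A1 + B0 * A1 ^ 2)
           + u3 u * (B1 ^ 2 * A0 + 2 * B0 * B1 * A1) + u4 u * (3 * B0 * B1 ^ 2)
           - (A0 * Q2 + A1 * Q1) + (B0 * P2 + B1 * P1)),
    / J * (u1 u * A1 ^ 3 + u2 u * (B1 * A1 ^ 2) + u3 u * (B1 ^ 2 * A1)
           + u4 u * B1 ^ 3
           - A1 * Q2 + B1 * P2) ).

Lemma lift0_spec (g : R2 -> R2) (q : R2) (u : R4) (t : R) :
  let g1 := fun z => fst (g z) in
  let g2 := fun z => snd (g z) in
  let A := d1 g1 q + d2 g1 q * t in
  let B := d1 g2 q + d2 g2 q * t in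
  let Q h := d1 (d1 h) q + 2 * d1 (d2 h) q * t + d2 (d2 h) q * t ^ 2 in
  let J := d1 g1 q * d2 g2 q - d2 g1 q * d1 g2 q in
  let v := lift0 g q u in
  u1 v + u2 v * t + u3 v * t ^ 2 + u4 v * t ^ 3
  = / J * (u1 u * A ^ 3 + u2 u * B * A ^ 2 + u3 u * B ^ 2 * A + u4 u * B ^ 3
           - A * Q g2 + B * Q g1).
Proof. cbv beta iota zeta delta [lift0 u1 u2 u3 u4 fst snd]; ring. Qed.

(* the section f^(0) o S o f^-1, where g = f^-1 *)
Definition transform (g : R2 -> R2) (S : R2 -> R4) (q : R2) : R4 :=
  lift0 g q (S (g q)).

Definition linear_on (V : R2 -> Prop) (S : R2 -> R4) : Prop :=
  exists a b c : R -> R,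
    let I := fun x : R => exists y : R, V (x, y) in
    smooth I a /\ smooth I b /\ smooth I c /\
    forall x y, V (x, y) -> S (x, y) = (b x * y + c x, a x, 0, 0).

Definition locally_linearizable (U : R2 -> Prop) (S : R2 -> R4) : Prop :=
  forall p, U p ->
    exists (V V' : R2 -> Prop) (f g : R2 -> R2),
      V p /\ (forall q, V q -> U q) /\ diffeo V V' f g /\
      linear_on V' (transform g S).

(* coordinates (p, u, (u_1, u_2)) and (j^1, (u_11, u_12, u_22)) *)
Definition J1 : Type := (R2 * R4 * (R4 * R4))%type.
Definition J2 : Type := (J1 * (R4 * R4 * R4))%type.

Definition j1 (S : R2 -> R4) (p : R2) : J1 := (p, S p, (on_R4 d1 S p, on_R4 d2 S p)).
Definition j2 (S : R2 -> R4) (p : R2) : J2 :=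
  (j1 S p, (on_R4 (fun h => d1 (d1 h)) S p, on_R4 (fun h => d1 (d2 h)) S p,
            on_R4 (fun h => d2 (d2 h)) S p)).

Definition base (theta1 : J1) : R2 := fst (fst theta1).

(* tangent vectors to J^1 are written in the above coordinates, as elements of J1 *)
Definition calK (theta2 : J2) (v : J1) : Prop :=
  exists S : R2 -> R4,
    let p := base (fst theta2) in
    smooth_near p S /\ j2 S p = theta2 /\
    exists w : R2, is_derive (fun t : R => j1 S (plus p (scal t w))) 0 v.

(* W_p / L^k_p in coordinates: the partial derivatives of order <= k at p.
   The projections rho_{k+1,k} are [fst]. *)
Definition W0 : Type := R2.
Definition W1 : Type := (W0 * (R2 * R2))%type.
Definition W2 : Type := (W1 * (R2 * R2 * R2))%type.
Definition W3 : Type := (W2 * (R2 * R2 * R2 * R2))%type.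

Definition vj1 (X : R2 -> R2) (p : R2) : W1 := (X p, (on_R2 d1 X p, on_R2 d2 X p)).
Definition vj2 (X : R2 -> R2) (p : R2) : W2 :=
  (vj1 X p, (on_R2 (fun h => d1 (d1 h)) X p, on_R2 (fun h => d1 (d2 h)) X p,
             on_R2 (fun h => d2 (d2 h)) X p)).
Definition vj3 (X : R2 -> R2) (p : R2) : W3 :=
  (vj2 X p, (on_R2 (fun h => d1 (d1 (d1 h))) X p, on_R2 (fun h => d1 (d1 (d2 h))) X p,
             on_R2 (fun h => d1 (d2 (d2 h))) X p, on_R2 (fun h => d2 (d2 (d2 h))) X p)).

Definition rho21 (xi : W2) : W1 := fst xi.
Definition rho30 (xi : W3) : W0 := fst (fst (fst xi)).

Definition lie (X Y : R2 -> R2) (p : R2) : R2 :=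
  minus (plus (scal (fst (X p)) (on_R2 d1 Y p)) (scal (snd (X p)) (on_R2 d2 Y p)))
        (plus (scal (fst (Y p)) (on_R2 d1 X p)) (scal (snd (Y p)) (on_R2 d2 X p))).

Definition local_flow (X : R2 -> R2) (p : R2) (Phi : R -> R2 -> R2) : Prop :=
  exists O : R * R2 -> Prop,
    open O /\ O (0, p) /\ smooth O (fun z => Phi (fst z) (snd z)) /\
    (forall q, O (0, q) -> Phi 0 q = q) /\
    (forall t q, O (t, q) -> is_derive (fun s => Phi s q) t (X (Phi t q))).

(* v is the value of the lifted field X^(1) at theta1: the velocity at t = 0 of
   f_t^(1)(theta1) = j^1_{f_t(p)} (f_t^(0) o S o f_t^-1), where theta1 = j^1_p S
   and f_t^-1 = f_{-t}. *)
Definition prolong1 (X : R2 -> R2) (theta1 : J1) (v : J1) : Prop :=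
  let p := base theta1 in
  exists (Phi : R -> R2 -> R2) (S : R2 -> R4),
    local_flow X p Phi /\ smooth_near p S /\ j1 S p = theta1 /\
    is_derive (fun t : R => j1 (transform (Phi (- t)) S) (Phi t p)) 0 v.

Definition calA (theta2 : J2) (xi : W3) : Prop :=
  let p := base (fst theta2) in
  exists X : R2 -> R2, smooth_near p X /\ vj3 X p = xi /\
    exists v : J1, prolong1 X (fst theta2) v /\ calK theta2 v.

Definition subspace {V : NormedModule R_AbsRing} (H : V -> Prop) : Prop :=
  H zero /\ (forall x y, H x -> H y -> H (plus x y)) /\
  (forall (k : R) x, H x -> H (scal k x)).

(* dim H = 2 follows from the isomorphism with T_p *)
Definition horizontal (theta2 : J2) (H : W3 -> Prop) : Prop :=
  subspace H /\ (forall xi, H xi -> calA theta2 xi) /\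
  (forall v : W0, exists! xi : W3, H xi /\ rho30 xi = v).

(* The bracket [j^3_p X, j^3_p Y] is the 2-jet of [X, Y]; it depends only on the
   3-jets, and every 3-jet is represented by a smooth field. *)
Definition flat_horizontal (theta2 : J2) (H : W3 -> Prop) : Prop :=
  let p := base (fst theta2) in
  horizontal theta2 H /\
  forall X Y : R2 -> R2, smooth_near p X -> smooth_near p Y ->
    H (vj3 X p) -> H (vj3 Y p) -> rho21 (vj2 (lie X Y) p) = zero.

(* Determines w = omega_H, since rho30 is a bijection from H onto T_p. *)
Definition is_omega_H (p : R2) (H : W3 -> Prop) (w : W0 -> W0 -> W2) : Prop :=
  forall X Y : R2 -> R2, smooth_near p X -> smooth_near p Y ->
    H (vj3 X p) -> H (vj3 Y p) ->
    w (rho30 (vj3 X p)) (rho30 (vj3 Y p)) = vj2 (lie X Y) p.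

(* Such H exist and all give the same omega_H, so the choice is immaterial. *)
Definition omega (theta2 : J2) : W0 -> W0 -> W2 :=
  epsilon (inhabits (fun _ _ => zero))
    (fun w => exists H, flat_horizontal theta2 H /\
                        is_omega_H (base (fst theta2)) H w).

(* Main.v *)
(* Ratios (psi1/psi0, psi2/psi0) of solutions of a linear system that expresses the second derivatives
   of psi through psi, psi_x, psi_y and the coefficients of the equation map it to y'' = 0.  The
   obstructions to integrability of this system are F^1 and F^2, so F = 0 gives three independent
   solutions and a linearizing map.  Conversely, F vanishes for a linear equation, which is therefore
   locally equivalent to y'' = 0; by functoriality of the lift so is every linearizable equation.  The
   coefficients of an equation equivalent to y'' = 0 are combinations of the Christoffel symbols of a
   flat torsion-free connection, and the flatness identities yield F = 0.

   On jets, X^(1) at theta1 is an explicit function of the 3-jet of X, so that membership in the algebra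
   A forces linear equations on the 3-jet, and is equivalent to them whenever some field with this
   3-jet has a flow that is known to be smooth.  For a jet with nonzero value such a field is obtained
   by straightening: it is the image of d/ds under a chart given by Taylor polynomials of integral
   curves.  On a flat horizontal H with lifts X, Y of the coordinate vectors, the equations leave for
   [X, Y] the second derivatives (2 F^1, F^2, 0) / 3 and (0, F^1, 2 F^2) / 3; hence omega = 0 if and
   only if F^1 = F^2 = 0. *)

From Stdlib Require Import Reals Lra Lia FunctionalExtensionality List Classical ClassicalEpsilon.
From Coquelicot Require Import Coquelicot.
Require Import Defs.
Open Scope R_scope.

(** The obstacle is analytic: differential equations have to be solved with smooth dependence on all
    variables, but linear ones suffice. The parameter derivative of a solution is a component of the
    solution of a larger linear system, so smoothness follows by induction over all linear systems
    at once. Flows of general fields are avoided: [calA] prescribes only the 3-jet of the field, so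
    a polynomial chart that is correct to fourth order along a transversal is enough, and the
    inverse function theorem inverts it. This needs a nonzero value at the point; over the zero
    vector a horizontal subspace contains only the zero jet, which the identity flow realises. The
    coefficients 1/3 of the linear system for psi come from picking, among the connections whose
    unparametrised geodesics are the integral curves, the one with trace-free symbols; taking ratios
    of solutions moves within this class. Since [omega] is defined by choice, it takes both the
    existence of a flat horizontal subspace and the independence of the value from it. *)

Ltac Rring := match goal with |- @eq _ ?a ?b => change (@eq R a b) end; ring.

(** * Maps of class [Ck] between normed modules and their closure properties *)

Lemma line_cont {V : NormedModule R_AbsRing} (p v : V) (t : R) :
  continuous (fun t : R => plus p (scal t v)) t.
Proof.
  apply (continuous_plus (fun _ => p) (fun t : R => scal t v)).
  - apply continuous_const.
  - apply (continuous_scal_l (fun t : R => t) v). apply continuous_id.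
Qed.

Lemma line0 {V : NormedModule R_AbsRing} (p v : V) : plus p (scal 0 v) = p.
Proof.
  transitivity (plus p zero); [f_equal; apply (scal_zero_l v)|apply plus_zero_r].
Qed.

Lemma near_line {V : NormedModule R_AbsRing} (D : V -> Prop) (p v : V) :
  open D -> D p -> locally (0 : R) (fun t : R => D (plus p (scal t v))).
Proof.
  intros hD Dp. apply (line_cont p v 0 D). apply hD. now rewrite line0.
Qed.

Lemma Ck_ext {V W : NormedModule R_AbsRing} (k : nat) (D : V -> Prop) (F F' : V -> W) :
  open D -> (forall p, D p -> F p = F' p) -> Ck k D F -> Ck k D F'.
Proof.
  intros hD; revert F F'.
  assert (C : forall F F' : V -> W, (forall p, D p -> F p = F' p) ->
    (forall p, D p -> continuous F p) -> forall p, D p -> continuous F' p).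
  { intros F F' e c p Dp. apply (continuous_ext_loc F' F); [|now apply c].
    generalize (hD p Dp). apply filter_imp. intros; now apply e. }
  destruct k as [|k]; intros F F' e; simpl; intros [c H]; split; try (now apply (C F)); auto.
  intros v. destruct (H v) as [G [dG cG]]. exists G; split; auto.
  intros p Dp. apply (is_derive_ext_loc (fun t : R => F (plus p (scal t v)))); [|now apply dG].
  generalize (near_line D p v hD Dp). apply filter_imp. intros; now apply e.
Qed.

Lemma Ck_sub {V W : NormedModule R_AbsRing} (k : nat) (D D' : V -> Prop) (F : V -> W) :
  (forall p, D' p -> D p) -> Ck k D F -> Ck k D' F.
Proof.
  intros s; revert F; induction k as [|k IH]; intros F [c H]; split; auto.
  intros v. destruct (H v) as [G [dG cG]]. exists G; split; auto.
Qed.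

Lemma Ck_S {V W : NormedModule R_AbsRing} (k : nat) (D : V -> Prop) (F : V -> W) :
  Ck (S k) D F -> Ck k D F.
Proof.
  revert F; induction k as [|k IH]; intros F [c H]; split; auto.
  intros v. destruct (H v) as [G [dG cG]]. exists G; split; auto.
Qed.

Lemma Ck_const {V W : NormedModule R_AbsRing} (k : nat) (D : V -> Prop) (c : W) :
  Ck k D (fun _ => c).
Proof.
  revert c; induction k as [|k IH]; intros c; (split; [intros; apply continuous_const|]); auto.
  intros v. exists (fun _ => zero); split; auto. intros p Dp. apply (is_derive_const c).
Qed.

Lemma is_derive_lin_post {W Z : NormedModule R_AbsRing} (f : R -> W) (L : W -> Z) (t : R) (l : W) :
  is_linear L -> is_derive f t l -> is_derive (fun t => L (f t)) t (L l).
Proof.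
  intros hL hf. unfold is_derive in *.
  eapply filterdiff_ext_lin.
  - apply (filterdiff_comp' f L t _ L hf). apply filterdiff_linear, hL.
  - intros y; simpl. apply (linear_scal L hL).
Qed.

Lemma Ck_lin_post {V W Z : NormedModule R_AbsRing} (k : nat) (D : V -> Prop) (F : V -> W) (L : W -> Z) :
  is_linear L -> Ck k D F -> Ck k D (fun p => L (F p)).
Proof.
  intros hL; revert F; induction k as [|k IH]; intros F [c H];
    (split; [intros p Dp; apply continuous_comp; [now apply c|now apply linear_cont]|]); auto.
  intros v. destruct (H v) as [G [dG cG]]. exists (fun p => L (G p)); split; auto.
  intros p Dp. apply (is_derive_lin_post (fun t : R => F (plus p (scal t v)))); auto.
Qed.

(** Along a line with direction [v], [A] runs on a line with direction [L v], so derivatives of the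
    composite are derivatives of [F] in the directions [L v] and no chain rule is needed. Slices,
    projections and time reversal are treated this way. *)
Lemma Ck_pre {V' V W : NormedModule R_AbsRing} (k : nat) (D : V -> Prop) (F : V -> W)
  (A L : V' -> V) :
  (forall p, continuous A p) ->
  (forall p v (t : R), A (plus p (scal t v)) = plus (A p) (scal t (L v))) ->
  Ck k D F -> Ck k (fun p => D (A p)) (fun p => F (A p)).
Proof.
  intros cA hA; revert F; induction k as [|k IH]; intros F [c H];
    (split; [intros p Dp; apply continuous_comp; [apply cA|now apply c]|]); auto.
  intros v. destruct (H (L v)) as [G [dG cG]]. exists (fun p => G (A p)); split; auto.
  intros p Dp. apply (is_derive_ext (fun t : R => F (plus (A p) (scal t (L v))))); auto.
  intros t. now rewrite hA.
Qed.

Lemma Ck_linear {V W : NormedModule R_AbsRing} (k : nat) (D : V -> Prop) (L : V -> W) :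
  is_linear L -> Ck k D L.
Proof.
  intros hL. destruct k as [|k]; (split; [intros; now apply linear_cont|]); auto.
  intros v. exists (fun _ => L v); split; [|apply Ck_const].
  intros p Dp. apply (is_derive_lin_post (fun t : R => plus p (scal t v))); auto.
  eapply is_derive_ext; [intros t; reflexivity|].
  evar_last. apply (is_derive_plus (fun _ => p) (fun t : R => scal t v)).
  apply is_derive_const. apply (is_derive_scal_l (fun t : R => t) 0 1 v). apply (is_derive_id (K:=R_AbsRing)).
  rewrite plus_zero_l. apply (scal_one v).
Qed.

Lemma Ck_plus {V W : NormedModule R_AbsRing} (k : nat) (D : V -> Prop) (F F' : V -> W) :
  Ck k D F -> Ck k D F' -> Ck k D (fun p => plus (F p) (F' p)).
Proof.
  revert F F'; induction k as [|k IH]; intros F F' [c H] [c' H'];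
    (split; [intros p Dp; apply (continuous_plus F F'); auto|]); auto.
  intros v. destruct (H v) as [G [dG cG]], (H' v) as [G' [dG' cG']].
  exists (fun p => plus (G p) (G' p)); split; auto.
  intros p Dp.
  apply (is_derive_plus (fun t : R => F (plus p (scal t v))) (fun t : R => F' (plus p (scal t v)))); auto.
Qed.

Lemma Ck_mult {V : NormedModule R_AbsRing} (k : nat) (D : V -> Prop) (F F' : V -> R) :
  Ck k D F -> Ck k D F' -> Ck k D (fun p => F p * F' p).
Proof.
  revert F F'; induction k as [|k IH]; intros F F' [c H] [c' H'];
    (split; [intros p Dp; apply (continuous_mult F F'); auto|]); auto.
  intros v. destruct (H v) as [G [dG cG]], (H' v) as [G' [dG' cG']].
  assert (kF : Ck k D F) by (apply Ck_S; split; auto).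
  assert (kF' : Ck k D F') by (apply Ck_S; split; auto).
  exists (fun p => G p * F' p + F p * G' p); split.
  - intros p Dp.
    generalize (is_derive_mult (fun t : R => F (plus p (scal t v))) (fun t : R => F' (plus p (scal t v)))
      0 (G p) (G' p) (dG p Dp) (dG' p Dp) (fun n m => Rmult_comm n m)).
    now rewrite line0.
  - apply (Ck_plus (W := R_NormedModule)); apply IH; auto.
Qed.

Lemma Ck_inv {V : NormedModule R_AbsRing} (k : nat) (D : V -> Prop) (F : V -> R) :
  (forall p, D p -> F p <> 0) -> Ck k D F -> Ck k D (fun p => / F p).
Proof.
  intros nz; revert F nz; induction k as [|k IH]; intros F nz [c H].
  - split; auto. intros p Dp. apply (continuous_comp F Rinv); auto.
    apply continuity_pt_filterlim. apply continuity_pt_inv; [apply derivable_continuous_pt, derivable_pt_id|]. now apply nz.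
  - assert (kF : Ck k D F) by (apply Ck_S; split; auto).
    pose proof (IH F nz kF) as I. split.
    + apply I || (destruct k; apply I).
    + intros v. destruct (H v) as [G [dG cG]].
      (* The derivative is written through [/ F p] itself, so that the induction hypothesis covers
         it. *)
      exists (fun p => (-1) * (G p * (/ F p * / F p))); split.
      * intros p Dp. evar_last.
        apply (is_derive_inv (fun t : R => F (plus p (scal t v))) 0 (G p)); auto.
        rewrite line0; now apply nz.
        rewrite line0. field. now apply nz.
      * apply Ck_mult; [apply Ck_const|]. repeat apply Ck_mult; auto.
Qed.

Lemma is_derive_prod {V W : NormedModule R_AbsRing} (f : R -> V) (g : R -> W) (t : R) lf lg :
  is_derive f t lf -> is_derive g t lg -> is_derive (fun t => (f t, g t)) t (lf, lg).
Proof.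
  intros hf hg.
  apply (filterdiff_ext_lin _ (fun y : R_AbsRing => (scal y lf, scal y lg))); [|reflexivity].
  split; [apply is_linear_prod; [apply hf|apply hg]|].
  intros x hx eps.
  (* The norm of a pair is at most [sqrt 2] times the larger of the two component norms. *)
  assert (e2 : 0 < eps / sqrt 2) by (apply Rdiv_lt_0_compat; [apply eps|apply Rlt_sqrt2_0]).
  destruct hf as [_ hf], hg as [_ hg].
  generalize (filter_and _ _ (hf x hx (mkposreal _ e2)) (hg x hx (mkposreal _ e2))).
  apply filter_imp. intros y [h1 h2]. simpl in h1, h2.
  eapply Rle_trans; [apply (norm_prod (minus (minus (f y) (f x)) (scal (minus y x) lf)) (minus (minus (g y) (g x)) (scal (minus y x) lg)))|].
  pose proof Rlt_sqrt2_0.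
  apply Rle_trans with (sqrt 2 * (eps / sqrt 2 * norm (minus y x))).
  - apply Rmult_le_compat_l; [lra|]. apply Rmax_lub; auto.
  - right. change (sqrt 2 * (eps / sqrt 2 * Rabs (y - x)) = eps * Rabs (y - x)). field. lra.
Qed.

Lemma continuous_pair {U V W : UniformSpace} (f : U -> V) (g : U -> W) p :
  continuous f p -> continuous g p -> continuous (fun p => (f p, g p)) p.
Proof.
  intros cf cg P [e He].
  refine (filter_imp (F := locally p) (fun q => ball (f p) e (f q) /\ ball (g p) e (g q)) _ _ _).
  - intros q [ha hb]. apply He. split; auto.
  - apply filter_and; [apply cf|apply cg]; apply locally_ball.
Qed.

Lemma Ck_pair {V W Z : NormedModule R_AbsRing} (k : nat) (D : V -> Prop) (F : V -> W) (F' : V -> Z) :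
  Ck k D F -> Ck k D F' -> Ck k D (fun p => (F p, F' p)).
Proof.
  revert F F'; induction k as [|k IH]; intros F F' [c H] [c' H'];
    (split; [intros p Dp; apply continuous_pair; auto|]); auto.
  intros v. destruct (H v) as [G [dG cG]], (H' v) as [G' [dG' cG']].
  exists (fun p => (G p, G' p)); split; auto.
  intros p Dp. apply is_derive_prod; auto.
Qed.

(** * Directional derivatives *)

Definition dd {V : NormedModule R_AbsRing} (v : V) (F : V -> R) (p : V) : R :=
  Derive (fun t : R => F (plus p (scal t v))) 0.

(** Continuously differentiable implies differentiable: isolated as a property of the space because
    it is proved by adding one real coordinate at a time. *)
Definition diffble (V : NormedModule R_AbsRing) : Prop :=
  forall (D : V -> Prop) (F : V -> R) (p : V), open D -> Ck 1 D F -> D p ->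
  filterdiff F (locally p) (fun v => dd v F p).

Lemma Ck_is_dd {V : NormedModule R_AbsRing} (k : nat) (D : V -> Prop) (F : V -> R) v p :
  Ck (S k) D F -> D p -> is_derive (fun t : R => F (plus p (scal t v))) 0 (dd v F p).
Proof.
  intros [_ H] Dp. destruct (H v) as [G [dG _]].
  unfold dd. rewrite (is_derive_unique _ _ _ (dG p Dp)). now apply dG.
Qed.

Lemma Ck_dd {V : NormedModule R_AbsRing} (k : nat) (D : V -> Prop) (F : V -> R) v :
  open D -> Ck (S k) D F -> Ck k D (dd v F).
Proof.
  intros hD [_ H]. destruct (H v) as [G [dG cG]].
  apply (Ck_ext k D G); auto. intros p Dp. symmetry. apply is_derive_unique. now apply dG.
Qed.

Lemma filterdiff_line {V : NormedModule R_AbsRing} (F : V -> R) p l v :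
  filterdiff F (locally p) l -> is_derive (fun t : R => F (plus p (scal t v))) 0 (l v).
Proof.
  intros hF. pose proof hF as [hl _].
  apply (filterdiff_ext_lin _ (fun y : R => l (scal y v))).
  - apply (filterdiff_comp' (fun t : R => plus p (scal t v)) F 0 (fun y : R => scal y v)).
    + evar_last. apply (filterdiff_plus_fct (fun _ => p) (fun t : R => scal t v)).
      apply filterdiff_const. apply filterdiff_linear. apply (is_linear_scal_l v).
      simpl. apply functional_extensionality; intros y. apply plus_zero_l.
    + now rewrite line0.
  - intros y. apply (linear_scal l hl).
Qed.

(** Restricted to a line, a differential gives the directional derivative, so its values are forced
    and only its existence has to be shown. *)
Lemma diffble_of_ex (V : NormedModule R_AbsRing) :
  (forall (D : V -> Prop) (F : V -> R) (p : V), open D -> Ck 1 D F -> D p ->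
    exists l, filterdiff F (locally p) l) -> diffble V.
Proof.
  intros H D F p hD cF Dp. destruct (H D F p hD cF Dp) as [l hl].
  apply (filterdiff_ext_lin _ l); auto. intros v.
  symmetry. apply is_derive_unique. now apply filterdiff_line.
Qed.

Lemma diffble_R : diffble R_NormedModule.
Proof.
  apply diffble_of_ex. intros D F p hD cF Dp.
  pose proof (Ck_is_dd 0 D F 1 p cF Dp) as H.
  exists (fun y : R => scal y (dd (V := R_NormedModule) 1 F p)).
  assert (H' : is_derive F p (dd (V := R_NormedModule) 1 F p)); [|apply H'].
  apply (is_derive_ext (fun s => F (plus p (scal (s - p) 1)))).
  - intros t. f_equal. change (p + (t - p) * 1 = t). ring.
  - evar_last. apply (is_derive_comp (fun t : R => F (plus p (scal t 1))) (fun s => s - p)).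
    + rewrite Rminus_diag. apply H.
    + auto_derive; auto.
    + apply (scal_one (dd (V := R_NormedModule) 1 F p)).
Qed.

(** The increment splits into a step in [q] at fixed [t0], controlled by [lV], and a step in [t],
    controlled by the mean value theorem; the second one costs only the oscillation of [Gt] near the
    base point. *)
Lemma filterdiff_partial (V : NormedModule R_AbsRing) (F : R * V -> R) (Gt : R * V -> R)
    (t0 : R) (q0 : V) (lV : V -> R) :
  locally ((t0, q0) : prod_NormedModule R_AbsRing R_NormedModule V)
    (fun z => is_derive (fun s : R => F (s, snd z)) (fst z) (Gt z)) ->
  continuous (Gt : prod_NormedModule R_AbsRing R_NormedModule V -> R) (t0, q0) ->
  filterdiff (fun q => F (t0, q)) (locally q0) lV ->
  filterdiff (F : prod_NormedModule R_AbsRing R_NormedModule V -> R_NormedModule) (locally (t0, q0))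
    (fun w => plus (scal (fst w) (Gt (t0, q0)) : R_NormedModule) (lV (snd w))).
Proof.
  intros dG cG fV. set (W := prod_NormedModule R_AbsRing R_NormedModule V) in *.
  split.
  { apply (is_linear_comp (fun w : W => ((scal (fst w) (Gt (t0, q0)) : R_NormedModule), lV (snd w)))
      (fun x : R_NormedModule * R_NormedModule => plus (fst x) (snd x))).
    - apply is_linear_prod.
      + apply (is_linear_comp (fun w : W => fst w) (fun x : R => scal x (Gt (t0, q0)) : R_NormedModule)).
        apply is_linear_fst. apply (is_linear_scal_l (Gt (t0, q0) : R_NormedModule)).
      + apply (is_linear_comp (fun w : W => snd w) lV). apply is_linear_snd. apply fV.
    - apply is_linear_plus. }
  intros x hx eps.
  apply (is_filter_lim_locally_unique (V := W)) in hx. rewrite <- hx; clear x hx.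
  assert (e2 : 0 < eps / 2) by (destruct eps; simpl; lra).
  destruct fV as [_ fV].
  destruct (fV q0 (fun P H => H) (mkposreal _ e2)) as [d1 H1]; simpl in H1.
  assert (cG' : locally ((t0, q0) : W) (fun z => is_derive (fun s : R => F (s, snd z)) (fst z) (Gt z) /\ Rabs (Gt z - Gt (t0, q0)) <= eps / 2)).
  { apply filter_and; [exact dG|].
    assert (LL : locally (Gt (t0, q0)) (fun y => Rabs (y - Gt (t0, q0)) <= eps / 2)).
    { exists (mkposreal _ e2). intros y hy. apply Rlt_le. apply hy. }
    apply (cG _ LL). }
  destruct cG' as [d2 H2].
  assert (d0 : 0 < Rmin d1 d2) by (apply Rmin_pos; [apply d1|apply d2]).
  exists (mkposreal _ d0). intros [t q] [bt bq]; simpl in bt, bq.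
  assert (bq1 : ball q0 d1 q) by (eapply ball_le; [|apply bq]; simpl; apply Rmin_l).
  assert (bq2 : ball q0 d2 q) by (eapply ball_le; [|apply bq]; simpl; apply Rmin_r).
  assert (bt2 : Rabs (t - t0) < d2) by (eapply Rlt_le_trans; [apply bt|]; simpl; apply Rmin_r).
  specialize (H1 q bq1).
  assert (bc : forall c, Rmin t0 t <= c <= Rmax t0 t -> ball (t0, q0) d2 ((c, q) : W)).
  { intros c hc. split; [|exact bq2]. simpl. change (Rabs (c - t0) < d2).
    eapply Rle_lt_trans; [|apply bt2]. unfold Rmin, Rmax in hc.
    destruct (Rle_dec t0 t); unfold Rabs; repeat destruct Rcase_abs; lra. }
  destruct (MVT_gen (fun s => F (s, q)) t0 t (fun s => Gt (s, q))) as [c [hc ec]].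
  { intros s hs. apply (H2 (s, q)). apply bc. lra. }
  { intros s hs. apply continuity_pt_filterlim.
    apply (ex_derive_continuous (fun s => F (s, q)) s). exists (Gt (s, q)). apply (H2 (s, q)), bc, hs. }
  specialize (H2 _ (bc c hc)) as [_ H2].
  assert (ec' : F (t, q) = F (t0, q) + Gt (c, q) * (t - t0)) by (change (F (t, q) - F (t0, q) = Gt (c, q) * (t - t0)) in ec; rewrite <- ec; ring).
  set (nn := norm (minus (t, q) (t0, q0) : W)).
  assert (n1 : Rabs (t - t0) <= nn /\ norm (minus q q0) <= nn).
  { pose proof (norm_prod (minus t t0 : R_NormedModule) (minus q q0)) as [N _].
    split; (eapply Rle_trans; [|apply N]); [apply (Rmax_l (Rabs (t - t0)))|apply Rmax_r]. }
  destruct n1 as [n1 n2].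
  change (Rabs (F (t, q) - F (t0, q0) - ((t - t0) * Gt (t0, q0) + lV (minus q q0))) <= eps * nn).
  change (Rabs (F (t0, q) - F (t0, q0) - lV (minus q q0)) <= eps / 2 * norm (minus q q0)) in H1.
  replace (F (t, q) - F (t0, q0) - ((t - t0) * Gt (t0, q0) + lV (minus q q0)))
    with ((Gt (c, q) - Gt (t0, q0)) * (t - t0) + (F (t0, q) - F (t0, q0) - lV (minus q q0)))
    by (rewrite ec'; ring).
  eapply Rle_trans; [apply Rabs_triang|]. rewrite Rabs_mult.
  assert (Rabs (Gt (c, q) - Gt (t0, q0)) * Rabs (t - t0) <= eps / 2 * nn).
  { apply Rmult_le_compat; auto; apply Rabs_pos. }
  assert (eps / 2 * norm (minus q q0) <= eps / 2 * nn) by (apply Rmult_le_compat_l; auto; lra).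
  lra.
Qed.

Lemma diffble_prod (V : NormedModule R_AbsRing) :
  diffble V -> diffble (prod_NormedModule R_AbsRing R_NormedModule V).
Proof.
  intros HV. apply diffble_of_ex. intros D F [t0 q0]. change R in t0. intros hD cF Dp.
  set (W := prod_NormedModule R_AbsRing R_NormedModule V) in *.
  set (A := fun q : V => (t0, q) : W).
  assert (cA : forall q, continuous A q).
  { intros q. apply continuous_pair; [apply continuous_const|apply continuous_id]. }
  assert (fV : filterdiff (fun q => F (t0, q)) (locally q0) (fun v => dd v (fun q => F (t0, q)) q0)).
  { apply (HV (fun q => D (A q))); auto.
    - apply (open_comp A D); [|assumption]. intros x _; apply cA.
    - apply (Ck_pre 1 D F A (fun v => (0, v) : W)); auto.
      intros p v t. unfold A. change ((t0, plus p (scal t v)) = (t0 + t * 0, plus p (scal t v))).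
      f_equal. Rring. }
  set (lV := fun v => dd v (fun q => F (t0, q)) q0) in *.
  pose (Gt := dd (V := W) ((1 : R), zero : V) F).
  assert (cG : continuous Gt (t0, q0)) by (apply (Ck_dd 0 D F); auto).
  assert (dG : forall t q, D (t, q) -> is_derive (fun s : R => F (s, q)) t (Gt (t, q))).
  { intros t q Dt. pose proof (Ck_is_dd 0 D F ((1 : R), zero : V) (t, q) cF Dt) as H.
    apply (is_derive_ext (fun s => F (plus (t, q) (scal (s - t) ((1 : R), zero : V))))).
    - intros s. f_equal. change ((t + (s - t) * 1, plus q (scal (s-t) zero)) = (s, q)).
      apply f_equal2; [Rring|]. rewrite scal_zero_r. apply plus_zero_r.
    - evar_last. apply (is_derive_comp (fun s : R => F (plus (t, q) (scal s ((1 : R), zero : V)))) (fun s => s - t)).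
      + rewrite Rminus_diag. apply H.
      + apply (is_derive_minus (fun s : R => s) (fun _ => t)); [apply (is_derive_id (K := R_AbsRing))|apply (is_derive_const t)].
      + simpl. change ((1 - 0) * Gt (t, q) = Gt (t, q)). ring. }
  exists (fun w : W => plus (scal (fst w) (Gt (t0, q0)) : R_NormedModule) (lV (snd w))).
  apply filterdiff_partial; auto.
  generalize (hD _ Dp). apply filter_imp. intros [t q] Dt. now apply dG.
Qed.

(** * Partial derivatives and chain rules in the plane and in space *)

Notation NR2 := (prod_NormedModule R_AbsRing R_NormedModule R_NormedModule).
Notation NR3 := (prod_NormedModule R_AbsRing R_NormedModule NR2).

Lemma diffble_R2 : diffble NR2.
Proof. apply diffble_prod, diffble_R. Qed.

Lemma diffble_R3 : diffble NR3.
Proof. apply diffble_prod, diffble_R2. Qed.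

Lemma plus_scal_R2 (p v : R2) (h : R) :
  plus (p : NR2) (scal h (v : NR2)) = (fst p + h * fst v, snd p + h * snd v).
Proof. reflexivity. Qed.

(** Both sides are limits of the same difference quotients, so this is an equality of total
    operators, valid without differentiability. *)
Lemma d1_dd (f : R2 -> R) : d1 f = dd (V := NR2) (1, 0) f.
Proof.
  apply (functional_extensionality (A := R2)); intros [x y]. unfold d1, dd, Derive. f_equal.
  apply Lim_ext; intros h. rewrite !plus_scal_R2; simpl.
  replace (x + (0 + h) * 1) with (x + h) by ring. replace (y + (0 + h) * 0) with y by ring.
  replace (x + 0 * 1) with x by ring. now replace (y + 0 * 0) with y by ring.
Qed.

Lemma d2_dd (f : R2 -> R) : d2 f = dd (V := NR2) (0, 1) f.
Proof.
  apply (functional_extensionality (A := R2)); intros [x y]. unfold d2, dd, Derive. f_equal.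
  apply Lim_ext; intros h. rewrite !plus_scal_R2; simpl.
  replace (x + (0 + h) * 0) with x by ring. replace (y + (0 + h) * 1) with (y + h) by ring.
  replace (x + 0 * 0) with x by ring. now replace (y + 0 * 1) with y by ring.
Qed.

Lemma line1 (F : R -> R) (t l : R) :
  is_derive (fun s : R => F (t + s * 1)) 0 l <-> is_derive F t l.
Proof.
  split; intros H.
  - apply (is_derive_ext (fun s => F (t + (s - t) * 1))); [intros s; f_equal; ring|].
    evar_last. apply (is_derive_comp (fun s : R => F (t + s * 1)) (fun s => s - t)).
    + rewrite Rminus_diag. apply H.
    + auto_derive; auto.
    + apply (scal_one l).
  - evar_last. apply (is_derive_comp F (fun s => t + s * 1)).
    + rewrite Rmult_0_l, Rplus_0_r. apply H.
    + auto_derive; auto.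
    + change (1 * 1 * l = l). ring.
Qed.

Lemma filterdiff_R2 (f p1 p2 : R2 -> R) (p : R2) (D : R2 -> Prop) :
  open (D : NR2 -> Prop) -> D p ->
  (forall p, D p -> is_derive (fun s => f (s, snd p)) (fst p) (p1 p)) ->
  (forall p, D p -> is_derive (fun s => f (fst p, s)) (snd p) (p2 p)) ->
  (forall p, D p -> continuous (p1 : NR2 -> R) p) ->
  filterdiff (f : NR2 -> R_NormedModule) (locally p) (fun v => fst v * p1 p + snd v * p2 p).
Proof.
  intros hD Dp h1 h2 c1. destruct p as [x y].
  apply (filterdiff_partial R_NormedModule f p1 x y (fun v => v * p2 (x, y))).
  - generalize (hD _ Dp). apply filter_imp. intros z Dz. now apply h1.
  - now apply c1.
  - apply (h2 (x, y) Dp).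
Qed.

Lemma is_derive_line_R2 (f p1 p2 : R2 -> R) (p v : R2) (D : R2 -> Prop) :
  open (D : NR2 -> Prop) -> D p ->
  (forall p, D p -> is_derive (fun s => f (s, snd p)) (fst p) (p1 p)) ->
  (forall p, D p -> is_derive (fun s => f (fst p, s)) (snd p) (p2 p)) ->
  (forall p, D p -> continuous (p1 : NR2 -> R) p) ->
  is_derive (fun t : R => f (plus (p : NR2) (scal t (v : NR2)))) 0 (fst v * p1 p + snd v * p2 p).
Proof.
  intros hD Dp h1 h2 c1.
  apply (filterdiff_line (V := NR2) f p (fun v => fst v * p1 p + snd v * p2 p) v).
  apply (filterdiff_R2 f p1 p2 p D); auto.
Qed.

Lemma Ck_is_d1 (k : nat) (D : R2 -> Prop) (f : R2 -> R) (p : R2) :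
  Ck (V := NR2) (S k) D f -> D p -> is_derive (fun s => f (s, snd p)) (fst p) (d1 f p).
Proof.
  intros cf Dp. pose proof (Ck_is_dd k D f (1, 0) p cf Dp) as H. rewrite d1_dd.
  apply line1. eapply is_derive_ext; [|apply H]. intros t. simpl.
  rewrite plus_scal_R2; simpl. now replace (snd p + t * 0) with (snd p) by ring.
Qed.

Lemma Ck_is_d2 (k : nat) (D : R2 -> Prop) (f : R2 -> R) (p : R2) :
  Ck (V := NR2) (S k) D f -> D p -> is_derive (fun s => f (fst p, s)) (snd p) (d2 f p).
Proof.
  intros cf Dp. pose proof (Ck_is_dd k D f (0, 1) p cf Dp) as H. rewrite d2_dd.
  apply line1. eapply is_derive_ext; [|apply H]. intros t. simpl.
  rewrite plus_scal_R2; simpl. now replace (fst p + t * 0) with (fst p) by ring.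
Qed.

Lemma Ck_d1 (k : nat) (D : R2 -> Prop) (f : R2 -> R) :
  open (D : NR2 -> Prop) -> Ck (V := NR2) (S k) D f -> Ck (V := NR2) k D (d1 f).
Proof. rewrite d1_dd. apply Ck_dd. Qed.

Lemma Ck_d2 (k : nat) (D : R2 -> Prop) (f : R2 -> R) :
  open (D : NR2 -> Prop) -> Ck (V := NR2) (S k) D f -> Ck (V := NR2) k D (d2 f).
Proof. rewrite d2_dd. apply Ck_dd. Qed.

(** The tool for functions given by integrals, limits or inverses: every directional derivative is a
    combination of the two candidate partials, so their regularity gives one more order for [f]. *)
Lemma Ck_partials (k : nat) (D : R2 -> Prop) (f p1 p2 : R2 -> R) :
  open (D : NR2 -> Prop) ->
  (forall p, D p -> is_derive (fun s => f (s, snd p)) (fst p) (p1 p)) ->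
  (forall p, D p -> is_derive (fun s => f (fst p, s)) (snd p) (p2 p)) ->
  Ck (V := NR2) k D p1 -> Ck (V := NR2) k D p2 -> Ck (V := NR2) (S k) D f.
Proof.
  intros hD h1 h2 c1 c2.
  assert (c1' : forall p, D p -> continuous (p1 : NR2 -> R) p) by (destruct k; apply c1).
  split.
  - intros p Dp. apply (filterdiff_continuous f). eexists. apply (filterdiff_R2 f p1 p2 p D); auto.
  - intros v. exists (fun p => fst v * p1 p + snd v * p2 p). split.
    + intros p Dp. apply (is_derive_line_R2 f p1 p2 p v D); auto.
    + apply (Ck_plus (W := R_NormedModule)); apply Ck_mult; auto; apply Ck_const.
Qed.

Lemma filterdiff_d12 (D : R2 -> Prop) (f : R2 -> R) (p : R2) :
  open (D : NR2 -> Prop) -> Ck (V := NR2) 1 D f -> D p ->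
  filterdiff (f : NR2 -> R_NormedModule) (locally p) (fun v => fst v * d1 f p + snd v * d2 f p).
Proof.
  intros hD cf Dp. apply (filterdiff_R2 f (d1 f) (d2 f) p D); auto.
  - intros; now apply (Ck_is_d1 0 D).
  - intros; now apply (Ck_is_d2 0 D).
  - apply (Ck_d1 0 D f hD cf).
Qed.

Lemma is_derive_comp_R2 (D : R2 -> Prop) (h : R2 -> R) (f g : R -> R) (t a b : R) :
  open (D : NR2 -> Prop) -> Ck (V := NR2) 1 D h -> D (f t, g t) ->
  is_derive f t a -> is_derive g t b ->
  is_derive (fun t => h (f t, g t)) t (a * d1 h (f t, g t) + b * d2 h (f t, g t)).
Proof.
  intros hD ch Dt hf hg.
  eapply filterdiff_ext_lin.
  - apply (filterdiff_comp' (fun t : R_AbsRing => (f t, g t) : NR2) h t).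
    + apply (is_derive_prod (V := R_NormedModule) (W := R_NormedModule) f g t a b); auto.
    + apply (filterdiff_d12 D h); auto.
  - intros y; simpl.
    change (y * a * d1 h (f t, g t) + y * b * d2 h (f t, g t)
      = y * (a * d1 h (f t, g t) + b * d2 h (f t, g t))). ring.
Qed.

Lemma Ck_comp_R2 {V : NormedModule R_AbsRing} (k : nat) (D : V -> Prop) (D' : R2 -> Prop)
    (h : R2 -> R) (F G : V -> R) :
  open (D' : NR2 -> Prop) -> Ck (V := NR2) k D' h -> Ck k D F -> Ck k D G ->
  (forall p, D p -> D' (F p, G p)) -> Ck k D (fun p => h (F p, G p)).
Proof.
  intros hD'; revert h F G; induction k as [|k IH]; intros h F G ch cF cG m.
  - split; auto. intros p Dp.
    apply (continuous_comp (fun p => (F p, G p) : NR2) h).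
    apply continuous_pair; [apply cF|apply cG]; auto. apply ch; auto.
  - split.
    + intros p Dp. apply (continuous_comp (fun p => (F p, G p) : NR2) h).
      apply continuous_pair; [apply cF|apply cG]; auto. apply ch; auto.
    + intros v. destruct (proj2 cF v) as [F' [dF cF']], (proj2 cG v) as [G' [dG cG']].
      exists (fun p => F' p * d1 h (F p, G p) + G' p * d2 h (F p, G p)). split.
      * intros p Dp.
        assert (ch1 : Ck (V := NR2) 1 D' h) by (clear - ch; induction k; auto; apply IHk; now apply Ck_S).
        pose proof (is_derive_comp_R2 D' h (fun t : R => F (plus p (scal t v)))
           (fun t : R => G (plus p (scal t v))) 0 (F' p) (G' p)) as H.
        cbv beta in H. rewrite line0 in H. apply H; auto.
      * apply (Ck_plus (W := R_NormedModule)); apply Ck_mult; auto; apply IH; auto;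
          try (now apply Ck_S); [apply Ck_d1|apply Ck_d2]; auto.
Qed.

Lemma continuous_2d (f : R2 -> R) (x y : R) :
  continuous (f : NR2 -> R) (x, y) -> continuity_2d_pt (fun u v => f (u, v)) x y.
Proof.
  intros c. apply continuity_2d_pt_filterlim.
  eapply filterlim_ext; [|apply c]. intros [a b]; reflexivity.
Qed.

Lemma d12_comm (D : R2 -> Prop) (f : R2 -> R) (p : R2) :
  open (D : NR2 -> Prop) -> Ck (V := NR2) 2 D f -> D p -> d1 (d2 f) p = d2 (d1 f) p.
Proof.
  intros hD cf Dp. destruct p as [x y].
  pose proof (Ck_d1 1 D f hD cf) as cf1. pose proof (Ck_d2 1 D f hD cf) as cf2.
  apply (Schwarz (fun u v => f (u, v)) x y).
  - assert (L : locally ((x, y) : NR2) D) by now apply hD.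
    destruct L as [e He]. exists e. intros u v hu hv.
    assert (Duv : D (u, v)) by (apply He; split; assumption).
    split; [|split; [|split]]; eexists.
    + apply (Ck_is_d1 1 D f (u, v)); auto.
    + apply (Ck_is_d2 1 D f (u, v)); auto.
    + apply (Ck_is_d1 0 D (d2 f) (u, v)); auto.
    + apply (Ck_is_d2 0 D (d1 f) (u, v)); auto.
  - apply (continuous_2d (d1 (d2 f))). apply (Ck_d1 0 D (d2 f)); auto.
  - apply (continuous_2d (d2 (d1 f))). apply (Ck_d2 0 D (d1 f)); auto.
Qed.

(** Restricting [F] to the affine plane through [p] spanned by [v] and [w] turns [dd v] and [dd w]
    into [d1] and [d2], which reduces the claim to Schwarz's theorem in the plane. *)
Lemma dd_comm {V : NormedModule R_AbsRing} (D : V -> Prop) (F : V -> R) (p v w : V) :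
  open D -> Ck 2 D F -> D p -> dd v (dd w F) p = dd w (dd v F) p.
Proof.
  intros hD cF Dp.
  set (A := fun z : NR2 => plus p (plus (scal (fst z) v) (scal (snd z) w))).
  assert (hA : forall z u (t : R), A (plus z (scal t u)) =
     plus (A z) (scal t (plus (scal (fst u) v) (scal (snd u) w)))).
  { intros [z1 z2] [a b] t. unfold A.
    assert (Lr : forall (x y : R) (u : V), scal (x + y) u = plus (scal x u) (scal y u)).
    { intros x y u. apply (scal_distr_r x y u). }
    assert (Lm : forall (x y : R) (u : V), scal (x * y) u = scal x (scal y u)).
    { intros x y u. symmetry. apply (scal_assoc x y u). }
    change (plus p (plus (scal (z1 + t * a) v) (scal (z2 + t * b) w)) =
      plus (plus p (plus (scal z1 v) (scal z2 w))) (scal t (plus (scal a v) (scal b w)))).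
    rewrite !Lr, !Lm, scal_distr_l, <- !plus_assoc. do 2 f_equal.
    rewrite plus_assoc, (plus_comm _ (scal z2 w)), <- plus_assoc. reflexivity. }
  assert (cA : forall z, continuous A z).
  { intros z. unfold A. apply (continuous_plus (fun _ => p)); [apply continuous_const|].
    apply (continuous_plus (fun z : NR2 => scal (fst z) v));
    apply (continuous_scal_l (K := R_AbsRing)); [apply continuous_fst|apply continuous_snd]. }
  assert (A0 : A (0, 0) = p).
  { unfold A; simpl. rewrite !(scal_zero_l _ : scal 0 _ = zero), plus_zero_l. apply plus_zero_r. }
  assert (E1 : forall H : V -> R, d1 (fun z => H (A z)) = fun z => dd v H (A z)).
  { intros H. apply functional_extensionality; intros z. rewrite d1_dd. unfold dd.
    apply Derive_ext; intros t. rewrite hA. simpl.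
    now rewrite (scal_one v : scal 1 v = v), (scal_zero_l w : scal 0 w = zero), plus_zero_r. }
  assert (E2 : forall H : V -> R, d2 (fun z => H (A z)) = fun z => dd w H (A z)).
  { intros H. apply functional_extensionality; intros z. rewrite d2_dd. unfold dd.
    apply Derive_ext; intros t. rewrite hA. simpl.
    now rewrite (scal_one w : scal 1 w = w), (scal_zero_l v : scal 0 v = zero), plus_zero_l. }
  pose proof (d12_comm (fun z => D (A z)) (fun z => F (A z)) (0, 0)) as H.
  rewrite E1, !E2, E1, A0 in H. apply H; auto.
  - apply (open_comp A D); auto. intros z _; apply cA.
  - apply (Ck_pre 2 D F A (fun u => plus (scal (fst u) v) (scal (snd u) w))); auto.
Qed.

Lemma dd_R3 (D : R * R2 -> Prop) (F : R * R2 -> R) (f g h : R -> R) (t a b c : R) :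
  open (D : NR3 -> Prop) -> Ck (V := NR3) 1 D F -> D (f t, (g t, h t)) ->
  is_derive f t a -> is_derive g t b -> is_derive h t c ->
  is_derive (fun t => F (f t, (g t, h t))) t
    (dd (V := NR3) (a, (b, c)) F (f t, (g t, h t))).
Proof.
  intros hD cF Dt hf hg hh.
  pose proof (diffble_R3 D F _ hD cF Dt) as H.
  eapply filterdiff_ext_lin.
  - apply (filterdiff_comp' (fun t : R_AbsRing => (f t, (g t, h t)) : NR3) F t).
    + apply (is_derive_prod (V := R_NormedModule) (W := NR2) f (fun t => (g t, h t)) t a (b, c)); auto.
      apply (is_derive_prod (V := R_NormedModule) (W := R_NormedModule) g h); auto.
    + apply H.
  - intros y; simpl. destruct H as [H _]. apply (linear_scal _ H y (a, (b, c))).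
Qed.

Lemma dd_plus {V : NormedModule R_AbsRing} (D : V -> Prop) (F : V -> R) (p v w : V) :
  diffble V -> open D -> Ck 1 D F -> D p -> dd (plus v w) F p = dd v F p + dd w F p.
Proof. intros HV hD cF Dp. destruct (HV D F p hD cF Dp) as [H _]. apply (linear_plus _ H). Qed.

Lemma dd_scal {V : NormedModule R_AbsRing} (D : V -> Prop) (F : V -> R) (p v : V) (a : R) :
  diffble V -> open D -> Ck 1 D F -> D p -> dd (scal a v) F p = a * dd v F p.
Proof. intros HV hD cF Dp. destruct (HV D F p hD cF Dp) as [H _]. apply (linear_scal _ H). Qed.

(** * Smooth functions *)

Notation sm := (@smooth NR2 R_NormedModule).
Notation open2 := (@open NR2).

Lemma smooth_ext {V W : NormedModule R_AbsRing} (D : V -> Prop) (F F' : V -> W) :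
  open D -> (forall p, D p -> F p = F' p) -> smooth D F -> smooth D F'.
Proof. intros hD e H k. now apply (Ck_ext k D F). Qed.

Lemma smooth_sub {V W : NormedModule R_AbsRing} (D D' : V -> Prop) (F : V -> W) :
  (forall p, D' p -> D p) -> smooth D F -> smooth D' F.
Proof. intros e H k. now apply (Ck_sub k D). Qed.

Lemma smooth_const {V W : NormedModule R_AbsRing} (D : V -> Prop) (c : W) : smooth D (fun _ => c).
Proof. intros k; apply Ck_const. Qed.

Lemma smooth_linear {V W : NormedModule R_AbsRing} (D : V -> Prop) (L : V -> W) :
  is_linear L -> smooth D L.
Proof. intros h k; now apply Ck_linear. Qed.

Lemma smooth_lin_post {V W Z : NormedModule R_AbsRing} (D : V -> Prop) (F : V -> W) (L : W -> Z) :
  is_linear L -> smooth D F -> smooth D (fun p => L (F p)).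
Proof. intros h H k; now apply Ck_lin_post. Qed.

Lemma smooth_pair {V W Z : NormedModule R_AbsRing} (D : V -> Prop) (F : V -> W) (F' : V -> Z) :
  smooth D F -> smooth D F' -> smooth D (fun p => (F p, F' p)).
Proof. intros H H' k; now apply Ck_pair. Qed.

Lemma smooth_plus {V : NormedModule R_AbsRing} (D : V -> Prop) (F F' : V -> R) :
  smooth D F -> smooth D F' -> smooth D (fun p => F p + F' p).
Proof. intros H H' k; now apply (Ck_plus (W := R_NormedModule)). Qed.

Lemma smooth_mult {V : NormedModule R_AbsRing} (D : V -> Prop) (F F' : V -> R) :
  smooth D F -> smooth D F' -> smooth D (fun p => F p * F' p).
Proof. intros H H' k; now apply Ck_mult. Qed.

Lemma smooth_opp {V : NormedModule R_AbsRing} (D : V -> Prop) (F : V -> R) :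
  smooth D F -> smooth D (fun p => - F p).
Proof. intros H; apply (smooth_lin_post (W := R_NormedModule) (Z := R_NormedModule) D F opp); auto. apply (is_linear_opp (V := R_NormedModule)). Qed.

Lemma smooth_minus {V : NormedModule R_AbsRing} (D : V -> Prop) (F F' : V -> R) :
  smooth D F -> smooth D F' -> smooth D (fun p => F p - F' p).
Proof. intros H H'; apply smooth_plus; auto. now apply smooth_opp. Qed.

Lemma smooth_inv {V : NormedModule R_AbsRing} (D : V -> Prop) (F : V -> R) :
  (forall p, D p -> F p <> 0) -> smooth D F -> smooth D (fun p => / F p).
Proof. intros h H k; now apply Ck_inv. Qed.

Lemma smooth_div {V : NormedModule R_AbsRing} (D : V -> Prop) (F F' : V -> R) :
  (forall p, D p -> F' p <> 0) -> smooth D F -> smooth D F' -> smooth D (fun p => F p / F' p).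
Proof. intros h H H'; apply smooth_mult; auto. now apply smooth_inv. Qed.

Lemma smooth_pow {V : NormedModule R_AbsRing} (D : V -> Prop) (F : V -> R) (n : nat) :
  smooth D F -> smooth D (fun p => F p ^ n).
Proof.
  intros H; induction n as [|n IH]; simpl; [apply (smooth_const (W := R_NormedModule))|].
  now apply smooth_mult.
Qed.

Lemma smooth_fst {V W Z : NormedModule R_AbsRing} (D : V -> Prop) (F : V -> W * Z) :
  smooth (W := prod_NormedModule R_AbsRing W Z) D F -> smooth D (fun p => fst (F p)).
Proof. apply smooth_lin_post, is_linear_fst. Qed.

Lemma smooth_snd {V W Z : NormedModule R_AbsRing} (D : V -> Prop) (F : V -> W * Z) :
  smooth (W := prod_NormedModule R_AbsRing W Z) D F -> smooth D (fun p => snd (F p)).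
Proof. apply smooth_lin_post, is_linear_snd. Qed.

Lemma smooth_id {V : NormedModule R_AbsRing} (D : V -> Prop) : smooth D (fun p : V => p).
Proof. apply smooth_linear, is_linear_id. Qed.

Lemma smooth_comp_R2 {V : NormedModule R_AbsRing} (D : V -> Prop) (D' : R2 -> Prop)
    (h : R2 -> R) (F G : V -> R) :
  open2 D' -> sm D' h -> smooth D F -> smooth D G ->
  (forall p, D p -> D' (F p, G p)) -> smooth D (fun p => h (F p, G p)).
Proof. intros o H H1 H2 m k. now apply (Ck_comp_R2 k D D'). Qed.

Lemma smooth_comp_R {V : NormedModule R_AbsRing} (D : V -> Prop) (D' : R -> Prop)
    (h : R -> R) (F : V -> R) :
  open D' -> smooth D' h -> smooth D F ->
  (forall p, D p -> D' (F p)) -> smooth D (fun p => h (F p)).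
Proof.
  intros o H HF m.
  apply (smooth_comp_R2 D (fun q => D' (fst q)) (fun q => h (fst q)) F (fun _ => 0)); auto.
  - apply (open_comp (fst : NR2 -> R_NormedModule) D'); auto. intros; apply continuous_fst.
  - intros k. apply (Ck_pre (V' := NR2) k D' h fst fst); auto. intros; apply continuous_fst.
  - apply (smooth_const (W := R_NormedModule)).
Qed.

Lemma smooth_dd {V : NormedModule R_AbsRing} (D : V -> Prop) (F : V -> R) v :
  open D -> smooth D F -> smooth D (dd v F).
Proof. intros o H k. now apply Ck_dd. Qed.

Lemma smooth_d1 (D : R2 -> Prop) (f : R2 -> R) : open2 D -> sm D f -> sm D (d1 f).
Proof. intros o H k. now apply Ck_d1. Qed.

Lemma smooth_d2 (D : R2 -> Prop) (f : R2 -> R) : open2 D -> sm D f -> sm D (d2 f).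
Proof. intros o H k. now apply Ck_d2. Qed.

Lemma is_d1 (D : R2 -> Prop) (f : R2 -> R) (x y : R) :
  sm D f -> D (x, y) -> is_derive (fun s => f (s, y)) x (d1 f (x, y)).
Proof. intros H Dp. exact (Ck_is_d1 0 D f (x, y) (H 1%nat) Dp). Qed.

Lemma is_d2 (D : R2 -> Prop) (f : R2 -> R) (x y : R) :
  sm D f -> D (x, y) -> is_derive (fun s => f (x, s)) y (d2 f (x, y)).
Proof. intros H Dp. exact (Ck_is_d2 0 D f (x, y) (H 1%nat) Dp). Qed.

Lemma smooth_d12 (D : R2 -> Prop) (f : R2 -> R) (p : R2) :
  open2 D -> sm D f -> D p -> d1 (d2 f) p = d2 (d1 f) p.
Proof. intros o H Dp. now apply (d12_comm D f p o (H 2%nat)). Qed.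

Lemma near_d1 (D : R2 -> Prop) (x y : R) : open2 D -> D (x, y) -> locally x (fun s => D (s, y)).
Proof.
  intros o Dp. destruct (o _ Dp) as [e He]. exists e. intros s hs. apply He. split; auto. apply ball_center.
Qed.

Lemma near_d2 (D : R2 -> Prop) (x y : R) : open2 D -> D (x, y) -> locally y (fun s => D (x, s)).
Proof.
  intros o Dp. destruct (o _ Dp) as [e He]. exists e. intros s hs. apply He. split; auto. apply ball_center.
Qed.

Lemma d1_ext (D : R2 -> Prop) (f g : R2 -> R) p :
  open2 D -> D p -> (forall q, D q -> f q = g q) -> d1 f p = d1 g p.
Proof.
  intros o Dp e. destruct p as [x y]. apply Derive_ext_loc; simpl.
  generalize (near_d1 D x y o Dp). apply filter_imp. intros; now apply e.
Qed.

Lemma d2_ext (D : R2 -> Prop) (f g : R2 -> R) p :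
  open2 D -> D p -> (forall q, D q -> f q = g q) -> d2 f p = d2 g p.
Proof.
  intros o Dp e. destruct p as [x y]. apply Derive_ext_loc; simpl.
  generalize (near_d2 D x y o Dp). apply filter_imp. intros; now apply e.
Qed.

(** * Derivatives of expressions *)

Lemma der_eq (f : R -> R) (x l l' : R) : is_derive f x l -> l = l' -> is_derive f x l'.
Proof. now intros H <-. Qed.

Lemma der_plus (f g : R -> R) x a b :
  is_derive f x a -> is_derive g x b -> is_derive (fun s => f s + g s) x (a + b).
Proof. intros; now apply (is_derive_plus f g). Qed.

Lemma der_minus (f g : R -> R) x a b :
  is_derive f x a -> is_derive g x b -> is_derive (fun s => f s - g s) x (a - b).
Proof. intros; now apply (is_derive_minus f g). Qed.

Lemma der_opp (f : R -> R) x a : is_derive f x a -> is_derive (fun s => - f s) x (- a).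
Proof. intros; now apply (is_derive_opp f). Qed.

Lemma der_mult (f g : R -> R) x a b :
  is_derive f x a -> is_derive g x b -> is_derive (fun s => f s * g s) x (a * g x + f x * b).
Proof. intros; apply (is_derive_mult f g); auto. intros; apply Rmult_comm. Qed.

Lemma der_inv (f : R -> R) x a :
  f x <> 0 -> is_derive f x a -> is_derive (fun s => / f s) x (- a / f x ^ 2).
Proof. intros; now apply is_derive_inv. Qed.

Lemma der_div (f g : R -> R) x a b : g x <> 0 ->
  is_derive f x a -> is_derive g x b -> is_derive (fun s => f s / g s) x ((a * g x - f x * b) / g x ^ 2).
Proof. intros; now apply is_derive_div. Qed.

Lemma der_pow (f : R -> R) x a n :
  is_derive f x a -> is_derive (fun s => f s ^ n) x (INR n * a * f x ^ pred n).
Proof. intros; now apply is_derive_pow. Qed.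

Lemma der_const (c : R) x : is_derive (fun _ : R => c) x 0.
Proof. apply (is_derive_const c). Qed.

Lemma der_id x : is_derive (fun s : R => s) x 1.
Proof. apply (is_derive_id (K := R_AbsRing)). Qed.

(** Differentiates along the syntax of the expression and hands atoms to [leaf]; with [leaf1] or
    [leaf2] the result is expressed through [d1] or [d2] of the atoms. Nonvanishing of denominators
    is left as a goal. *)
Ltac der leaf :=
  lazymatch goal with
  | |- is_derive (fun _ => ?c) _ _ => apply der_const
  | |- is_derive (fun s => s) _ _ => apply der_id
  | |- is_derive (fun s => @?f s + @?g s) _ _ => apply (der_plus f g); cbv beta; der leaf
  | |- is_derive (fun s => @?f s - @?g s) _ _ => apply (der_minus f g); cbv beta; der leaf
  | |- is_derive (fun s => - @?f s) _ _ => apply (der_opp f); cbv beta; der leaf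
  | |- is_derive (fun s => @?f s * @?g s) _ _ => apply (der_mult f g); cbv beta; der leaf
  | |- is_derive (fun s => @?f s / @?g s) _ _ => apply (der_div f g); cbv beta; [|der leaf|der leaf]
  | |- is_derive (fun s => / @?f s) _ _ => apply (der_inv f); cbv beta; [|der leaf]
  | |- is_derive (fun s => @?f s ^ ?n) _ _ => apply (der_pow f); cbv beta; der leaf
  | |- is_derive _ _ _ => leaf
  | |- _ => idtac
  end.

Ltac smt :=
  lazymatch goal with
  | |- @smooth ?V _ ?D (fun _ => ?c) => exact (@smooth_const V R_NormedModule D c)
  | |- smooth _ (fun s => @?f s + @?g s) => apply (smooth_plus _ f g); cbv beta; smt
  | |- smooth _ (fun s => @?f s - @?g s) => apply (smooth_minus _ f g); cbv beta; smt
  | |- smooth _ (fun s => - @?f s) => apply (smooth_opp _ f); cbv beta; smt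
  | |- smooth _ (fun s => @?f s * @?g s) => apply (smooth_mult _ f g); cbv beta; smt
  | |- smooth _ (fun s => @?f s / @?g s) => apply (smooth_div _ f g); cbv beta; [|smt|smt]
  | |- smooth _ (fun s => / @?f s) => apply (smooth_inv _ f); cbv beta; [|smt]
  | |- smooth _ (fun s => @?f s ^ ?n) => apply (smooth_pow _ f); cbv beta; smt
  | |- smooth _ (fun s => d1 ?f s) => apply (smooth_d1 _ f); [assumption|smt]
  | |- smooth _ (fun s => d2 ?f s) => apply (smooth_d2 _ f); [assumption|smt]
  | |- smooth _ (d1 ?f) => apply (smooth_d1 _ f); [assumption|smt]
  | |- smooth _ (d2 ?f) => apply (smooth_d2 _ f); [assumption|smt]
  | |- smooth _ (dd _ ?f) => apply (smooth_dd _ f); [assumption|smt]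
  | |- smooth _ (fun s => dd _ ?f s) => apply (smooth_dd _ f); [assumption|smt]
  | |- smooth _ _ => solve [assumption | auto]
  | |- _ => idtac
  end.

Ltac leaf1 D := apply (is_d1 D); [smt|try assumption].
Ltac leaf2 D := apply (is_d2 D); [smt|try assumption].

(** * Linear differential equations depending on a parameter *)

Definition box (x0 y0 r : R) (p : R2) : Prop := Rabs (fst p - x0) < r /\ Rabs (snd p - y0) < r.

Lemma continuous_Rabs_minus (c : R) (x : R) : continuous (fun x => Rabs (x - c)) x.
Proof.
  apply (continuous_comp (fun x => x - c) Rabs).
  - apply (ex_derive_continuous (fun x => x - c)). auto_derive; auto.
  - apply continuous_Rabs.
Qed.

Lemma open_box x0 y0 r : open2 (box x0 y0 r).
Proof.
  apply (open_and (T := NR2)).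
  - apply (open_comp (fun p : NR2 => Rabs (fst p - x0)) (fun z => z < r)); [|apply open_lt].
    intros p _. apply (continuous_comp (fst : NR2 -> R) (fun x => Rabs (x - x0))).
    apply continuous_fst. apply continuous_Rabs_minus.
  - apply (open_comp (fun p : NR2 => Rabs (snd p - y0)) (fun z => z < r)); [|apply open_lt].
    intros p _. apply (continuous_comp (snd : NR2 -> R) (fun x => Rabs (x - y0))).
    apply continuous_snd. apply continuous_Rabs_minus.
Qed.

Lemma box_seg x0 y0 r x y s :
  box x0 y0 r (x, y) -> Rmin y0 y <= s <= Rmax y0 y -> box x0 y0 r (x, s).
Proof.
  intros [h1 h2] hs; split; auto; simpl in *.
  unfold Rmin, Rmax in hs. destruct (Rle_dec y0 y); unfold Rabs in *; repeat destruct Rcase_abs; lra.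
Qed.

Definition prim (y0 : R) (f : R2 -> R) (p : R2) : R := RInt (fun s => f (fst p, s)) y0 (snd p).

Lemma sm_continuous (D : R2 -> Prop) (f : R2 -> R) p : sm D f -> D p -> continuous (f : NR2 -> R) p.
Proof. intros H Dp. now apply (H 0%nat). Qed.

Lemma sm_ex_RInt x0 y0 r (f : R2 -> R) x y : sm (box x0 y0 r) f -> box x0 y0 r (x, y) ->
  ex_RInt (fun s => f (x, s)) y0 y.
Proof.
  intros hf Dp. apply (ex_RInt_continuous (V := R_CompleteNormedModule)). intros s hs.
  apply (ex_derive_continuous (fun s => f (x, s))). exists (d2 f (x, s)).
  apply (is_d2 (box x0 y0 r)); auto. now apply (box_seg x0 y0 r x y).
Qed.

Lemma prim_d2 x0 y0 r (f : R2 -> R) x y : sm (box x0 y0 r) f -> box x0 y0 r (x, y) ->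
  is_derive (fun s => prim y0 f (x, s)) y (f (x, y)).
Proof.
  intros hf Dp. apply (is_derive_RInt (fun s => f (x, s)) (fun y => RInt (fun s => f (x, s)) y0 y) y0 y).
  - generalize (near_d2 _ x y (open_box x0 y0 r) Dp). apply filter_imp. intros s hs.
    apply (RInt_correct (V := R_CompleteNormedModule)). now apply (sm_ex_RInt x0 y0 r).
  - apply (ex_derive_continuous (fun s => f (x, s))). exists (d2 f (x, y)).
    now apply (is_d2 (box x0 y0 r)).
Qed.

Lemma prim_d1 x0 y0 r (f : R2 -> R) x y : sm (box x0 y0 r) f -> box x0 y0 r (x, y) ->
  is_derive (fun s => prim y0 f (s, y)) x (prim y0 (d1 f) (x, y)).
Proof.
  intros hf Dp. unfold prim; simpl.
  apply (is_derive_RInt_param (fun x t => f (x, t)) y0 y x).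
  - generalize (near_d1 _ x y (open_box x0 y0 r) Dp). apply filter_imp. intros s hs t ht.
    exists (d1 f (s, t)). apply (is_d1 (box x0 y0 r)); auto. now apply (box_seg x0 y0 r s y).
  - intros t ht. apply (continuous_2d (d1 f)). apply (sm_continuous (box x0 y0 r)).
    apply smooth_d1; auto; apply open_box. now apply (box_seg x0 y0 r x y).
  - generalize (near_d1 _ x y (open_box x0 y0 r) Dp). apply filter_imp. intros s hs.
    now apply (sm_ex_RInt x0 y0 r).
Qed.

(** Joint continuity follows from continuity in the first variable along one horizontal line and a
    Lipschitz bound in the second variable that is uniform near the point; the Lipschitz constant is
    a local bound [K] of the integrand. *)
Lemma prim_continuous x0 y0 r (f : R2 -> R) p : sm (box x0 y0 r) f -> box x0 y0 r p ->
  continuous (prim y0 f : NR2 -> R) p.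
Proof.
  intros hf Dp. destruct p as [x y].
  set (K := Rabs (f (x, y)) + 1).
  assert (LB : locally ((x, y) : NR2) (fun q => box x0 y0 r q /\ Rabs (f q) < K)).
  { apply filter_and; [now apply open_box|].
    assert (CA : continuous (fun q : NR2 => Rabs (f q)) (x, y)).
    { apply (continuous_comp (f : NR2 -> R) Rabs); [now apply (sm_continuous (box x0 y0 r))|apply continuous_Rabs]. }
    apply (CA (fun z => z < K)). apply (open_lt K). unfold K; lra. }
  assert (Kp : 0 < K) by (unfold K; pose proof (Rabs_pos (f (x, y))); lra).
  destruct LB as [e He].
  intros P [eps HP].
  assert (Cx : continuous (fun s => prim y0 f (s, y)) x).
  { apply (ex_derive_continuous (fun s => prim y0 f (s, y))). eexists. now apply (prim_d1 x0 y0 r). }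
  assert (e2 : 0 < eps / 2) by (destruct eps; simpl; lra).
  destruct (Cx (ball (prim y0 f (x, y)) (mkposreal _ e2)) (locally_ball _ _)) as [d Hd].
  assert (m0 : 0 < Rmin (Rmin e d) (eps / 2 / K)).
  { repeat apply Rmin_pos; try apply cond_pos. apply Rdiv_lt_0_compat; lra. }
  exists (mkposreal _ m0). intros [x' y']. change R in x'. change R in y'. intros [hx hy]; simpl in hx, hy.
  assert (hxe : ball x e x') by (eapply ball_le; [|apply hx]; simpl; eapply Rle_trans; [apply Rmin_l|apply Rmin_l]).
  assert (hxd : ball x d x') by (eapply ball_le; [|apply hx]; simpl; eapply Rle_trans; [apply Rmin_l|apply Rmin_r]).
  assert (hye : Rabs (y' - y) < e) by (eapply Rlt_le_trans; [apply hy|]; simpl; eapply Rle_trans; [apply Rmin_l|apply Rmin_l]).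
  assert (hyK : Rabs (y' - y) < eps / 2 / K) by (eapply Rlt_le_trans; [apply hy|]; simpl; apply Rmin_r).
  assert (B : forall s, Rmin y y' <= s <= Rmax y y' -> box x0 y0 r (x', s) /\ Rabs (f (x', s)) < K).
  { intros s hs. apply He. split; [exact hxe|]. change (Rabs (s - y) < e).
    eapply Rle_lt_trans; [|apply hye].
    unfold Rmin, Rmax in hs. destruct (Rle_dec y y'); unfold Rabs in *; repeat destruct Rcase_abs; lra. }
  apply HP. change (Rabs (prim y0 f (x', y') - prim y0 f (x, y)) < eps).
  specialize (Hd x' hxd). change (Rabs (prim y0 f (x', y) - prim y0 f (x, y)) < eps / 2) in Hd.
  destruct (MVT_gen (fun s => prim y0 f (x', s)) y y' (fun s => f (x', s))) as [c [hc ec]].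
  { intros s hs. apply (prim_d2 x0 y0 r); auto. apply B; lra. }
  { intros s hs. apply continuity_pt_filterlim.
    apply (ex_derive_continuous (fun s => prim y0 f (x', s)) s). eexists.
    apply (prim_d2 x0 y0 r); auto. apply B; lra. }
  destruct (B c hc) as [_ Bc].
  replace (prim y0 f (x', y') - prim y0 f (x, y)) with
    ((prim y0 f (x', y') - prim y0 f (x', y)) + (prim y0 f (x', y) - prim y0 f (x, y))) by ring.
  eapply Rle_lt_trans; [apply Rabs_triang|]. cbv beta in ec. rewrite ec, Rabs_mult.
  assert (Rabs (f (x', c)) * Rabs (y' - y) <= K * (eps / 2 / K)).
  { apply Rmult_le_compat; try apply Rabs_pos; lra. }
  replace (K * (eps / 2 / K)) with (eps / 2) in H by (field; lra). lra.
Qed.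

(** The partials of a primitive are the primitive of [d1 f] and [f] itself, so the induction on the
    order has to run over all integrands. *)
Lemma prim_smooth x0 y0 r (f : R2 -> R) : sm (box x0 y0 r) f -> sm (box x0 y0 r) (prim y0 f).
Proof.
  intros hf k; revert f hf; induction k as [|k IH]; intros f hf.
  - split; auto. intros p Dp. now apply (prim_continuous x0 y0 r).
  - apply (Ck_partials k _ _ (prim y0 (d1 f)) f); [apply open_box| | | |].
    + intros [x y] Dp. now apply (prim_d1 x0 y0 r).
    + intros [x y] Dp. now apply (prim_d2 x0 y0 r).
    + apply IH. apply smooth_d1; auto. apply open_box.
    + apply hf.
Qed.

Lemma prim0 y0 (f : R2 -> R) x : prim y0 f (x, y0) = 0.
Proof. unfold prim. simpl. apply (RInt_point (V := R_CompleteNormedModule)). Qed.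

(** The closed square of radius [r] lies in the larger box, so compactness gives a step length [d]
    over which [f] changes by less than 2; the centre is joined to any point of the box by [S N]
    such steps. *)
Lemma bounded_box x0 y0 r r' (f : R2 -> R) : 0 < r < r' -> sm (box x0 y0 r') f ->
  exists K, forall p, box x0 y0 r p -> Rabs (f p) <= K.
Proof.
  intros hr hf.
  assert (L : forall u v, exists d : posreal, box x0 y0 r' (u, v) ->
     forall q, Rabs (fst q - u) < 2 * d -> Rabs (snd q - v) < 2 * d -> Rabs (f q - f (u, v)) < 1).
  { intros u v. destruct (classic (box x0 y0 r' (u, v))) as [Duv|n]; [|exists (mkposreal 1 Rlt_0_1); tauto].
    pose proof (sm_continuous _ f (u, v) hf Duv) as C.
    destruct (C (ball (f (u, v)) (mkposreal 1 Rlt_0_1)) (locally_ball _ _)) as [d Hd].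
    (* Half of the continuity radius: below, a point is within [delta u v] of the centre of its cell
       and its neighbour within a further [d], and both must stay inside the full radius. *)
    exists (pos_div_2 d). intros _ q h1 h2. simpl in h1, h2. apply (Hd q).
    split; [change (Rabs (fst q - u) < d)|change (Rabs (snd q - v) < d)]; lra. }
  pose (delta := fun u v => proj1_sig (constructive_indefinite_description _ (L u v))).
  assert (Hdelta : forall u v, box x0 y0 r' (u, v) ->
     forall q, Rabs (fst q - u) < 2 * delta u v -> Rabs (snd q - v) < 2 * delta u v -> Rabs (f q - f (u, v)) < 1).
  { intros u v. unfold delta. destruct constructive_indefinite_description as [d Hd]. exact Hd. }
  destruct (compactness_value_2d (x0 - r) (x0 + r) (y0 - r) (y0 + r) delta) as [d Hd].
  assert (U : forall p q, box x0 y0 r p -> Rabs (fst q - fst p) < d -> Rabs (snd q - snd p) < d -> Rabs (f q - f p) < 2).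
  { intros [a b] q [h1 h2] h3 h4; simpl in *. apply Rabs_def2 in h1, h2.
    destruct (Rlt_dec (Rabs (f q - f (a, b))) 2) as [|n]; auto. exfalso.
    apply (Hd a b); [lra|lra|]. intros (u & v & hu & hv & hau & hbv & hd). apply n.
    assert (Duv : box x0 y0 r' (u, v)) by (split; simpl; apply Rabs_def1; lra).
    pose proof (Hdelta u v Duv (a, b)) as H1. pose proof (Hdelta u v Duv q) as H2. simpl in H1.
    assert (0 < delta u v) by apply cond_pos.
    specialize (H1 ltac:(lra) ltac:(lra)).
    assert (Rabs (fst q - u) <= Rabs (fst q - a) + Rabs (a - u)) by (replace (fst q - u) with ((fst q - a) + (a - u)) by ring; apply Rabs_triang).
    assert (Rabs (snd q - v) <= Rabs (snd q - b) + Rabs (b - v)) by (replace (snd q - v) with ((snd q - b) + (b - v)) by ring; apply Rabs_triang).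
    specialize (H2 ltac:(lra) ltac:(lra)).
    replace (f q - f (a, b)) with ((f q - f (u, v)) - (f (a, b) - f (u, v))) by ring.
    eapply Rle_lt_trans; [apply Rabs_triang|]. rewrite Rabs_Ropp. lra. }
  (* [INR N + 1] exceeds [r / d], so steps of length at most [r / (INR N + 1)] are shorter than
     [d]. *)
  destruct (nfloor_ex (r / d)) as [N [_ HN]]; [apply Rlt_le, Rdiv_lt_0_compat; [lra|apply cond_pos]|].
  exists (Rabs (f (x0, y0)) + 2 * (INR N + 1)). intros [x y] [hx hy]; simpl in hx, hy.
  assert (Np : 0 < INR N + 1) by (pose proof (pos_INR N); lra).
  set (q := fun k : nat => (x0 + INR k / (INR N + 1) * (x - x0), y0 + INR k / (INR N + 1) * (y - y0)) : R2).
  assert (dp : 0 < d) by apply cond_pos.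
  assert (rd : r / (INR N + 1) < d).
  { apply Rmult_lt_reg_r with (INR N + 1); auto. unfold Rdiv. rewrite Rmult_assoc, Rinv_l by lra.
    rewrite Rmult_1_r. apply Rmult_lt_reg_r with (/ d); [now apply Rinv_0_lt_compat|].
    replace (d * (INR N + 1) * / d) with (INR N + 1) by (field; lra). exact HN. }
  assert (Q : forall k, (k <= S N)%nat -> Rabs (f (q k) - f (x0, y0)) <= 2 * INR k).
  { induction k as [|k IH]; intros hk.
    - replace (q 0%nat) with ((x0, y0) : R2) by (unfold q; simpl; f_equal; field; lra).
      rewrite Rminus_diag, Rabs_R0. simpl. lra.
    - specialize (IH ltac:(lia)). rewrite S_INR.
      replace (f (q (S k)) - f (x0, y0)) with ((f (q (S k)) - f (q k)) + (f (q k) - f (x0, y0))) by ring.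
      eapply Rle_trans; [apply Rabs_triang|].
      assert (St : forall w, Rabs w < r -> Rabs (INR (S k) / (INR N + 1) * w - INR k / (INR N + 1) * w) < d).
      { intros w hw. rewrite S_INR.
        replace ((INR k + 1) / (INR N + 1) * w - INR k / (INR N + 1) * w) with (w / (INR N + 1)) by (field; lra).
        unfold Rdiv. rewrite Rabs_mult, (Rabs_pos_eq (/ _)) by (apply Rlt_le; now apply Rinv_0_lt_compat).
        eapply Rle_lt_trans; [|apply rd]. apply Rmult_le_compat_r; [apply Rlt_le; now apply Rinv_0_lt_compat|lra]. }
      assert (Bk : forall w, Rabs w < r -> Rabs (INR k / (INR N + 1) * w) < r).
      { intros w hw. rewrite Rabs_mult. rewrite (Rabs_pos_eq (INR k / _)).
        2: apply Rmult_le_pos; [apply pos_INR|apply Rlt_le; now apply Rinv_0_lt_compat].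
        eapply Rle_lt_trans; [|apply hw]. rewrite <- (Rmult_1_l (Rabs w)) at 2.
        apply Rmult_le_compat_r; [apply Rabs_pos|].
        apply Rmult_le_reg_r with (INR N + 1); auto. unfold Rdiv. rewrite Rmult_assoc, Rinv_l by lra.
        apply le_INR in hk. rewrite !S_INR in hk. lra. }
      assert (Rabs (f (q (S k)) - f (q k)) < 2); [|lra].
      apply U; unfold q; cbn [fst snd].
      + split; cbn [fst snd]; [replace (x0 + INR k / (INR N + 1) * (x - x0) - x0) with (INR k / (INR N + 1) * (x - x0)) by ring
         |replace (y0 + INR k / (INR N + 1) * (y - y0) - y0) with (INR k / (INR N + 1) * (y - y0)) by ring]; auto.
      + replace (x0 + INR (S k) / (INR N + 1) * (x - x0) - (x0 + INR k / (INR N + 1) * (x - x0)))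
         with (INR (S k) / (INR N + 1) * (x - x0) - INR k / (INR N + 1) * (x - x0)) by ring. auto.
      + replace (y0 + INR (S k) / (INR N + 1) * (y - y0) - (y0 + INR k / (INR N + 1) * (y - y0)))
         with (INR (S k) / (INR N + 1) * (y - y0) - INR k / (INR N + 1) * (y - y0)) by ring. auto. }
  specialize (Q (S N) (le_n _)). rewrite S_INR in Q.
  replace (q (S N)) with ((x, y) : R2) in Q by (unfold q; rewrite S_INR; f_equal; field; lra).
  replace (f (x, y)) with ((f (x, y) - f (x0, y0)) + f (x0, y0)) by ring.
  eapply Rle_trans; [apply Rabs_triang|]. lra.
Qed.

(** * Finite sums over index lists, exponential comparison and geometric limits *)

Fixpoint sumL {T : Type} (l : list T) (g : T -> R) : R :=
  match l with nil => 0 | cons j l => g j + sumL l g end.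

Lemma sumL_ext {T : Type} (l : list T) (g h : T -> R) : (forall j, g j = h j) -> sumL l g = sumL l h.
Proof. intros e. induction l; simpl; congruence. Qed.

Lemma sumL_plus {T : Type} (l : list T) (g h : T -> R) :
  sumL l (fun j => g j + h j) = sumL l g + sumL l h.
Proof. induction l; simpl; lra. Qed.

Lemma sumL_minus {T : Type} (l : list T) (g h : T -> R) :
  sumL l (fun j => g j - h j) = sumL l g - sumL l h.
Proof. induction l; simpl; lra. Qed.

Lemma sumL_0 {T : Type} (l : list T) : sumL l (fun _ => 0) = 0.
Proof. induction l; simpl; lra. Qed.

Lemma sumL_app {T : Type} (l l' : list T) (g : T -> R) : sumL (l ++ l') g = sumL l g + sumL l' g.
Proof. induction l; simpl; lra. Qed.

Lemma sumL_map {S T : Type} (l : list S) (f : S -> T) (g : T -> R) :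
  sumL (map f l) g = sumL l (fun j => g (f j)).
Proof. induction l; simpl; congruence. Qed.

Lemma sumL_abs {T : Type} (l : list T) (g : T -> R) K :
  (forall j, Rabs (g j) <= K) -> Rabs (sumL l g) <= INR (length l) * K.
Proof.
  intros h. induction l as [|j l IH]; simpl length; simpl sumL.
  - rewrite Rabs_R0. simpl; lra.
  - rewrite S_INR. eapply Rle_trans; [apply Rabs_triang|]. specialize (h j). lra.
Qed.

Lemma Ck_sumL {T : Type} {V : NormedModule R_AbsRing} (k : nat) (D : V -> Prop) (l : list T) (g : T -> V -> R) :
  (forall j, Ck k D (g j)) -> Ck k D (fun p => sumL l (fun j => g j p)).
Proof.
  intros h. induction l; simpl; [apply (Ck_const (W := R_NormedModule))|].
  now apply (Ck_plus (W := R_NormedModule)).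
Qed.

Lemma smooth_sumL {T : Type} {V : NormedModule R_AbsRing} (D : V -> Prop) (l : list T) (g : T -> V -> R) :
  (forall j, smooth D (g j)) -> smooth D (fun p => sumL l (fun j => g j p)).
Proof. intros h k. apply Ck_sumL. intros j; apply h. Qed.

Lemma der_sumL {T : Type} (l : list T) (g : T -> R -> R) (x : R) (a : T -> R) :
  (forall j, is_derive (g j) x (a j)) -> is_derive (fun s => sumL l (fun j => g j s)) x (sumL l a).
Proof.
  intros h. induction l; simpl; [apply der_const|]. now apply der_plus.
Qed.

(** Integrating a bound with the weight [exp (lam * (s - y0))] gains a factor [1 / lam], so a large
    [lam] makes the Picard step contract on the whole interval. The reason is that
    [B / lam * exp (lam * (s - y0)) - e * g s] is nondecreasing for both signs [e]. *)
Lemma exp_compare_r y0 y (g f : R -> R) B lam : 0 < lam -> 0 <= B -> y0 <= y ->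
  (forall s, y0 <= s <= y -> is_derive g s (f s)) -> g y0 = 0 ->
  (forall s, y0 <= s <= y -> Rabs (f s) <= B * exp (lam * (s - y0))) ->
  Rabs (g y) <= B / lam * exp (lam * (y - y0)).
Proof.
  intros hl hB hy hg g0 hf.
  assert (K : forall e, Rabs e = 1 -> e * g y <= B / lam * exp (lam * (y - y0))).
  { intros e he.
    destruct (MVT_gen (fun s => B / lam * exp (lam * (s - y0)) - e * g s) y0 y
      (fun s => B * exp (lam * (s - y0)) - e * f s)) as [c [hc ec]].
    - rewrite Rmin_left, Rmax_right by lra. intros s hs.
      eapply der_eq; [apply der_minus|].
      + instantiate (1 := B * exp (lam * (s - y0))). auto_derive; auto. unfold Rminus. field; lra.
      + apply der_mult; [apply der_const|]. apply hg; lra.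
      + simpl. ring.
    - rewrite Rmin_left, Rmax_right by lra. intros s hs. apply continuity_pt_filterlim.
      apply (ex_derive_continuous (fun s => B / lam * exp (lam * (s - y0)) - e * g s)).
      eexists. apply der_minus.
      + instantiate (1 := B * exp (lam * (s - y0))). auto_derive; auto. unfold Rminus. field; lra.
      + apply der_mult; [apply der_const|]. apply hg; lra.
    - rewrite Rmin_left, Rmax_right in hc by lra. rewrite g0 in ec.
      rewrite Rminus_diag, Rmult_0_r, exp_0 in ec.
      assert (0 <= B / lam) by (apply Rmult_le_pos; [lra|apply Rlt_le; now apply Rinv_0_lt_compat]).
      assert (0 <= (B * exp (lam * (c - y0)) - e * f c) * (y - y0)).
      { apply Rmult_le_pos; [|lra]. specialize (hf c hc).
        assert (e * f c <= Rabs (f c)).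
        { eapply Rle_trans; [apply Rle_abs|]. rewrite Rabs_mult, he. lra. } lra. }
      lra. }
  pose proof (K 1 Rabs_R1). pose proof (K (-1) ltac:(rewrite Rabs_left; lra)).
  apply Rabs_le; lra.
Qed.

(** To the left of [y0] the one-sided estimate is applied after the reflection of [s] to
    [2 * y0 - s]. *)
Lemma exp_compare y0 r (g f : R -> R) B lam : 0 < lam -> 0 <= B ->
  (forall s, Rabs (s - y0) < r -> is_derive g s (f s)) -> g y0 = 0 ->
  (forall s, Rabs (s - y0) < r -> Rabs (f s) <= B * exp (lam * Rabs (s - y0))) ->
  forall y, Rabs (y - y0) < r -> Rabs (g y) <= B / lam * exp (lam * Rabs (y - y0)).
Proof.
  intros hl hB hg g0 hf y hy. destruct (Rle_dec y0 y) as [h|h].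
  - rewrite (Rabs_pos_eq (y - y0)) by lra.
    rewrite (Rabs_pos_eq (y - y0)) in hy by lra.
    apply (exp_compare_r y0 y g f); auto.
    + intros s hs. apply hg. rewrite Rabs_pos_eq; lra.
    + intros s hs. rewrite <- (Rabs_pos_eq (s - y0)) by lra. apply hf. rewrite Rabs_pos_eq; lra.
  - rewrite (Rabs_left (y - y0)) in * by lra.
    replace (- (y - y0)) with ((2 * y0 - y) - y0) by ring.
    replace (g y) with ((fun s => g (2 * y0 - s)) (2 * y0 - y)) by (simpl; f_equal; ring).
    apply (exp_compare_r y0 (2 * y0 - y) (fun s => g (2 * y0 - s)) (fun s => - f (2 * y0 - s))); auto; try lra.
    + intros s hs. evar_last.
      apply (is_derive_comp g (fun s => 2 * y0 - s)); [apply hg; rewrite Rabs_left1; lra|].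
      apply der_minus; [apply der_const|apply der_id].
      change ((0 - 1) * f (2 * y0 - s) = - f (2 * y0 - s)). ring.
    + simpl. replace (2 * y0 - y0) with y0 by ring. exact g0.
    + intros s hs. rewrite Rabs_Ropp.
      replace (s - y0) with (Rabs (2 * y0 - s - y0)) by (rewrite Rabs_left1; lra).
      apply hf. rewrite Rabs_left1; lra.
Qed.

(** Summing the increments from [n] to [n + k] gives the bound [2 * A * ((1 / 2) ^ n - (1 / 2) ^ (n
    + k))], which yields the Cauchy property and the rate together. *)
Lemma geometric_limit (u : nat -> R) A : (forall m, Rabs (u (S m) - u m) <= A * (1 / 2) ^ m) ->
  forall n, Rabs (u n - Lim_seq u) <= 2 * A * (1 / 2) ^ n.
Proof.
  intros h.
  assert (T : forall k n, Rabs (u (n + k)%nat - u n) <= 2 * A * ((1 / 2) ^ n - (1 / 2) ^ (n + k))).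
  { induction k as [|k IH]; intros n.
    - rewrite Nat.add_0_r, !Rminus_diag, Rabs_R0. lra.
    - rewrite Nat.add_succ_r. replace (u (S (n + k)) - u n) with ((u (S (n + k)) - u (n + k)%nat) + (u (n + k)%nat - u n)) by ring.
      eapply Rle_trans; [apply Rabs_triang|]. specialize (IH n). specialize (h (n + k)%nat). simpl. lra. }
  assert (A0 : 0 <= A).
  { specialize (h 0%nat). simpl in h. pose proof (Rabs_pos (u 1%nat - u 0%nat)). lra. }
  assert (P : forall n, 0 < (1 / 2) ^ n) by (intros; apply pow_lt; lra).
  assert (C : ex_finite_lim_seq u).
  { apply ex_lim_seq_cauchy_corr. intros eps.
    assert (G : is_lim_seq (fun n => 4 * A * (1 / 2) ^ n) 0).
    { replace 0 with (4 * A * 0) by ring. apply (is_lim_seq_scal_l _ _ 0). apply is_lim_seq_geom. rewrite Rabs_pos_eq; lra. }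
    apply is_lim_seq_spec in G. destruct (G eps) as [N HN]. exists N.
    assert (Q : forall n, (N <= n)%nat -> Rabs (u n - u N) <= 2 * A * (1 / 2) ^ N).
    { intros n hn. replace n with (N + (n - N))%nat by lia. eapply Rle_trans; [apply T|].
      apply Rmult_le_compat_l; [lra|]. specialize (P (N + (n - N))%nat). lra. }
    intros n m hn hm. specialize (HN N (le_n _)). rewrite Rminus_0_r in HN.
    replace (u n - u m) with ((u n - u N) - (u m - u N)) by ring.
    eapply Rle_lt_trans; [apply Rabs_triang|]. rewrite Rabs_Ropp.
    pose proof (Q n hn). pose proof (Q m hm). pose proof (Rle_abs (4 * A * (1 / 2) ^ N)). lra. }
  apply Lim_seq_correct' in C. intros n.
  assert (L : is_lim_seq (fun k => Rabs (u n - u (k + n)%nat)) (Rabs (u n - Lim_seq u))).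
  { apply (is_lim_seq_abs _ (u n - Lim_seq u)).
    apply is_lim_seq_minus'; [apply is_lim_seq_const|]. now apply (is_lim_seq_incr_n u n). }
  apply (is_lim_seq_le _ (fun _ => 2 * A * (1 / 2) ^ n) _ (2 * A * (1 / 2) ^ n)) in L; auto.
  - intros k. rewrite Rabs_minus_sym, Nat.add_comm. eapply Rle_trans; [apply T|].
    apply Rmult_le_compat_l; [lra|]. specialize (P (n + k)%nat). lra.
  - apply is_lim_seq_const.
Qed.

Lemma CVU_of_bound (f : nat -> R -> R) (D : R -> Prop) A :
  (forall n x, D x -> Rabs (f n x - Lim_seq (fun n => f n x)) <= A * (1 / 2) ^ n) -> CVU_dom f D.
Proof.
  intros h eps.
  assert (G : is_lim_seq (fun n => A * (1 / 2) ^ n) 0).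
  { replace 0 with (A * 0) by ring. apply (is_lim_seq_scal_l _ _ 0). apply is_lim_seq_geom. rewrite Rabs_pos_eq; lra. }
  apply is_lim_seq_spec in G. generalize (G eps). apply filter_imp. intros n hn x Dx.
  eapply Rle_lt_trans; [now apply h|]. rewrite Rminus_0_r in hn.
  eapply Rle_lt_trans; [apply Rle_abs|]. apply hn.
Qed.

(** * Picard iteration for linear systems in the second variable, with the first as parameter *)

Fixpoint picard {T : Type} (y0 : R) (l : list T) (M : T -> T -> R2 -> R) (c : T -> R2 -> R) (m : nat)
    (i : T) (p : R2) : R :=
  match m with
  | O => c i (fst p, y0)
  | S m => c i (fst p, y0) + prim y0 (fun q => sumL l (fun j => M i j q * picard y0 l M c m j q)) p
  end.

(** Defined everywhere through [Lim_seq]; convergence, with a geometric rate, is known only on boxes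
    and comes from [psol_rate]. *)
Definition psol {T : Type} (y0 : R) (l : list T) (M : T -> T -> R2 -> R) (c : T -> R2 -> R) (i : T) (p : R2) : R :=
  Lim_seq (fun m => picard y0 l M c m i p).

(* The system satisfied by a solution together with its x-derivative. *)
Definition ext_mx {T : Type} (M : T -> T -> R2 -> R) (bi bj : bool * T) : R2 -> R :=
  match fst bi, fst bj with
  | true, false => d1 (M (snd bi) (snd bj))
  | false, true => fun _ => 0
  | _, _ => M (snd bi) (snd bj)
  end.

Definition ext_init {T : Type} (c : T -> R2 -> R) (bi : bool * T) : R2 -> R :=
  if fst bi then d1 (c (snd bi)) else c (snd bi).

Definition ext_list {T : Type} (l : list T) : list (bool * T) :=
  map (pair false) l ++ map (pair true) l.

Lemma ext_list_full {T : Type} (l : list T) : (forall i, In i l) -> forall bi, In bi (ext_list l).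
Proof. intros h [[] i]; apply in_or_app; [right|left]; now apply in_map. Qed.

(** The undifferentiated half of the extended system does not see the differentiated half, because
    that block of [ext_mx] is zero. *)
Lemma picard_ext {T : Type} y0 (l : list T) (M : T -> T -> R2 -> R) (c : T -> R2 -> R) m (i : T) :
  picard y0 (ext_list l) (ext_mx M) (ext_init c) m (false, i) = picard y0 l M c m i.
Proof.
  revert i; induction m as [|m IH]; intros i; apply functional_extensionality; intros p; simpl; auto.
  f_equal. f_equal. apply functional_extensionality; intros q.
  unfold ext_list at 1. rewrite sumL_app, !sumL_map.
  assert (Z : sumL l (fun j => ext_mx M (false, i) (true, j) q *
      picard y0 (ext_list l) (ext_mx M) (ext_init c) m (true, j) q) = 0).
  { rewrite (sumL_ext _ _ (fun _ => 0)); [apply sumL_0|intros; apply Rmult_0_l]. }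
  rewrite Z, Rplus_0_r.
  apply sumL_ext. intros j. now rewrite IH.
Qed.

Lemma box_mono x0 y0 r r' p : r <= r' -> box x0 y0 r p -> box x0 y0 r' p.
Proof. intros h [h1 h2]. split; eapply Rlt_le_trans; eauto. Qed.

Lemma smooth_at_y0 x0 y0 r (f : R2 -> R) : sm (box x0 y0 r) f -> sm (box x0 y0 r) (fun p => f (fst p, y0)).
Proof.
  intros hf. apply (smooth_comp_R2 (V := NR2) _ (box x0 y0 r) f (fun p => fst p) (fun _ => y0)); auto.
  - apply open_box.
  - apply (smooth_fst (V := NR2) (W := R_NormedModule) (Z := R_NormedModule)). apply smooth_id.
  - apply (smooth_const (W := R_NormedModule)).
  - intros p [h1 h2]. split; auto. simpl. rewrite Rminus_diag, Rabs_R0.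
    eapply Rle_lt_trans; [apply Rabs_pos|exact h2].
Qed.

Lemma box_y0 x0 y0 r x y : box x0 y0 r (x, y) -> box x0 y0 r (x, y0).
Proof.
  intros [h1 h2]. split; auto. simpl in *. rewrite Rminus_diag, Rabs_R0.
  pose proof (Rabs_pos (y - y0)); lra.
Qed.

Lemma picard_smooth {T : Type} x0 y0 r (l : list T) (M : T -> T -> R2 -> R) (c : T -> R2 -> R) :
  (forall i j, sm (box x0 y0 r) (M i j)) -> (forall i, sm (box x0 y0 r) (c i)) ->
  forall m i, sm (box x0 y0 r) (picard y0 l M c m i).
Proof.
  intros hM hc; induction m as [|m IH]; intros i; simpl.
  - now apply (smooth_at_y0 x0 y0 r (c i)).
  - apply smooth_plus; [now apply (smooth_at_y0 x0 y0 r (c i))|].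
    apply prim_smooth. apply (smooth_sumL (V := NR2)). intros j. now apply smooth_mult.
Qed.

Lemma prim_congr x0 y0 r (f g : R2 -> R) p :
  (forall q, box x0 y0 r q -> f q = g q) -> box x0 y0 r p -> prim y0 f p = prim y0 g p.
Proof.
  intros e Dp. destruct p as [x y]. apply RInt_ext. intros s hs. apply e.
  apply (box_seg x0 y0 r x y); auto. simpl in hs. lra.
Qed.

Lemma is_d1_at_y0 x0 y0 r (c : R2 -> R) x y : sm (box x0 y0 r) c -> box x0 y0 r (x, y) ->
  is_derive (fun s => c (s, y0)) x (d1 c (x, y0)).
Proof. intros hc Dp. apply (is_d1 (box x0 y0 r)); auto. now apply box_y0 in Dp. Qed.

(** Differentiation in the parameter commutes with every Picard step, so the x-derivatives of the
    iterates are again Picard iterates, of the extended system, and converge for the same reason. *)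
Lemma picard_is_d1 {T : Type} x0 y0 r (l : list T) (M : T -> T -> R2 -> R) (c : T -> R2 -> R) :
  (forall i j, sm (box x0 y0 r) (M i j)) -> (forall i, sm (box x0 y0 r) (c i)) ->
  forall m i x y, box x0 y0 r (x, y) ->
  is_derive (fun s => picard y0 l M c m i (s, y)) x
    (picard y0 (ext_list l) (ext_mx M) (ext_init c) m (true, i) (x, y)).
Proof.
  intros hM hc; induction m as [|m IH]; intros i x y Dp; simpl.
  - now apply (is_d1_at_y0 x0 y0 r (c i) x y).
  - apply der_plus; [now apply (is_d1_at_y0 x0 y0 r (c i) x y)|].
    eapply der_eq.
    + apply (prim_d1 x0 y0 r); auto. apply (smooth_sumL (V := NR2)). intros j. apply smooth_mult; auto.
      now apply picard_smooth.
    + apply (prim_congr x0 y0 r); auto. intros [u v] Duv.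
      unfold ext_list at 1. rewrite sumL_app, !sumL_map, <- sumL_plus.
      apply is_derive_unique. apply der_sumL. intros j. rewrite picard_ext.
      apply (der_mult (fun s => M i j (s, v)) (fun s => picard y0 l M c m j (s, v))); [|now apply IH].
      now apply (is_d1 (box x0 y0 r)).
Qed.

Lemma picard_is_d2 {T : Type} x0 y0 r (l : list T) (M : T -> T -> R2 -> R) (c : T -> R2 -> R) :
  (forall i j, sm (box x0 y0 r) (M i j)) -> (forall i, sm (box x0 y0 r) (c i)) ->
  forall m i x y, box x0 y0 r (x, y) ->
  is_derive (fun s => picard y0 l M c (S m) i (x, s)) y
    (sumL l (fun j => M i j (x, y) * picard y0 l M c m j (x, y))).
Proof.
  intros hM hc m i x y Dp; simpl. eapply der_eq; [apply der_plus; [apply der_const|]|apply Rplus_0_l].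
  apply (prim_d2 x0 y0 r (fun q => sumL l (fun j => M i j q * picard y0 l M c m j q))); auto.
  apply (smooth_sumL (V := NR2)). intros j. apply smooth_mult; auto. now apply picard_smooth.
Qed.

Lemma picard_at_y0 {T : Type} y0 (l : list T) (M : T -> T -> R2 -> R) (c : T -> R2 -> R) m i x : picard y0 l M c m i (x, y0) = c i (x, y0).
Proof. destruct m; simpl; auto. rewrite prim0. ring. Qed.

Lemma bounded_family {T : Type} x0 y0 r r' (l : list T) (f : T -> R2 -> R) : 0 < r < r' ->
  (forall i, In i l) -> (forall i, sm (box x0 y0 r') (f i)) ->
  exists K, 0 < K /\ forall i p, box x0 y0 r p -> Rabs (f i p) <= K.
Proof.
  intros hr hl hf.
  assert (H : exists K, 0 < K /\ forall i, In i l -> forall p, box x0 y0 r p -> Rabs (f i p) <= K).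
  { clear hl. induction l as [|j l [K [K0 HK]]].
    - exists 1. split; [lra|]. intros i [].
    - destruct (bounded_box x0 y0 r r' (f j) hr (hf j)) as [K' HK'].
      exists (Rmax K K'). split; [apply Rlt_le_trans with K; auto; apply Rmax_l|].
      intros i [<-|hi] p Dp; (eapply Rle_trans; [|]); [now apply HK'|apply Rmax_r|now apply HK|apply Rmax_l]. }
  destruct H as [K [K0 HK]]. exists K. split; auto.
Qed.

Lemma bounded_family2 {T : Type} x0 y0 r r' (l : list T) (f : T -> T -> R2 -> R) : 0 < r < r' ->
  (forall i, In i l) -> (forall i j, sm (box x0 y0 r') (f i j)) ->
  exists K, 0 < K /\ forall i j p, box x0 y0 r p -> Rabs (f i j p) <= K.
Proof.
  intros hr hl hf.
  destruct (bounded_family x0 y0 r r' (list_prod l l) (fun ij => f (fst ij) (snd ij))) as [K [K0 HK]]; auto.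
  - intros [i j]. now apply in_prod.
  - exists K. split; auto. intros i j. apply (HK (i, j)).
Qed.

Lemma exp_mono_box lam y0 r y : 0 < lam -> Rabs (y - y0) < r -> exp (lam * Rabs (y - y0)) <= exp (lam * r).
Proof.
  intros hl hy. destruct (Req_dec (lam * Rabs (y - y0)) (lam * r)) as [->|]; [lra|].
  apply Rlt_le, exp_increasing. now apply Rmult_lt_compat_l.
Qed.

Lemma exp_ge_1 lam a : 0 < lam -> 0 <= a -> 1 <= exp (lam * a).
Proof.
  intros h1 h2. pose proof (exp_ineq1_le (lam * a)). pose proof (Rmult_le_pos lam a). lra.
Qed.

(** In the norm weighted by [exp (lam * Rabs (y - y0))] each step halves the difference of
    consecutive iterates; on the box the weight is bounded and is absorbed into [A]. *)
Lemma picard_rate {T : Type} x0 y0 r r' (l : list T) (M : T -> T -> R2 -> R) (c : T -> R2 -> R) : 0 < r < r' -> (forall i, In i l) ->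
  (forall i j, sm (box x0 y0 r') (M i j)) -> (forall i, sm (box x0 y0 r') (c i)) ->
  exists A, forall m i p, box x0 y0 r p ->
    Rabs (picard y0 l M c (S m) i p - picard y0 l M c m i p) <= A * (1 / 2) ^ m.
Proof.
  intros hr hl hM hc.
  destruct (bounded_family2 x0 y0 r r' l M hr hl hM) as [K [K0 HK]].
  destruct (bounded_family x0 y0 r r' l c hr hl hc) as [C [C0 HC]].
  assert (hM' : forall i j, sm (box x0 y0 r) (M i j)).
  { intros; eapply smooth_sub; [|apply hM]. intros; eapply box_mono; eauto; lra. }
  assert (hc' : forall i, sm (box x0 y0 r) (c i)).
  { intros; eapply smooth_sub; [|apply hc]. intros; eapply box_mono; eauto; lra. }
  (* The added 1 keeps [lam] positive even for an empty list. As [lam] is twice the bound [N * K]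
     for the matrix, one integration yields exactly the factor 1/2. *)
  set (N := INR (length l) + 1).
  assert (N1 : 1 <= N) by (unfold N; pose proof (pos_INR (length l)); lra).
  set (lam := 2 * (N * K)).
  assert (NK : 0 < N * K) by (apply Rmult_lt_0_compat; lra).
  assert (lam0 : 0 < lam) by (unfold lam; lra).
  assert (SA : forall (g : T -> R) B, (forall j, Rabs (g j) <= B) -> 0 <= B -> Rabs (sumL l g) <= N * B).
  { intros g B h B0. eapply Rle_trans; [now apply (sumL_abs l g B)|].
    apply Rmult_le_compat_r; auto. unfold N; lra. }
  assert (H : forall m i x y, box x0 y0 r (x, y) ->
    Rabs (picard y0 l M c (S m) i (x, y) - picard y0 l M c m i (x, y)) <= C * (1 / 2) ^ m * exp (lam * Rabs (y - y0))).
  { induction m as [|m IH]; intros i x y Dp.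
    - replace (C * (1 / 2) ^ 0) with (2 * (N * K * C) / lam) by (unfold lam; simpl; field; lra).
      apply Rle_trans with (N * K * C / lam * exp (lam * Rabs (y - y0))).
      + refine (exp_compare y0 r (fun s => picard y0 l M c 1 i (x, s) - picard y0 l M c 0 i (x, s))
          (fun s => sumL l (fun j => M i j (x, s) * picard y0 l M c 0 j (x, s))) (N * K * C) lam lam0 _ _ _ _ y _).
        * apply Rmult_le_pos; lra.
        * intros s hs. eapply der_eq; [apply der_minus|apply Rminus_0_r].
          -- apply (picard_is_d2 x0 y0 r); auto. split; auto. apply Dp.
          -- apply (der_const (c i (x, y0))).
        * rewrite !picard_at_y0. ring.
        * intros s hs. apply Rle_trans with (N * K * C * 1).
          -- rewrite Rmult_1_r, Rmult_assoc. assert (D : box x0 y0 r (x, s)) by (split; auto; apply Dp).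
             apply SA; [|apply Rmult_le_pos; lra]. intros j. rewrite Rabs_mult. apply Rmult_le_compat; try apply Rabs_pos; auto.
             simpl. apply HC. now apply (box_y0 x0 y0 r x s).
          -- apply Rmult_le_compat_l; [apply Rmult_le_pos; lra|]. apply exp_ge_1; auto. apply Rabs_pos.
        * apply Dp.
      + apply Rmult_le_compat_r; [apply Rlt_le, exp_pos|]. apply Rmult_le_compat_r; [apply Rlt_le; now apply Rinv_0_lt_compat|].
        pose proof (Rmult_lt_0_compat _ _ NK C0). lra.
    - assert (P : 0 < (1 / 2) ^ m) by (apply pow_lt; lra).
      replace (C * (1 / 2) ^ S m) with (N * (K * (C * (1 / 2) ^ m)) / lam) by (unfold lam; simpl; field; lra).
      assert (B0 : 0 <= K * (C * (1 / 2) ^ m)) by (repeat apply Rmult_le_pos; lra).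
      refine (exp_compare y0 r (fun s => picard y0 l M c (S (S m)) i (x, s) - picard y0 l M c (S m) i (x, s))
          (fun s => sumL l (fun j => M i j (x, s) * (picard y0 l M c (S m) j (x, s) - picard y0 l M c m j (x, s))))
           (N * (K * (C * (1 / 2) ^ m))) lam lam0 _ _ _ _ y _).
      + apply Rmult_le_pos; lra.
      + intros s hs. assert (D : box x0 y0 r (x, s)) by (split; auto; apply Dp).
        eapply der_eq; [apply der_minus; apply (picard_is_d2 x0 y0 r); auto|].
        rewrite <- sumL_minus. apply sumL_ext. intros j; ring.
      + rewrite !picard_at_y0. ring.
      + intros s hs. assert (D : box x0 y0 r (x, s)) by (split; auto; apply Dp).
        rewrite Rmult_assoc. pose proof (exp_pos (lam * Rabs (s - y0))). apply SA.
        * intros j. rewrite Rabs_mult, Rmult_assoc. apply Rmult_le_compat; try apply Rabs_pos; auto.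
        * apply Rmult_le_pos; lra.
      + apply Dp. }
  exists (C * exp (lam * r)). intros m i [x y] Dp. eapply Rle_trans; [now apply H|].
  assert (P : 0 < (1 / 2) ^ m) by (apply pow_lt; lra).
  rewrite !Rmult_assoc. apply Rmult_le_compat_l; [lra|]. rewrite Rmult_comm. apply Rmult_le_compat_r; [lra|].
  apply exp_mono_box; auto. apply Dp.
Qed.

Lemma psol_rate {T : Type} x0 y0 r r' (l : list T) (M : T -> T -> R2 -> R) (c : T -> R2 -> R) : 0 < r < r' -> (forall i, In i l) ->
  (forall i j, sm (box x0 y0 r') (M i j)) -> (forall i, sm (box x0 y0 r') (c i)) ->
  exists A, forall m i p, box x0 y0 r p ->
    Rabs (picard y0 l M c m i p - psol y0 l M c i p) <= A * (1 / 2) ^ m.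
Proof.
  intros hr hl hM hc. destruct (picard_rate x0 y0 r r' l M c hr hl hM hc) as [A HA].
  exists (2 * A). intros m i p Dp.
  apply (geometric_limit (fun m => picard y0 l M c m i p) A). intros k. now apply HA.
Qed.

Lemma psol_at_y0 {T : Type} y0 (l : list T) (M : T -> T -> R2 -> R) (c : T -> R2 -> R) i x : psol y0 l M c i (x, y0) = c i (x, y0).
Proof.
  unfold psol. rewrite (Lim_seq_ext _ (fun _ => c i (x, y0))); [|intros; apply picard_at_y0].
  now rewrite Lim_seq_const.
Qed.

Lemma lim_of_rate (u : nat -> R) A L : (forall n, Rabs (u n - L) <= A * (1 / 2) ^ n) -> real (Lim_seq u) = L.
Proof.
  intros h. assert (E : is_lim_seq u L); [|now rewrite (is_lim_seq_unique _ _ E)].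
  apply is_lim_seq_spec. intros eps.
  assert (G : is_lim_seq (fun n => A * (1 / 2) ^ n) 0).
  { replace 0 with (A * 0) by ring. apply (is_lim_seq_scal_l _ _ 0). apply is_lim_seq_geom. rewrite Rabs_pos_eq; lra. }
  apply is_lim_seq_spec in G. generalize (G eps). apply filter_imp. intros n hn.
  rewrite Rminus_0_r in hn. eapply Rle_lt_trans; [apply h|]. eapply Rle_lt_trans; [apply Rle_abs|]. apply hn.
Qed.

Lemma open_interval y0 r : open (fun s : R => Rabs (s - y0) < r).
Proof.
  apply (open_comp (fun s : R => Rabs (s - y0)) (fun z => z < r)); [|apply open_lt].
  intros; apply continuous_Rabs_minus.
Qed.

Lemma connected_interval y0 r : is_connected (fun s : R => Rabs (s - y0) < r).
Proof.
  intros a b x ha hb hx. unfold Rabs in *; repeat destruct Rcase_abs; lra.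
Qed.

(** The derivatives of the iterates are the matrix applied to earlier iterates, hence converge
    uniformly as well, and the limit can be differentiated termwise. *)
Lemma psol_is_d2 {T : Type} x0 y0 r r' (l : list T) (M : T -> T -> R2 -> R) (c : T -> R2 -> R) : 0 < r < r' -> (forall i, In i l) ->
  (forall i j, sm (box x0 y0 r') (M i j)) -> (forall i, sm (box x0 y0 r') (c i)) ->
  forall i x y, box x0 y0 r (x, y) ->
  is_derive (fun s => psol y0 l M c i (x, s)) y (sumL l (fun j => M i j (x, y) * psol y0 l M c j (x, y))).
Proof.
  intros hr hl hM hc i x y Dp.
  destruct (psol_rate x0 y0 r r' l M c hr hl hM hc) as [A HA].
  destruct (bounded_family2 x0 y0 r r' l M hr hl hM) as [K [K0 HK]].
  assert (hM' : forall i j, sm (box x0 y0 r) (M i j)).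
  { intros; eapply smooth_sub; [|apply hM]. intros; eapply box_mono; eauto; lra. }
  assert (hc' : forall i, sm (box x0 y0 r) (c i)).
  { intros; eapply smooth_sub; [|apply hc]. intros; eapply box_mono; eauto; lra. }
  assert (Dx : forall s, Rabs (s - y0) < r -> box x0 y0 r (x, s)) by (intros; split; auto; apply Dp).
  (* Only iterates from 1 on have as derivative the matrix applied to the preceding iterate; the
     shift does not change the limit. *)
  set (fn := fun m s => picard y0 l M c (S m) i (x, s)).
  assert (LF : forall s, Rabs (s - y0) < r -> real (Lim_seq (fun m => fn m s)) = psol y0 l M c i (x, s)).
  { intros s hs. unfold fn, psol. apply (f_equal real). apply (Lim_seq_incr_1 (fun m => picard y0 l M c m i (x, s))). }
  assert (DF : forall m s, Rabs (s - y0) < r -> is_derive (fn m) s (sumL l (fun j => M i j (x, s) * picard y0 l M c m j (x, s)))).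
  { intros m s hs. apply (picard_is_d2 x0 y0 r); auto. }
  assert (RD : forall m s, Rabs (s - y0) < r ->
     Rabs (Derive (fn m) s - sumL l (fun j => M i j (x, s) * psol y0 l M c j (x, s))) <= INR (length l) * (K * A) * (1 / 2) ^ m).
  { intros m s hs. rewrite (is_derive_unique _ _ _ (DF m s hs)), <- sumL_minus, Rmult_assoc.
    apply sumL_abs. intros j. rewrite <- Rmult_minus_distr_l, Rabs_mult, Rmult_assoc.
    apply Rmult_le_compat; try apply Rabs_pos; auto. }
  assert (LD : forall s, Rabs (s - y0) < r -> real (Lim_seq (fun m => Derive (fn m) s)) =
     sumL l (fun j => M i j (x, s) * psol y0 l M c j (x, s))).
  { intros s hs. eapply lim_of_rate. intros n. apply RD; auto. }
  pose proof (CVU_Derive fn (fun s => Rabs (s - y0) < r) (open_interval y0 r) (connected_interval y0 r)) as H.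
  rewrite <- LD by apply Dp.
  apply (is_derive_ext_loc (fun s : R => real (Lim_seq (fun m => fn m s)))).
  - assert (O : locally y (fun s => Rabs (s - y0) < r)) by (apply (open_interval y0 r); apply Dp).
    revert O. apply filter_imp. exact LF.
  - apply H.
    + apply (CVU_of_bound fn _ (A * (1 / 2))). intros n s hs. rewrite LF by auto.
      rewrite Rmult_assoc. change (1 / 2 * (1 / 2) ^ n) with ((1 / 2) ^ S n). apply HA; auto.
    + intros n s hs. eexists. now apply DF.
    + intros n s hs.
      assert (C : continuity_pt (fun s => sumL l (fun j => M i j (x, s) * picard y0 l M c n j (x, s))) s).
      { apply continuity_pt_filterlim.
        apply (ex_derive_continuous (fun s => sumL l (fun j => M i j (x, s) * picard y0 l M c n j (x, s))) s).
        eexists. apply der_sumL. intros j. apply der_mult; apply (is_d2 (box x0 y0 r)); auto.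
        now apply picard_smooth. }
      eapply continuity_pt_ext_loc; [|exact C].
      assert (O : locally s (fun s => Rabs (s - y0) < r)) by (now apply (open_interval y0 r)).
      revert O. apply filter_imp. intros z hz. symmetry. apply is_derive_unique. now apply DF.
    + apply (CVU_of_bound _ _ (INR (length l) * (K * A))). intros n s hs. rewrite LD by auto. now apply RD.
    + apply Dp.
Qed.

Lemma ext_mx_smooth {T : Type} (D : R2 -> Prop) (M : T -> T -> R2 -> R) : open2 D ->
  (forall i j, sm D (M i j)) -> forall i j, sm D (ext_mx M i j).
Proof.
  intros o h [[] i] [[] j]; unfold ext_mx; simpl; auto; [now apply smooth_d1|apply (smooth_const (W := R_NormedModule))].
Qed.

Lemma ext_init_smooth {T : Type} (D : R2 -> Prop) (c : T -> R2 -> R) : open2 D ->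
  (forall i, sm D (c i)) -> forall i, sm D (ext_init c i).
Proof. intros o h [[] i]; unfold ext_init; simpl; auto. now apply smooth_d1. Qed.

Lemma psol_is_d1 {T : Type} x0 y0 r r' (l : list T) (M : T -> T -> R2 -> R) (c : T -> R2 -> R) : 0 < r < r' -> (forall i, In i l) ->
  (forall i j, sm (box x0 y0 r') (M i j)) -> (forall i, sm (box x0 y0 r') (c i)) ->
  forall i x y, box x0 y0 r (x, y) ->
  is_derive (fun s => psol y0 l M c i (s, y)) x (psol y0 (ext_list l) (ext_mx M) (ext_init c) (true, i) (x, y)).
Proof.
  intros hr hl hM hc i x y Dp.
  destruct (psol_rate x0 y0 r r' l M c hr hl hM hc) as [A HA].
  destruct (psol_rate x0 y0 r r' _ _ _ hr (ext_list_full l hl)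
     (ext_mx_smooth _ M (open_box _ _ _) hM) (ext_init_smooth _ c (open_box _ _ _) hc)) as [A' HA'].
  assert (hM' : forall i j, sm (box x0 y0 r) (M i j)).
  { intros; eapply smooth_sub; [|apply hM]. intros; eapply box_mono; eauto; lra. }
  assert (hc' : forall i, sm (box x0 y0 r) (c i)).
  { intros; eapply smooth_sub; [|apply hc]. intros; eapply box_mono; eauto; lra. }
  assert (Dx : forall s, Rabs (s - x0) < r -> box x0 y0 r (s, y)) by (intros; split; auto; apply Dp).
  set (fn := fun m s => picard y0 l M c m i (s, y)).
  set (pic' := picard y0 (ext_list l) (ext_mx M) (ext_init c)) in *.
  set (sol' := psol y0 (ext_list l) (ext_mx M) (ext_init c)) in *.
  assert (DF : forall m s, Rabs (s - x0) < r -> is_derive (fn m) s (pic' m (true, i) (s, y))).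
  { intros m s hs. apply (picard_is_d1 x0 y0 r); auto. }
  assert (RD : forall m s, Rabs (s - x0) < r -> Rabs (Derive (fn m) s - sol' (true, i) (s, y)) <= A' * (1 / 2) ^ m).
  { intros m s hs. rewrite (is_derive_unique _ _ _ (DF m s hs)). apply HA'; auto. }
  assert (LD : forall s, Rabs (s - x0) < r -> real (Lim_seq (fun m => Derive (fn m) s)) = sol' (true, i) (s, y)).
  { intros s hs. eapply lim_of_rate. intros n. apply RD; auto. }
  pose proof (CVU_Derive fn (fun s => Rabs (s - x0) < r) (open_interval x0 r) (connected_interval x0 r)) as H.
  rewrite <- LD by apply Dp.
  apply H.
  + apply (CVU_of_bound fn _ A). intros n s hs. apply HA; auto.
  + intros n s hs. eexists. now apply DF.
  + intros n s hs.
    assert (C : continuity_pt (fun s => pic' n (true, i) (s, y)) s).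
    { apply continuity_pt_filterlim. apply (ex_derive_continuous (fun s => pic' n (true, i) (s, y)) s).
      eexists. apply (is_d1 (box x0 y0 r)); auto. apply picard_smooth;
      [apply (ext_mx_smooth _ M (open_box _ _ _) hM')|apply (ext_init_smooth _ c (open_box _ _ _) hc')]. }
    eapply continuity_pt_ext_loc; [|exact C].
    assert (O : locally s (fun s => Rabs (s - x0) < r)) by (now apply (open_interval x0 r)).
    revert O. apply filter_imp. intros z hz. symmetry. apply is_derive_unique. now apply DF.
  + apply (CVU_of_bound _ _ A'). intros n s hs. rewrite LD by auto. now apply RD.
  + apply Dp.
Qed.

Lemma psol_continuous {T : Type} x0 y0 r r' (l : list T) (M : T -> T -> R2 -> R) (c : T -> R2 -> R) : 0 < r < r' -> (forall i, In i l) ->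
  (forall i j, sm (box x0 y0 r') (M i j)) -> (forall i, sm (box x0 y0 r') (c i)) ->
  forall i p, box x0 y0 r p -> continuous (psol y0 l M c i : NR2 -> R) p.
Proof.
  intros hr hl hM hc i p Dp.
  destruct (psol_rate x0 y0 r r' l M c hr hl hM hc) as [A HA].
  intros P [eps HP].
  assert (e3 : 0 < eps / 3) by (destruct eps; simpl; lra).
  assert (G : is_lim_seq (fun n => A * (1 / 2) ^ n) 0).
  { replace 0 with (A * 0) by ring. apply (is_lim_seq_scal_l _ _ 0). apply is_lim_seq_geom. rewrite Rabs_pos_eq; lra. }
  apply is_lim_seq_spec in G. destruct (G (mkposreal _ e3)) as [N HN]. specialize (HN N (le_n _)).
  rewrite Rminus_0_r in HN. simpl in HN. apply Rabs_def2 in HN.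
  assert (C : continuous (picard y0 l M c N i : NR2 -> R) p).
  { apply (sm_continuous (box x0 y0 r')); [now apply picard_smooth|]. eapply box_mono; eauto; lra. }
  assert (L : locally (p : NR2) (fun q => box x0 y0 r q /\ Rabs (picard y0 l M c N i q - picard y0 l M c N i p) < eps / 3)).
  { apply filter_and; [now apply (open_box x0 y0 r)|].
    apply (C (fun z => Rabs (z - picard y0 l M c N i p) < eps / 3)). exists (mkposreal _ e3). intros z hz; exact hz. }
  revert L. apply (filter_imp (F := locally (p : NR2))). intros q [Dq hq]. apply HP.
  change (Rabs (psol y0 l M c i q - psol y0 l M c i p) < eps).
  pose proof (HA N i p Dp) as h1. pose proof (HA N i q Dq) as h2. rewrite Rabs_minus_sym in h2.
  replace (psol y0 l M c i q - psol y0 l M c i p) with ((psol y0 l M c i q - picard y0 l M c N i q) +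
    ((picard y0 l M c N i q - picard y0 l M c N i p) + (picard y0 l M c N i p - psol y0 l M c i p))) by ring.
  eapply Rle_lt_trans; [apply Rabs_triang|].
  pose proof (Rabs_triang (picard y0 l M c N i q - picard y0 l M c N i p) (picard y0 l M c N i p - psol y0 l M c i p)). lra.
Qed.

(** The y-derivative is a combination of solutions and the x-derivative is a component of the
    solution of the extended system, which is indexed by [bool * T]; the induction on the order
    therefore quantifies over the index type and the system. *)
Theorem psol_smooth {T : Type} x0 y0 r r' (l : list T) (M : T -> T -> R2 -> R) (c : T -> R2 -> R) : 0 < r < r' -> (forall i, In i l) ->
  (forall i j, sm (box x0 y0 r') (M i j)) -> (forall i, sm (box x0 y0 r') (c i)) ->
  forall i, sm (box x0 y0 r) (psol y0 l M c i).
Proof.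
  intros hr hl hM hc i k. revert T l M c hl hM hc i.
  induction k as [|k IH]; intros T l M c hl hM hc i.
  - split; auto. apply (psol_continuous x0 y0 r r'); auto.
  - apply (Ck_partials k _ _ (psol y0 (ext_list l) (ext_mx M) (ext_init c) (true, i))
      (fun p => sumL l (fun j => M i j p * psol y0 l M c j p))).
    + apply open_box.
    + intros [x y] Dp. now apply (psol_is_d1 x0 y0 r r').
    + intros [x y] Dp. now apply (psol_is_d2 x0 y0 r r').
    + apply IH; [now apply ext_list_full|apply ext_mx_smooth; auto; apply open_box|apply ext_init_smooth; auto; apply open_box].
    + assert (Q : forall j, Ck (V := NR2) (W := R_NormedModule) k (box x0 y0 r) (fun p => M i j p * psol y0 l M c j p)).
      { intros j. apply Ck_mult; [|now apply IH]. apply (Ck_sub k (box x0 y0 r')); [|apply hM].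
        intros; eapply box_mono; eauto; lra. }
      exact (Ck_sumL (V := NR2) k _ l (fun j p => M i j p * psol y0 l M c j p) Q).
Qed.

(** With zero initial data the weighted estimate reproduces any bound of the solution with an extra
    factor 1/2; starting from a bound [C] on the box and iterating leaves only zero. *)
Theorem linear_unique {T : Type} x0 y0 r r' (l : list T) (M : T -> T -> R2 -> R) (D : T -> R2 -> R) : 0 < r < r' -> (forall i, In i l) ->
  (forall i j, sm (box x0 y0 r') (M i j)) -> (forall i, sm (box x0 y0 r') (D i)) ->
  (forall i x, Rabs (x - x0) < r -> D i (x, y0) = 0) ->
  (forall i p, box x0 y0 r p -> d2 (D i) p = sumL l (fun j => M i j p * D j p)) ->
  forall i p, box x0 y0 r p -> D i p = 0.
Proof.
  intros hr hl hM hD D0 eD.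
  destruct (bounded_family2 x0 y0 r r' l M hr hl hM) as [K [K0 HK]].
  destruct (bounded_family x0 y0 r r' l D hr hl hD) as [C [C0 HC]].
  set (N := INR (length l) + 1).
  assert (N1 : 1 <= N) by (unfold N; pose proof (pos_INR (length l)); lra).
  set (lam := 2 * (N * K)).
  assert (NK : 0 < N * K) by (apply Rmult_lt_0_compat; lra).
  assert (lam0 : 0 < lam) by (unfold lam; lra).
  assert (H : forall m i x y, box x0 y0 r (x, y) -> Rabs (D i (x, y)) <= C * (1 / 2) ^ m * exp (lam * Rabs (y - y0))).
  { induction m as [|m IH]; intros i x y Dp.
    - simpl. rewrite Rmult_1_r. eapply Rle_trans; [now apply HC|]. rewrite <- (Rmult_1_r C) at 1.
      apply Rmult_le_compat_l; [lra|]. apply exp_ge_1; auto. apply Rabs_pos.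
    - assert (P : 0 < (1 / 2) ^ m) by (apply pow_lt; lra).
      replace (C * (1 / 2) ^ S m) with (N * (K * (C * (1 / 2) ^ m)) / lam) by (unfold lam; simpl; field; lra).
      assert (B0 : 0 <= K * (C * (1 / 2) ^ m)) by (repeat apply Rmult_le_pos; lra).
      refine (exp_compare y0 r (fun s => D i (x, s)) (fun s => d2 (D i) (x, s))
           (N * (K * (C * (1 / 2) ^ m))) lam lam0 _ _ _ _ y _).
      + apply Rmult_le_pos; lra.
      + intros s hs. apply (is_d2 (box x0 y0 r')); auto. apply (box_mono x0 y0 r); [lra|]. split; auto; apply Dp.
      + apply D0, Dp.
      + intros s hs. assert (Ds : box x0 y0 r (x, s)) by (split; auto; apply Dp).
        rewrite eD by auto. rewrite Rmult_assoc. pose proof (exp_pos (lam * Rabs (s - y0))).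
        eapply Rle_trans; [apply (sumL_abs l _ (K * (C * (1 / 2) ^ m) * exp (lam * Rabs (s - y0))))|].
        * intros j. rewrite Rabs_mult, Rmult_assoc. apply Rmult_le_compat; try apply Rabs_pos; auto.
        * apply Rmult_le_compat_r; [apply Rmult_le_pos; lra|]. unfold N; lra.
      + apply Dp. }
  intros i [x y] Dp.
  assert (L : real (Lim_seq (fun _ => D i (x, y))) = 0).
  { apply (lim_of_rate _ (C * exp (lam * Rabs (y - y0)))). intros n. rewrite Rminus_0_r.
    eapply Rle_trans; [now apply (H n)|]. right; ring. }
  now rewrite Lim_seq_const in L.
Qed.

(** * The inverse function theorem in the plane *)

Definition supd (z w : R2) : R := Rmax (Rabs (fst z - fst w)) (Rabs (snd z - snd w)).

Lemma MVT_bound (F : R -> R) (G : R -> R) a b k :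
  (forall s, Rmin a b <= s <= Rmax a b -> is_derive F s (G s) /\ Rabs (G s) <= k) ->
  Rabs (F b - F a) <= k * Rabs (b - a).
Proof.
  intros h. destruct (MVT_gen F a b G) as [c [hc ->]].
  - intros s hs. apply h; lra.
  - intros s hs. apply continuity_pt_filterlim, (ex_derive_continuous F s). exists (G s). now apply h.
  - rewrite Rabs_mult. apply Rmult_le_compat_r; [apply Rabs_pos|]. now apply h.
Qed.

Lemma between_abs a b s c r : Rabs (a - c) < r -> Rabs (b - c) < r -> Rmin a b <= s <= Rmax a b -> Rabs (s - c) < r.
Proof.
  intros ha hb hs. unfold Rmin, Rmax in hs. destruct (Rle_dec a b); unfold Rabs in *; repeat destruct Rcase_abs; lra.
Qed.

Lemma lip_box x0 y0 r (F F1 F2 : R2 -> R) k z w :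
  (forall x y, box x0 y0 r (x, y) -> is_derive (fun s => F (s, y)) x (F1 (x, y)) /\ Rabs (F1 (x, y)) <= k) ->
  (forall x y, box x0 y0 r (x, y) -> is_derive (fun s => F (x, s)) y (F2 (x, y)) /\ Rabs (F2 (x, y)) <= k) ->
  box x0 y0 r z -> box x0 y0 r w -> Rabs (F z - F w) <= 2 * k * supd z w.
Proof.
  intros h1 h2. destruct z as [x y], w as [x' y']. intros [hx hy] [hx' hy']; simpl in *.
  replace (F (x, y) - F (x', y')) with ((F (x, y) - F (x', y)) + (F (x', y) - F (x', y'))) by ring.
  eapply Rle_trans; [apply Rabs_triang|].
  assert (A : Rabs (F (x, y) - F (x', y)) <= k * Rabs (x - x')).
  { apply (MVT_bound (fun s => F (s, y)) (fun s => F1 (s, y))). intros s hs. apply h1. split; auto.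
    now apply (between_abs x' x). }
  assert (B : Rabs (F (x', y) - F (x', y')) <= k * Rabs (y - y')).
  { apply (MVT_bound (fun s => F (x', s)) (fun s => F2 (x', s))). intros s hs. apply h2. split; auto.
    now apply (between_abs y' y). }
  assert (0 <= k) by (destruct (h1 x y) as [_ h]; [split; auto|]; pose proof (Rabs_pos (F1 (x, y))); lra).
  assert (k * Rabs (x - x') <= k * supd (x, y) (x', y')) by (apply Rmult_le_compat_l; auto; apply Rmax_l).
  assert (k * Rabs (y - y') <= k * supd (x, y) (x', y')) by (apply Rmult_le_compat_l; auto; apply Rmax_r).
  lra.
Qed.

Lemma supd_fst z w : Rabs (fst z - fst w) <= supd z w.
Proof. apply Rmax_l. Qed.

Lemma supd_snd z w : Rabs (snd z - snd w) <= supd z w.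
Proof. apply Rmax_r. Qed.

Lemma supd_lub z w k : Rabs (fst z - fst w) <= k -> Rabs (snd z - snd w) <= k -> supd z w <= k.
Proof. apply Rmax_lub. Qed.

Lemma supd_pos z w : 0 <= supd z w.
Proof. eapply Rle_trans; [apply Rabs_pos|apply supd_fst]. Qed.

Lemma supd_triang a b c : supd a c <= supd a b + supd b c.
Proof.
  pose proof (supd_fst a b). pose proof (supd_fst b c). pose proof (supd_snd a b). pose proof (supd_snd b c).
  apply supd_lub.
  - replace (fst a - fst c) with ((fst a - fst b) + (fst b - fst c)) by ring.
    eapply Rle_trans; [apply Rabs_triang|]. lra.
  - replace (snd a - snd c) with ((snd a - snd b) + (snd b - snd c)) by ring.
    eapply Rle_trans; [apply Rabs_triang|]. lra.
Qed.

Lemma supd_sym a b : supd a b = supd b a.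
Proof. unfold supd. now rewrite (Rabs_minus_sym (fst a)), (Rabs_minus_sym (snd a)). Qed.

Lemma supd_0 a b : supd a b <= 0 -> a = b.
Proof.
  intros h. pose proof (supd_fst a b). pose proof (supd_snd a b).
  destruct a as [a1 a2], b as [b1 b2]; simpl in *.
  assert (E : forall x y, Rabs (x - y) <= 0 -> x = y).
  { intros x y hxy. unfold Rabs in hxy; destruct Rcase_abs; lra. }
  f_equal; apply E; lra.
Qed.

Lemma supd_refl a : supd a a = 0.
Proof. unfold supd. rewrite !Rminus_diag, Rabs_R0. apply Rmax_left; lra. Qed.

Lemma box_supd x0 y0 r z : box x0 y0 r z <-> supd z (x0, y0) < r.
Proof.
  split.
  - intros [h1 h2]. now apply Rmax_lub_lt.
  - intros h. split; eapply Rle_lt_trans; [apply (supd_fst z (x0, y0))|exact h|apply (supd_snd z (x0, y0))|exact h].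
Qed.

(** Banach iteration of the map [T], which adds [q] to the small perturbation, started at the centre
    of the box. *)
Lemma contraction_solve x0 y0 r (e1 e2 : R2 -> R) (q : R2) : 0 < r ->
  (forall z w, box x0 y0 r z -> box x0 y0 r w ->
    Rabs (e1 z - e1 w) <= 1 / 4 * supd z w /\ Rabs (e2 z - e2 w) <= 1 / 4 * supd z w) ->
  Rabs (fst q + e1 (x0, y0) - x0) < r / 2 -> Rabs (snd q + e2 (x0, y0) - y0) < r / 2 ->
  exists z, box x0 y0 r z /\ fst z = fst q + e1 z /\ snd z = snd q + e2 z.
Proof.
  intros hr he hq1 hq2.
  set (p := (x0, y0) : R2).
  set (T := fun z : R2 => (fst q + e1 z, snd q + e2 z) : R2).
  assert (bp : box x0 y0 r p) by (apply box_supd; fold p; now rewrite supd_refl).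
  assert (hT : forall z w, box x0 y0 r z -> box x0 y0 r w -> supd (T z) (T w) <= 1 / 4 * supd z w).
  { intros z w hz hw. destruct (he z w hz hw) as [h1 h2]. apply supd_lub; simpl.
    - replace (fst q + e1 z - (fst q + e1 w)) with (e1 z - e1 w) by ring. auto.
    - replace (snd q + e2 z - (snd q + e2 w)) with (e2 z - e2 w) by ring. auto. }
  assert (hTp : supd (T p) p < r / 2) by (apply Rmax_lub_lt; auto).
  set (u := fun n => Nat.iter n T p).
  (* The radius [3 / 4 * r] reproduces itself, as r/2 + (1/4)(3/4)r is smaller, and it leaves the
     limit strictly inside the open box. *)
  assert (hu : forall n, supd (u n) p <= 3 / 4 * r).
  { induction n as [|n IH].
    - simpl. rewrite supd_refl. lra.
    - simpl. eapply Rle_trans; [apply (supd_triang _ (T p))|]. fold (u n).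
      assert (supd (T (u n)) (T p) <= 1 / 4 * supd (u n) p); [|lra].
      apply hT; auto. apply box_supd. eapply Rle_lt_trans; [apply IH|lra]. }
  assert (bu : forall n, box x0 y0 r (u n)) by (intros n; apply box_supd; eapply Rle_lt_trans; [apply hu|lra]).
  assert (du : forall n, supd (u (S n)) (u n) <= r * (1 / 2) ^ n).
  { induction n as [|n IH].
    - simpl. lra.
    - change (supd (T (u (S n))) (T (u n)) <= r * (1 / 2) ^ (S n)).
      eapply Rle_trans; [apply hT; auto|]. pose proof (supd_pos (u (S n)) (u n)). rewrite <- tech_pow_Rmult. lra. }
  set (z := (real (Lim_seq (fun n => fst (u n))), real (Lim_seq (fun n => snd (u n)))) : R2).
  assert (rz : forall n, supd (u n) z <= 2 * r * (1 / 2) ^ n).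
  { intros n. apply supd_lub; simpl.
    - apply (geometric_limit (fun n => fst (u n)) r). intros m. eapply Rle_trans; [apply supd_fst|]. apply du.
    - apply (geometric_limit (fun n => snd (u n)) r). intros m. eapply Rle_trans; [apply supd_snd|]. apply du. }
  assert (small : forall eps, 0 < eps -> exists n, 2 * r * (1 / 2) ^ n < eps).
  { intros eps heps.
    assert (G : is_lim_seq (fun n => 2 * r * (1 / 2) ^ n) 0).
    { replace 0 with (2 * r * 0) by ring. apply (is_lim_seq_scal_l _ _ 0). apply is_lim_seq_geom. rewrite Rabs_pos_eq; lra. }
    apply is_lim_seq_spec in G. destruct (G (mkposreal _ heps)) as [N HN]. exists N. specialize (HN N (le_n _)).
    rewrite Rminus_0_r in HN. eapply Rle_lt_trans; [apply Rle_abs|]. apply HN. }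
  assert (bz : box x0 y0 r z).
  { apply box_supd. destruct (small (r / 4)) as [n hn]; [lra|].
    eapply Rle_lt_trans; [apply (supd_triang _ (u n))|]. rewrite supd_sym.
    pose proof (rz n). pose proof (hu n). unfold p in *. lra. }
  exists z. split; auto.
  assert (E : T z = z).
  { apply supd_0. apply Rnot_lt_le. intros h.
    destruct (small _ h) as [n hn].
    pose proof (supd_triang (T z) (u (S n)) z) as t1.
    pose proof (hT z (u n) bz (bu n)) as t2. change (T (u n)) with (u (S n)) in t2.
    pose proof (rz (S n)) as t3. pose proof (rz n) as t4. rewrite (supd_sym z) in t2. rewrite <- tech_pow_Rmult in t3.
    pose proof (supd_pos (u n) z). lra. }
  split; [now rewrite <- E at 1|now rewrite <- E at 1].
Qed.

(** A Lipschitz solution of [f z = q + (t - t0) v] is differentiable: the linearisation error of [f]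
    is small against the displacement of [z], hence against [Rabs (t - t0)], and Cramer's rule
    carries this over to [X] and [Y]. *)
Lemma inverse_derive (D : R2 -> Prop) (f1 f2 : R2 -> R) (X Y : R -> R) t0 q1 q2 v1 v2 C :
  open2 D -> sm D f1 -> sm D f2 -> D (X t0, Y t0) ->
  locally t0 (fun t => f1 (X t, Y t) = q1 + (t - t0) * v1 /\ f2 (X t, Y t) = q2 + (t - t0) * v2 /\
     supd (X t, Y t) (X t0, Y t0) <= C * Rabs (t - t0)) ->
  let z := (X t0, Y t0) in
  let J := d1 f1 z * d2 f2 z - d2 f1 z * d1 f2 z in
  J <> 0 ->
  is_derive X t0 ((d2 f2 z * v1 - d2 f1 z * v2) / J) /\
  is_derive Y t0 ((d1 f1 z * v2 - d1 f2 z * v1) / J).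
Proof.
  intros oD s1 s2 Dz loc z J hJ.
  set (al := d1 f1 z) in *. set (be := d2 f1 z) in *. set (ga := d1 f2 z) in *. set (ka := d2 f2 z) in *.
  destruct (filterdiff_d12 D f1 z oD (s1 1%nat) Dz) as [_ F1].
  destruct (filterdiff_d12 D f2 z oD (s2 1%nat) Dz) as [_ F2].
  specialize (F1 z (fun P H => H)). specialize (F2 z (fun P H => H)).
  destruct (locally_singleton _ _ loc) as [e1 [e2 _]]. rewrite !Rminus_diag, !Rmult_0_l, !Rplus_0_r in *.
  set (C' := Rabs C + 1).
  assert (C'0 : 0 < C') by (unfold C'; pose proof (Rabs_pos C); lra).
  set (N := Rabs al + Rabs be + Rabs ga + Rabs ka + 1).
  assert (N0 : 0 < N) by (unfold N; pose proof (Rabs_pos al); pose proof (Rabs_pos be); pose proof (Rabs_pos ga); pose proof (Rabs_pos ka); lra).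
  assert (aJ : 0 < Rabs J) by now apply Rabs_pos_lt.
  (* near t0, the linearisation error is at most eta |t - t0| for both equations *)
  assert (key : forall eta : posreal, locally t0 (fun t =>
     let dx := X t - X t0 in let dy := Y t - Y t0 in
     Rabs ((t - t0) * v1 - (dx * al + dy * be)) <= eta * Rabs (t - t0) /\
     Rabs ((t - t0) * v2 - (dx * ga + dy * ka)) <= eta * Rabs (t - t0))).
  { intros eta. pose proof Rlt_sqrt2_0 as s20.
    assert (h0 : 0 < eta / (sqrt 2 * C')) by (apply Rdiv_lt_0_compat; [apply eta|now apply Rmult_lt_0_compat]).
    specialize (F1 (mkposreal _ h0)). specialize (F2 (mkposreal _ h0)). simpl in F1, F2.
    assert (F12 := filter_and _ _ F1 F2). destruct F12 as [d Hd].
    assert (d'0 : 0 < d / C') by (apply Rdiv_lt_0_compat; [apply d|auto]).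
    generalize (filter_and _ _ loc (locally_ball t0 (mkposreal _ d'0))). apply filter_imp.
    intros t [[h1 [h2 h3]] ht]. change (Rabs (t - t0) < d / C') in ht.
    assert (h4 : supd (X t, Y t) z <= C' * Rabs (t - t0)).
    { eapply Rle_trans; [apply h3|]. apply Rmult_le_compat_r; [apply Rabs_pos|]. unfold C'. pose proof (Rle_abs C). lra. }
    assert (h5 : supd (X t, Y t) z < d).
    { eapply Rle_lt_trans; [apply h4|]. replace (pos d) with (C' * (d / C')) by (field; lra). now apply Rmult_lt_compat_l. }
    assert (B : ball (z : NR2) d ((X t, Y t) : NR2)).
    { split; [change (Rabs (X t - X t0) < d)|change (Rabs (Y t - Y t0) < d)]; eapply Rle_lt_trans; [|exact h5| |exact h5].
      apply (supd_fst (X t, Y t) z). apply (supd_snd (X t, Y t) z). }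
    assert (Nb : norm (minus ((X t, Y t) : NR2) z) <= sqrt 2 * (C' * Rabs (t - t0))).
    { eapply Rle_trans; [apply (norm_prod (U := R_NormedModule) (V := R_NormedModule) (X t - X t0) (Y t - Y t0))|].
      apply Rmult_le_compat_l; [lra|]. exact h4. }
    destruct (Hd _ B) as [G1 G2].
    change (Rabs (f1 (X t, Y t) - f1 z - ((X t - X t0) * al + (Y t - Y t0) * be)) <= eta / (sqrt 2 * C') * norm (minus ((X t, Y t) : NR2) z)) in G1.
    change (Rabs (f2 (X t, Y t) - f2 z - ((X t - X t0) * ga + (Y t - Y t0) * ka)) <= eta / (sqrt 2 * C') * norm (minus ((X t, Y t) : NR2) z)) in G2.
    assert (Q : eta / (sqrt 2 * C') * norm (minus ((X t, Y t) : NR2) z) <= eta * Rabs (t - t0)).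
    { replace (eta * Rabs (t - t0)) with (eta / (sqrt 2 * C') * (sqrt 2 * (C' * Rabs (t - t0)))) by (field; lra).
      apply Rmult_le_compat_l; [lra|exact Nb]. }
    rewrite h1 in G1. rewrite h2 in G2. change (f1 z = q1) in e1. change (f2 z = q2) in e2. rewrite e1 in G1. rewrite e2 in G2. split.
    - replace ((t - t0) * v1 - ((X t - X t0) * al + (Y t - Y t0) * be)) with (q1 + (t - t0) * v1 - q1 - ((X t - X t0) * al + (Y t - Y t0) * be)) by ring. lra.
    - replace ((t - t0) * v2 - ((X t - X t0) * ga + (Y t - Y t0) * ka)) with (q2 + (t - t0) * v2 - q2 - ((X t - X t0) * ga + (Y t - Y t0) * ka)) by ring. lra. }
  (* Cramer's rule: the error of either coordinate is a combination of the two linearisation errors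
     whose coefficients [A], [B] are, up to sign, entries of the Jacobian matrix, divided by [J]. *)
  assert (fin : forall (Z : R -> R) (l A B : R), Rabs A <= N -> Rabs B <= N ->
     (forall t, Z t - Z t0 - (t - t0) * l =
        (A * ((t - t0) * v1 - ((X t - X t0) * al + (Y t - Y t0) * be)) + B * ((t - t0) * v2 - ((X t - X t0) * ga + (Y t - Y t0) * ka))) / J) ->
     is_derive Z t0 l).
  { intros Z l A B hA hB hZ. split; [apply is_linear_scal_l|].
    intros x hx. apply (is_filter_lim_locally_unique (V := R_NormedModule)) in hx. rewrite <- hx; clear x hx. intros eps.
    assert (h0 : 0 < eps * Rabs J / (2 * N)) by (apply Rdiv_lt_0_compat; [apply Rmult_lt_0_compat; [apply eps|auto]|lra]).
    generalize (key (mkposreal _ h0)). apply filter_imp. intros t [k1 k2]. simpl in k1, k2.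
    change (Rabs (Z t - Z t0 - (t - t0) * l) <= eps * Rabs (t - t0)). rewrite hZ.
    set (r1 := (t - t0) * v1 - ((X t - X t0) * al + (Y t - Y t0) * be)) in *.
    set (r2 := (t - t0) * v2 - ((X t - X t0) * ga + (Y t - Y t0) * ka)) in *.
    unfold Rdiv. rewrite Rabs_mult, Rabs_inv. apply Rmult_le_reg_r with (Rabs J); auto.
    rewrite Rmult_assoc, Rinv_l, Rmult_1_r by lra.
    eapply Rle_trans; [apply Rabs_triang|]. rewrite !Rabs_mult.
    set (e := eps * Rabs J / (2 * N) * Rabs (t - t0)) in *.
    assert (Rabs A * Rabs r1 <= N * e) by (apply Rmult_le_compat; auto; apply Rabs_pos).
    assert (Rabs B * Rabs r2 <= N * e) by (apply Rmult_le_compat; auto; apply Rabs_pos).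
    replace (eps * Rabs (t - t0) * Rabs J) with (N * e + N * e) by (unfold e; field; lra). lra. }
  pose proof (Rabs_pos al); pose proof (Rabs_pos be); pose proof (Rabs_pos ga); pose proof (Rabs_pos ka).
  split.
  - apply (fin X _ (- ka) be); rewrite ?Rabs_Ropp; try (unfold N; lra). intros t. unfold J in *. field. auto.
  - apply (fin Y _ ga (- al)); rewrite ?Rabs_Ropp; try (unfold N; lra). intros t. unfold J in *. field. auto.
Qed.

Definition jac (f1 f2 : R2 -> R) (p : R2) : R := d1 f1 p * d2 f2 p - d2 f1 p * d1 f2 p.

Lemma smooth_coord_fst (D : R2 -> Prop) : sm D (fun p => fst p).
Proof. apply (smooth_fst (V := NR2) (W := R_NormedModule) (Z := R_NormedModule)). apply smooth_id. Qed.

Lemma smooth_coord_snd (D : R2 -> Prop) : sm D (fun p => snd p).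
Proof. apply (smooth_snd (V := NR2) (W := R_NormedModule) (Z := R_NormedModule)). apply smooth_id. Qed.

Theorem inverse_function (U : R2 -> Prop) (f1 f2 : R2 -> R) (p : R2) :
  open2 U -> U p -> sm U f1 -> sm U f2 -> jac f1 f2 p <> 0 ->
  exists (V V' : R2 -> Prop) (g1 g2 : R2 -> R),
    open2 V /\ open2 V' /\ V p /\ (forall z, V z -> U z) /\ sm V' g1 /\ sm V' g2 /\
    (forall z, V z -> V' (f1 z, f2 z) /\ (g1 (f1 z, f2 z), g2 (f1 z, f2 z)) = z) /\
    (forall q, V' q -> V (g1 q, g2 q) /\ (f1 (g1 q, g2 q), f2 (g1 q, g2 q)) = q) /\
    (forall z, V z -> jac f1 f2 z <> 0).
Proof.
  intros oU Up s1 s2 hJ. destruct p as [x0 y0]. set (p := (x0, y0)) in *.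
  set (De := jac f1 f2 p) in *.
  (* These are the entries of the inverse Jacobian matrix at [p]. They turn [f z = q] into the fixed
     point problem that [z] equals this matrix applied to [q] plus [(e1 z, e2 z)]; the partials
     [E11], ..., [E22] of the perturbation vanish at [p]. *)
  set (i11 := d2 f2 p / De). set (i12 := - d2 f1 p / De). set (i21 := - d1 f2 p / De). set (i22 := d1 f1 p / De).
  set (e1 := fun z : R2 => fst z - (i11 * f1 z + i12 * f2 z)).
  set (e2 := fun z : R2 => snd z - (i21 * f1 z + i22 * f2 z)).
  set (E11 := fun z => 1 - (i11 * d1 f1 z + i12 * d1 f2 z)).
  set (E12 := fun z => 0 - (i11 * d2 f1 z + i12 * d2 f2 z)).
  set (E21 := fun z => 0 - (i21 * d1 f1 z + i22 * d1 f2 z)).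
  set (E22 := fun z => 1 - (i21 * d2 f1 z + i22 * d2 f2 z)).
  assert (near : forall E : R2 -> R, sm U E -> E p = 0 -> locally (p : NR2) (fun z => Rabs (E z) < 1 / 8)).
  { intros E sE E0. pose proof (sm_continuous U E p sE Up) as C.
    apply (C (fun y => Rabs y < 1 / 8)). rewrite E0. exists (mkposreal (1 / 8) ltac:(lra)). intros y hy.
    change (Rabs (y - 0) < 1 / 8) in hy. now rewrite Rminus_0_r in hy. }
  (* The bound 1/8 gives the Lipschitz constant 1/4 through [lip_box] and at the same time keeps the
     Jacobian away from zero on the box. *)
  assert (L : locally (p : NR2) (fun z => U z /\ (Rabs (E11 z) < 1 / 8 /\ Rabs (E12 z) < 1 / 8) /\ (Rabs (E21 z) < 1 / 8 /\ Rabs (E22 z) < 1 / 8))).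
  { repeat apply filter_and; [now apply oU|..]; apply near;
      try (unfold E11, E12, E21, E22; smt);
      unfold E11, E12, E21, E22, i11, i12, i21, i22, De, jac in *; field; auto. }
  destruct L as [[r hr] HB]. simpl in HB.
  assert (HB' : forall z, box x0 y0 r z -> U z /\ (Rabs (E11 z) < 1 / 8 /\ Rabs (E12 z) < 1 / 8) /\ (Rabs (E21 z) < 1 / 8 /\ Rabs (E22 z) < 1 / 8)).
  { intros z [hz1 hz2]. apply HB. split; auto. }
  clear HB near.
  assert (lip : forall z w, box x0 y0 r z -> box x0 y0 r w ->
    Rabs (e1 z - e1 w) <= 1 / 4 * supd z w /\ Rabs (e2 z - e2 w) <= 1 / 4 * supd z w).
  { intros z w hz hw. replace (1 / 4) with (2 * (1 / 8)) by lra. split.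
    - apply (lip_box x0 y0 r e1 E11 E12); auto; intros x y Dxy; destruct (HB' _ Dxy) as (Uxy & h1 & h2); (split; [|lra]);
        unfold e1, E11, E12; simpl.
      + eapply der_eq; [der ltac:(leaf1 U)|ring].
      + eapply der_eq; [der ltac:(leaf2 U)|ring].
    - apply (lip_box x0 y0 r e2 E21 E22); auto; intros x y Dxy; destruct (HB' _ Dxy) as (Uxy & h1 & h2); (split; [|lra]);
        unfold e2, E21, E22; simpl.
      + eapply der_eq; [der ltac:(leaf1 U)|ring].
      + eapply der_eq; [der ltac:(leaf2 U)|ring]. }
  assert (bU : forall z, box x0 y0 r z -> U z) by (intros z hz; apply (HB' z hz)).
  assert (Jn : forall z, box x0 y0 r z -> jac f1 f2 z <> 0).
  { intros z hz h0. destruct (HB' z hz) as (_ & [h1 h2] & [h3 h4]).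
    assert (E : (1 - E11 z) * (1 - E22 z) - E12 z * E21 z = 0).
    { replace ((1 - E11 z) * (1 - E22 z) - E12 z * E21 z) with (jac f1 f2 z / De).
      - rewrite h0. unfold Rdiv; ring.
      - unfold E11, E12, E21, E22, i11, i12, i21, i22, De, jac in *. field. auto. }
    apply Rabs_def2 in h1, h2, h3, h4. nra. }
  set (L1 := fun q : R2 => i11 * fst q + i12 * snd q).
  set (L2 := fun q : R2 => i21 * fst q + i22 * snd q).
  (* The values [q] for which the first step of the iteration from the centre is shorter than
     [r / 2] in each coordinate. *)
  set (V' := fun q : R2 => Rabs (L1 q + e1 p - x0) < r / 2 /\ Rabs (L2 q + e2 p - y0) < r / 2).
  set (G := fun q : R2 => epsilon (inhabits p) (fun z => box x0 y0 r z /\ (f1 z, f2 z) = q)).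
  assert (Linj : forall a b, i11 * a + i12 * b = 0 -> i21 * a + i22 * b = 0 -> a = 0 /\ b = 0).
  { intros a b h1 h2.
    assert (Ea : a = d1 f1 p * (i11 * a + i12 * b) + d2 f1 p * (i21 * a + i22 * b)) by
      (unfold i11, i12, i21, i22, De, jac in *; field; auto).
    assert (Eb : b = d1 f2 p * (i11 * a + i12 * b) + d2 f2 p * (i21 * a + i22 * b)) by
      (unfold i11, i12, i21, i22, De, jac in *; field; auto).
    rewrite h1, h2 in Ea, Eb. split; lra. }
  assert (hG : forall q, V' q -> box x0 y0 r (G q) /\ (f1 (G q), f2 (G q)) = q).
  { intros q [h1 h2]. apply (epsilon_spec (inhabits p) (fun z => box x0 y0 r z /\ (f1 z, f2 z) = q)).
    destruct (contraction_solve x0 y0 r e1 e2 (L1 q, L2 q) hr lip h1 h2) as (z & bz & z1 & z2).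
    exists z; split; auto. simpl in z1, z2. unfold e1, L1 in z1. unfold e2, L2 in z2.
    destruct (Linj (f1 z - fst q) (f2 z - snd q)); [lra|lra|]. destruct q; simpl in *. f_equal; lra. }
  (* A point is the inverse matrix applied to its image plus a perturbation with Lipschitz constant
     1/4, which is absorbed on the left; this gives injectivity and the Lipschitz bound for the
     inverse together. *)
  assert (inj : forall z w, box x0 y0 r z -> box x0 y0 r w -> supd z w <= 2 * (Rabs i11 + Rabs i12 + Rabs i21 + Rabs i22) * supd (f1 z, f2 z) (f1 w, f2 w)).
  { intros z w hz hw. destruct (lip z w hz hw) as [l1 l2].
    set (C0 := Rabs i11 + Rabs i12 + Rabs i21 + Rabs i22).
    pose proof (supd_fst (f1 z, f2 z) (f1 w, f2 w)) as g1. pose proof (supd_snd (f1 z, f2 z) (f1 w, f2 w)) as g2.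
    simpl in g1, g2. set (s := supd (f1 z, f2 z) (f1 w, f2 w)) in *.
    pose proof (Rabs_pos i11); pose proof (Rabs_pos i12); pose proof (Rabs_pos i21); pose proof (Rabs_pos i22).
    assert (s0 : 0 <= s) by apply supd_pos.
    assert (bd : forall a b, Rabs (a * (f1 z - f1 w) + b * (f2 z - f2 w)) <= (Rabs a + Rabs b) * s).
    { intros a b. eapply Rle_trans; [apply Rabs_triang|]. rewrite !Rabs_mult.
      pose proof (Rmult_le_compat_l (Rabs a) _ _ (Rabs_pos a) g1).
      pose proof (Rmult_le_compat_l (Rabs b) _ _ (Rabs_pos b) g2). lra. }
    assert (A : supd z w <= C0 * s + 1 / 4 * supd z w).
    { apply supd_lub.
      - replace (fst z - fst w) with ((i11 * (f1 z - f1 w) + i12 * (f2 z - f2 w)) + (e1 z - e1 w)) by (unfold e1; ring).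
        eapply Rle_trans; [apply Rabs_triang|]. pose proof (bd i11 i12).
        assert ((Rabs i11 + Rabs i12) * s <= C0 * s) by (apply Rmult_le_compat_r; auto; unfold C0; lra). lra.
      - replace (snd z - snd w) with ((i21 * (f1 z - f1 w) + i22 * (f2 z - f2 w)) + (e2 z - e2 w)) by (unfold e2; ring).
        eapply Rle_trans; [apply Rabs_triang|]. pose proof (bd i21 i22).
        assert ((Rabs i21 + Rabs i22) * s <= C0 * s) by (apply Rmult_le_compat_r; auto; unfold C0; lra). lra. }
    pose proof (supd_pos z w). assert (0 <= C0 * s) by (apply Rmult_le_pos; unfold C0; lra). lra. }
  set (C := 2 * (Rabs i11 + Rabs i12 + Rabs i21 + Rabs i22)) in *.
  assert (lipG : forall q q', V' q -> V' q' -> supd (G q) (G q') <= C * supd q q').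
  { intros q q' h h'. destruct (hG q h) as [b1 b2], (hG q' h') as [b1' b2'].
    pose proof (inj _ _ b1 b1') as H. now rewrite b2, b2' in H. }
  assert (Gf : forall z, box x0 y0 r z -> V' (f1 z, f2 z) -> G (f1 z, f2 z) = z).
  { intros z bz h. destruct (hG _ h) as [b1 b2]. apply supd_0.
    eapply Rle_trans; [apply inj; auto|]. rewrite b2. rewrite supd_refl. lra. }
  assert (oV' : open2 V').
  { assert (cont : forall a b c d, open2 (fun q => Rabs (a * fst q + b * snd q + c - d) < r / 2)).
    { intros a b c d.
      apply (open_comp (fun q : NR2 => a * fst q + b * snd q + c - d) (fun y => Rabs y < r / 2)).
      - intros q _. apply (sm_continuous (fun _ => True) (fun q => a * fst q + b * snd q + c - d)); auto.
        pose proof (smooth_coord_fst (fun _ => True)). pose proof (smooth_coord_snd (fun _ => True)). smt.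
      - apply (open_comp Rabs (fun z => z < r / 2)); [|apply open_lt]. intros; apply continuous_Rabs. }
    apply (open_and (T := NR2)); apply cont. }
  set (V := fun z => box x0 y0 r z /\ V' (f1 z, f2 z)).
  assert (oV : open2 V).
  { intros z [bz hz]. apply filter_and; [now apply open_box|].
    assert (CC : continuous (fun z : NR2 => (f1 z, f2 z) : NR2) z).
    { apply continuous_pair; [apply (sm_continuous U f1)|apply (sm_continuous U f2)]; auto. }
    apply (CC V'). now apply oV'. }
  assert (Vp : V p).
  { split.
    - apply box_supd. unfold p. rewrite supd_refl. exact hr.
    - unfold V', L1, L2, e1, e2. simpl. split.
      + replace (i11 * f1 p + i12 * f2 p + (x0 - (i11 * f1 p + i12 * f2 p)) - x0) with 0 by ring. rewrite Rabs_R0; lra.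
      + replace (i21 * f1 p + i22 * f2 p + (y0 - (i21 * f1 p + i22 * f2 p)) - y0) with 0 by ring. rewrite Rabs_R0; lra. }
  assert (G2 : forall q, (fst (G q), snd (G q)) = G q) by (intros q; now destruct (G q)).
  assert (CG : forall q, V' q -> continuous (fun q : NR2 => fst (G q)) q /\ continuous (fun q : NR2 => snd (G q)) q).
  { intros q hq.
    assert (LL : forall eps : posreal, locally (q : NR2) (fun q' => supd (G q') (G q) < eps)).
    { intros eps.
      assert (C0 : 0 <= C). { unfold C. pose proof (Rabs_pos i11); pose proof (Rabs_pos i12); pose proof (Rabs_pos i21); pose proof (Rabs_pos i22). lra. }
      assert (h0 : 0 < eps / (C + 1)) by (apply Rdiv_lt_0_compat; [apply eps|lra]).
      generalize (filter_and (F := locally (q : NR2)) _ _ (oV' q hq) (locally_ball (q : NR2) (mkposreal _ h0))).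
      apply (filter_imp (F := locally (q : NR2))). intros q' [hq' [b1 b2]].
      change (Rabs (fst q' - fst q) < eps / (C + 1)) in b1. change (Rabs (snd q' - snd q) < eps / (C + 1)) in b2.
      eapply Rle_lt_trans; [now apply lipG|].
      assert (supd q' q < eps / (C + 1)) by (now apply Rmax_lub_lt).
      apply Rle_lt_trans with ((C + 1) * supd q' q); [pose proof (supd_pos q' q); lra|].
      replace (pos eps) with ((C + 1) * (eps / (C + 1))) by (field; lra). apply Rmult_lt_compat_l; lra. }
    split; intros P [eps HP]; generalize (LL eps); apply (filter_imp (F := locally (q : NR2))); intros q' h; apply HP;
      (eapply Rle_lt_trans; [|exact h]); [apply (supd_fst (G q') (G q))|apply (supd_snd (G q') (G q))]. }
  (* The bound 1 on the components of the direction lets the Lipschitz constant [C] of [G] serve as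
     the constant required by [inverse_derive]. *)
  assert (DG : forall q v1 v2 (a b : R -> R) t0, V' q -> q = (a t0, b t0) ->
     (forall t, a t = a t0 + (t - t0) * v1) -> (forall t, b t = b t0 + (t - t0) * v2) -> Rabs v1 <= 1 -> Rabs v2 <= 1 ->
     let z := G q in
     is_derive (fun t => fst (G (a t, b t))) t0 ((d2 f2 z * v1 - d2 f1 z * v2) / jac f1 f2 z) /\
     is_derive (fun t => snd (G (a t, b t))) t0 ((d1 f1 z * v2 - d1 f2 z * v1) / jac f1 f2 z)).
  { intros q v1 v2 a b t0 hq eq ha hb h1 h2 z.
    assert (ez : (fst (G (a t0, b t0)), snd (G (a t0, b t0))) = z) by (unfold z; rewrite G2; now rewrite eq).
    pose proof (inverse_derive U f1 f2 (fun t => fst (G (a t, b t))) (fun t => snd (G (a t, b t))) t0 (a t0) (b t0) v1 v2 C) as H.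
    cbv zeta beta in H. rewrite ez in H. apply H; auto.
    - apply bU. now apply hG.
    - assert (LV : locally t0 (fun t => V' (a t, b t))).
      { assert (CC : continuous (fun t : R => (a t, b t) : NR2) t0).
        { apply continuous_pair.
          - apply (continuous_ext (fun t => a t0 + (t - t0) * v1)); [intros; symmetry; apply ha|].
            apply (ex_derive_continuous (fun t => a t0 + (t - t0) * v1)). auto_derive; auto.
          - apply (continuous_ext (fun t => b t0 + (t - t0) * v2)); [intros; symmetry; apply hb|].
            apply (ex_derive_continuous (fun t => b t0 + (t - t0) * v2)). auto_derive; auto. }
        apply (CC V'). apply oV'. now rewrite <- eq. }
      revert LV. apply filter_imp. intros t ht. rewrite G2.
      destruct (hG _ ht) as [b1 b2]. injection b2 as b3 b4. rewrite b3, b4. split; [apply ha|]. split; [apply hb|].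
      unfold z. rewrite eq. rewrite eq in hq. eapply Rle_trans; [now apply lipG|]. apply Rmult_le_compat_l.
      { unfold C. pose proof (Rabs_pos i11); pose proof (Rabs_pos i12); pose proof (Rabs_pos i21); pose proof (Rabs_pos i22). lra. }
      assert (K : forall v, Rabs v <= 1 -> Rabs ((t - t0) * v) <= Rabs (t - t0)).
      { intros v hv. rewrite Rabs_mult. pose proof (Rabs_pos (t - t0)).
        rewrite <- (Rmult_1_r (Rabs (t - t0))) at 2. now apply Rmult_le_compat_l. }
      apply supd_lub; simpl.
      + rewrite (ha t). replace (a t0 + (t - t0) * v1 - a t0) with ((t - t0) * v1) by ring. auto.
      + rewrite (hb t). replace (b t0 + (t - t0) * v2 - b t0) with ((t - t0) * v2) by ring. auto.
    - apply Jn. now apply hG. }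
  set (h11 := fun z => d2 f2 z / jac f1 f2 z). set (h12 := fun z => - d2 f1 z / jac f1 f2 z).
  set (h21 := fun z => - d1 f2 z / jac f1 f2 z). set (h22 := fun z => d1 f1 z / jac f1 f2 z).
  assert (ob : open2 (box x0 y0 r)) by apply open_box.
  assert (s1' : sm (box x0 y0 r) f1) by (eapply smooth_sub; eauto).
  assert (s2' : sm (box x0 y0 r) f2) by (eapply smooth_sub; eauto).
  assert (sh : sm (box x0 y0 r) h11 /\ sm (box x0 y0 r) h12 /\ sm (box x0 y0 r) h21 /\ sm (box x0 y0 r) h22).
  { unfold h11, h12, h21, h22. repeat split; unfold jac; smt; intros z hz; now apply Jn. }
  destruct sh as (sh11 & sh12 & sh21 & sh22).
  (* Bootstrapping: the partials of [G] are the smooth entries [h11], ..., [h22] of the inverse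
     Jacobian matrix composed with [G], so order k for [G] gives order k + 1. *)
  assert (CK : forall k, Ck (V := NR2) (W := R_NormedModule) k V' (fun q => fst (G q)) /\ Ck (V := NR2) (W := R_NormedModule) k V' (fun q => snd (G q))).
  { induction k as [|k [IH1 IH2]].
    - split; split; auto; intros q hq; now apply CG.
    - assert (cc : forall h, sm (box x0 y0 r) h -> Ck (V := NR2) (W := R_NormedModule) k V' (fun q => h (fst (G q), snd (G q)))).
      { intros h sh. apply (Ck_comp_R2 k V' (box x0 y0 r)); auto. intros q hq. rewrite G2. now apply hG. }
      assert (R0le : Rabs 0 <= 1) by (rewrite Rabs_R0; lra). assert (R1le : Rabs 1 <= 1) by (rewrite Rabs_R1; lra).
      split.
      + apply (Ck_partials k V' _ (fun q => h11 (fst (G q), snd (G q))) (fun q => h12 (fst (G q), snd (G q)))); auto.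
        * intros [q1 q2] hq. rewrite G2. eapply der_eq.
          apply (DG (q1, q2) 1 0 (fun t => t) (fun _ => q2)); auto; intros; ring.
          unfold h11. unfold Rdiv; ring.
        * intros [q1 q2] hq. rewrite G2. eapply der_eq.
          apply (DG (q1, q2) 0 1 (fun _ => q1) (fun t => t)); auto; intros; ring.
          unfold h12. unfold Rdiv; ring.
      + apply (Ck_partials k V' _ (fun q => h21 (fst (G q), snd (G q))) (fun q => h22 (fst (G q), snd (G q)))); auto.
        * intros [q1 q2] hq. rewrite G2. eapply der_eq.
          apply (DG (q1, q2) 1 0 (fun t => t) (fun _ => q2)); auto; intros; ring.
          unfold h21. unfold Rdiv; ring.
        * intros [q1 q2] hq. rewrite G2. eapply der_eq.
          apply (DG (q1, q2) 0 1 (fun _ => q1) (fun t => t)); auto; intros; ring.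
          unfold h22. unfold Rdiv; ring. }
  exists V, V', (fun q => fst (G q)), (fun q => snd (G q)).
  refine (conj oV (conj oV' (conj Vp (conj _ (conj _ (conj _ (conj _ (conj _ _)))))))).
  - intros z hz. apply bU, hz.
  - intros k. apply CK.
  - intros k. apply CK.
  - intros z [bz hz]. split; auto. rewrite G2. auto.
  - intros q hq. rewrite G2. destruct (hG q hq) as [b1 b2]. split; [|exact b2]. split; auto. now rewrite b2.
  - intros z [bz hz]. now apply Jn.
Qed.

Lemma open_has_box (U : R2 -> Prop) x0 y0 : open2 U -> U (x0, y0) ->
  exists r, 0 < r /\ forall z, box x0 y0 r z -> U z.
Proof.
  intros oU Up. destruct (oU _ Up) as [[r hr] H]. exists r. split; [exact hr|].
  intros z [h1 h2]. apply H. split; auto.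
Qed.

Lemma box_center x0 y0 r : 0 < r -> box x0 y0 r (x0, y0).
Proof. intros hr. apply box_supd. now rewrite supd_refl. Qed.

Lemma sumL_exchange {T : Type} (l l' : list T) (a : T -> R) (B : T -> T -> R) (v : T -> R) :
  sumL l (fun j => a j * sumL l' (fun k => B j k * v k)) =
  sumL l' (fun k => sumL l (fun j => a j * B j k) * v k).
Proof.
  induction l' as [|k l' IH]; simpl.
  - rewrite (sumL_ext _ _ (fun _ => 0)); [apply sumL_0|intros; ring].
  - rewrite <- IH. clear IH. induction l as [|j l IH]; simpl; [ring|]. rewrite IH. ring.
Qed.

(** * Flat linear systems *)

(** The Frobenius theorem for linear systems: integrate along a horizontal line, then vertically
    from it. The defect [Del] of the first equation vanishes on the line and, by the curvature
    hypothesis, solves the vertical system, so uniqueness makes it zero. *)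
Theorem flat_system {T : Type} x0 y0 r (l : list T) (M1 M2 : T -> T -> R2 -> R) (e : T -> R) : 0 < r ->
  (forall i, In i l) ->
  (forall i j, sm (box x0 y0 r) (M1 i j)) -> (forall i j, sm (box x0 y0 r) (M2 i j)) ->
  (forall i k p, box x0 y0 r p ->
     d1 (M2 i k) p + sumL l (fun j => M2 i j p * M1 j k p) = d2 (M1 i k) p + sumL l (fun j => M1 i j p * M2 j k p)) ->
  exists Psi : T -> R2 -> R,
    (forall i, sm (box x0 y0 (r / 4)) (Psi i)) /\ (forall i, Psi i (x0, y0) = e i) /\
    forall i p, box x0 y0 (r / 4) p ->
      d1 (Psi i) p = sumL l (fun j => M1 i j p * Psi j p) /\
      d2 (Psi i) p = sumL l (fun j => M2 i j p * Psi j p).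
Proof.
  intros hr hl s1 s2 curv.
  (* along y = y0 the unknown solves an ordinary equation; the first coordinate is a dummy parameter *)
  set (N := fun i j (q : R2) => M1 i j (snd q, y0)).
  set (phi := psol x0 l N (fun i _ => e i)).
  assert (by0 : forall s, Rabs (s - x0) < r -> box x0 y0 r (s, y0)).
  { intros s hs; split; auto. simpl. now rewrite Rminus_diag, Rabs_R0. }
  assert (sN : forall i j, sm (box 0 x0 r) (N i j)).
  { intros i j. apply (smooth_comp_R2 (V := NR2) _ (box x0 y0 r) (M1 i j) (fun q => snd q) (fun _ => y0)); auto.
    - apply open_box.
    - apply smooth_coord_snd.
    - apply (smooth_const (W := R_NormedModule)).
    - intros q [h1 h2]. now apply by0. }
  assert (se : forall i : T, sm (box 0 x0 r) (fun _ => e i)) by (intros; apply (smooth_const (W := R_NormedModule))).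
  (* Existence, used twice, and uniqueness each require a strictly larger box; the radii descend
     from [r] through [3 / 4 * r] and [r / 2] to [r / 4]. *)
  assert (rr : 0 < 3 / 4 * r < r) by lra.
  pose proof (psol_smooth 0 x0 (3 / 4 * r) r l N (fun i _ => e i) rr hl sN se) as sphi. fold phi in sphi.
  set (c := fun i (p : R2) => phi i (0, fst p)).
  assert (b0 : forall s, Rabs (s - x0) < 3 / 4 * r -> box 0 x0 (3 / 4 * r) (0, s)).
  { intros s hs; split; auto. simpl. rewrite Rminus_diag, Rabs_R0. lra. }
  assert (sc : forall i, sm (box x0 y0 (3 / 4 * r)) (c i)).
  { intros i. apply (smooth_comp_R2 (V := NR2) _ (box 0 x0 (3 / 4 * r)) (phi i) (fun _ => 0) (fun q => fst q)); auto.
    - apply open_box.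
    - apply (smooth_const (W := R_NormedModule)).
    - apply smooth_coord_fst.
    - intros q [h1 h2]. now apply b0. }
  assert (s1' : forall i j, sm (box x0 y0 (3 / 4 * r)) (M1 i j)).
  { intros; eapply smooth_sub; [|apply s1]. intros; eapply box_mono; eauto; lra. }
  assert (s2' : forall i j, sm (box x0 y0 (3 / 4 * r)) (M2 i j)).
  { intros; eapply smooth_sub; [|apply s2]. intros; eapply box_mono; eauto; lra. }
  assert (r2 : 0 < r / 2 < 3 / 4 * r) by lra.
  set (Psi := psol y0 l M2 c).
  pose proof (psol_smooth x0 y0 (r / 2) (3 / 4 * r) l M2 c r2 hl s2' sc) as sPsi. fold Psi in sPsi.
  assert (dPsi2 : forall i p, box x0 y0 (r / 2) p -> d2 (Psi i) p = sumL l (fun j => M2 i j p * Psi j p)).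
  { intros i [x y] Dp. apply is_derive_unique. now apply (psol_is_d2 x0 y0 (r / 2) (3 / 4 * r)). }
  set (Del := fun i p => d1 (Psi i) p - sumL l (fun j => M1 i j p * Psi j p)).
  pose proof (open_box x0 y0 (r / 2)) as ob.
  assert (s1'' : forall i j, sm (box x0 y0 (r / 2)) (M1 i j)).
  { intros; eapply smooth_sub; [|apply s1]. intros; eapply box_mono; eauto; lra. }
  assert (s2'' : forall i j, sm (box x0 y0 (r / 2)) (M2 i j)).
  { intros; eapply smooth_sub; [|apply s2]. intros; eapply box_mono; eauto; lra. }
  assert (sDel : forall i, sm (box x0 y0 (r / 2)) (Del i)).
  { intros i. unfold Del. apply (smooth_minus (V := NR2)); [now apply smooth_d1|].
    apply (smooth_sumL (V := NR2)). intros j. apply (smooth_mult (V := NR2)); auto. }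
  assert (Del0 : forall i p, box x0 y0 (r / 4) p -> Del i p = 0).
  { apply (linear_unique x0 y0 (r / 4) (r / 2) l M2); auto; [lra| |].
    - intros i x hx. unfold Del.
      assert (E : d1 (Psi i) (x, y0) = sumL l (fun j => M1 i j (x, y0) * c j (x, y0))).
      { unfold d1; simpl. rewrite (Derive_ext _ (fun s => phi i (0, s))).
        - apply is_derive_unique.
          apply (psol_is_d2 0 x0 (3 / 4 * r) r l N (fun i _ => e i) rr hl sN se i 0 x). apply b0. lra.
        - intros s. apply (psol_at_y0 y0 l M2 c i s). }
      rewrite E, <- sumL_minus, <- (sumL_0 l). apply sumL_ext. intros j.
      rewrite (psol_at_y0 y0 l M2 c j x : Psi j (x, y0) = _). ring.
    - intros i [x y] Dp0.
      assert (Dp : box x0 y0 (r / 2) (x, y)) by (eapply box_mono; eauto; lra).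
      assert (Dpr : box x0 y0 r (x, y)) by (eapply box_mono; eauto; lra).
      assert (E : d2 (Del i) (x, y) = d2 (d1 (Psi i)) (x, y) - sumL l (fun j => d2 (M1 i j) (x, y) * Psi j (x, y) + M1 i j (x, y) * d2 (Psi j) (x, y))).
      { apply is_derive_unique; simpl. apply der_minus.
        - apply (is_d2 (box x0 y0 (r / 2))); auto. now apply smooth_d1.
        - apply der_sumL. intros j. apply (der_mult (fun s => M1 i j (x, s)) (fun s => Psi j (x, s))); apply (is_d2 (box x0 y0 (r / 2))); auto. }
      assert (E2 : d2 (d1 (Psi i)) (x, y) = sumL l (fun j => d1 (M2 i j) (x, y) * Psi j (x, y) + M2 i j (x, y) * d1 (Psi j) (x, y))).
      { rewrite <- (smooth_d12 (box x0 y0 (r / 2))) by auto.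
        rewrite (d1_ext _ _ (fun p => sumL l (fun j => M2 i j p * Psi j p)) _ ob Dp (fun q hq => dPsi2 i q hq)).
        apply is_derive_unique; simpl.
        apply der_sumL. intros j. apply (der_mult (fun s => M2 i j (s, y)) (fun s => Psi j (s, y))); apply (is_d1 (box x0 y0 (r / 2))); auto. }
      rewrite E, E2.
      assert (comm : forall A B : T -> T -> R, sumL l (fun j => A i j * sumL l (fun k => B j k * Psi k (x, y))) =
         sumL l (fun k => sumL l (fun j => A i j * B j k) * Psi k (x, y))).
      { intros A B. apply sumL_exchange. }
      assert (F1 : sumL l (fun j => M2 i j (x, y) * d1 (Psi j) (x, y)) = sumL l (fun j => M2 i j (x, y) * Del j (x, y)) +
          sumL l (fun k => sumL l (fun j => M2 i j (x, y) * M1 j k (x, y)) * Psi k (x, y))).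
      { rewrite <- (comm (fun i j => M2 i j (x, y)) (fun i j => M1 i j (x, y))), <- sumL_plus. apply sumL_ext. intros j. unfold Del. ring. }
      assert (F2 : sumL l (fun j => M1 i j (x, y) * d2 (Psi j) (x, y)) =
          sumL l (fun k => sumL l (fun j => M1 i j (x, y) * M2 j k (x, y)) * Psi k (x, y))).
      { rewrite <- (comm (fun i j => M1 i j (x, y)) (fun i j => M2 i j (x, y))). apply sumL_ext. intros j. now rewrite dPsi2. }
      rewrite !sumL_plus, F1, F2.
      assert (F3 : sumL l (fun j => d1 (M2 i j) (x, y) * Psi j (x, y)) + sumL l (fun k => sumL l (fun j => M2 i j (x, y) * M1 j k (x, y)) * Psi k (x, y))
        - (sumL l (fun j => d2 (M1 i j) (x, y) * Psi j (x, y)) + sumL l (fun k => sumL l (fun j => M1 i j (x, y) * M2 j k (x, y)) * Psi k (x, y))) = 0).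
      { rewrite <- !sumL_plus, <- sumL_minus, <- (sumL_0 l). apply sumL_ext. intros k.
        rewrite <- !Rmult_plus_distr_r, (curv i k (x, y) Dpr). ring. }
      lra. }
  exists Psi. split; [|split].
  - intros i; eapply smooth_sub; [|apply sPsi]. intros; eapply box_mono; eauto; lra.
  - intros i. rewrite (psol_at_y0 y0 l M2 c i x0 : Psi i (x0, y0) = _).
    apply (psol_at_y0 x0 l N (fun i _ => e i) i 0).
  - intros i p Dp. split.
    + specialize (Del0 i p Dp). unfold Del in Del0. lra.
    + apply dPsi2. eapply box_mono; eauto; lra.
Qed.

(** * Flattening an equation with vanishing invariant *)

(** With [lieF2], these are the classical Liouville expressions, whose joint vanishing is Lie's
    linearization test. *)
Definition lieF1 (a0 a1 a2 a3 : R2 -> R) (p : R2) : R :=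
  3 * d2 (d2 a0) p - 2 * d1 (d2 a1) p + d1 (d1 a2) p + 3 * a3 p * d1 a0 p - 3 * a2 p * d2 a0 p
  + 2 * a1 p * d2 a1 p - a1 p * d1 a2 p - 3 * a0 p * d2 a2 p + 6 * a0 p * d1 a3 p.

Definition lieF2 (a0 a1 a2 a3 : R2 -> R) (p : R2) : R :=
  d2 (d2 a1) p - 2 * d1 (d2 a2) p + 3 * d1 (d1 a3) p - 3 * a0 p * d2 a3 p + 3 * a1 p * d1 a3 p
  - 2 * a2 p * d1 a2 p + a2 p * d2 a1 p + 3 * a3 p * d1 a1 p - 6 * a3 p * d2 a0 p.

Inductive three := T0 | T1 | T2.
Definition threes := T0 :: T1 :: T2 :: nil.

(** The three coefficients of psi are forced: once the first-order part of the linear system is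
    fixed, they are the unique choice for which the integrability conditions in the rows and columns
    [T1], [T2] hold. *)
Definition kappa11 (a0 a1 a2 a3 : R2 -> R) (p : R2) : R :=
  d2 a0 p - 1 / 3 * d1 a1 p + 2 / 9 * a1 p ^ 2 - 2 / 3 * a0 p * a2 p.
Definition kappa12 (a0 a1 a2 a3 : R2 -> R) (p : R2) : R :=
  1 / 3 * d2 a1 p - 1 / 3 * d1 a2 p + 1 / 9 * a1 p * a2 p - a0 p * a3 p.
Definition kappa22 (a0 a1 a2 a3 : R2 -> R) (p : R2) : R :=
  1 / 3 * d2 a2 p - d1 a3 p + 2 / 9 * a2 p ^ 2 - 2 / 3 * a1 p * a3 p.

(* For (psi, psi_x, psi_y), the system
     psi_xx = a1/3 psi_x - a0 psi_y + kappa11 psi,  psi_xy = a2/3 psi_x - a1/3 psi_y + kappa12 psi,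
     psi_yy = a3 psi_x - a2/3 psi_y + kappa22 psi;
   ratios of its solutions map the integral curves of the equation to straight lines. *)
Definition lie_mx1 a0 a1 a2 a3 (i j : three) : R2 -> R :=
  match i, j with
  | T0, T1 => fun _ => 1
  | T0, _ => fun _ => 0
  | T1, T0 => kappa11 a0 a1 a2 a3 | T1, T1 => fun p => 1 / 3 * a1 p | T1, T2 => fun p => - a0 p
  | T2, T0 => kappa12 a0 a1 a2 a3 | T2, T1 => fun p => 1 / 3 * a2 p | T2, T2 => fun p => - (1 / 3 * a1 p)
  end.

Definition lie_mx2 a0 a1 a2 a3 (i j : three) : R2 -> R :=
  match i, j with
  | T0, T2 => fun _ => 1
  | T0, _ => fun _ => 0
  | T1, T0 => kappa12 a0 a1 a2 a3 | T1, T1 => fun p => 1 / 3 * a2 p | T1, T2 => fun p => - (1 / 3 * a1 p)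
  | T2, T0 => kappa22 a0 a1 a2 a3 | T2, T1 => a3 | T2, T2 => fun p => - (1 / 3 * a2 p)
  end.

Lemma d1_const c p : d1 (fun _ => c) p = 0.
Proof. apply is_derive_unique, der_const. Qed.
Lemma d2_const c p : d2 (fun _ => c) p = 0.
Proof. apply is_derive_unique, der_const. Qed.

(** All entries agree identically by the choice of the kappas, except those in column [T0] and rows
    [T1], [T2], where the difference of the two sides is [- lieF1 / 3] and [- lieF2 / 3]. *)
Lemma lie_curvature (D : R2 -> Prop) a0 a1 a2 a3 :
  open2 D -> sm D a0 -> sm D a1 -> sm D a2 -> sm D a3 ->
  (forall p, D p -> lieF1 a0 a1 a2 a3 p = 0 /\ lieF2 a0 a1 a2 a3 p = 0) ->
  let M1 := lie_mx1 a0 a1 a2 a3 in let M2 := lie_mx2 a0 a1 a2 a3 in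
  forall i k p, D p ->
     d1 (M2 i k) p + sumL threes (fun j => M2 i j p * M1 j k p) = d2 (M1 i k) p + sumL threes (fun j => M1 i j p * M2 j k p).
Proof.
  intros o s0 s1 s2 s3 hF M1 M2 i k [x y] Dp. destruct (hF _ Dp) as [h1 h2]. clear hF.
  unfold lieF1, lieF2 in h1, h2.
  assert (X1 : forall f, sm D f -> is_derive (fun s => f (s, y)) x (d1 f (x, y))) by (intros; now apply (is_d1 D)).
  assert (X2 : forall f, sm D f -> is_derive (fun s => f (x, s)) y (d2 f (x, y))) by (intros; now apply (is_d2 D)).
  assert (cm : forall f, sm D f -> d2 (d1 f) (x, y) = d1 (d2 f) (x, y)) by (intros; symmetry; now apply (smooth_d12 D)).
  assert (R11 : d2 (kappa11 a0 a1 a2 a3) (x, y) = d2 (d2 a0) (x, y) - 1 / 3 * d1 (d2 a1) (x, y) + 4 / 9 * a1 (x, y) * d2 a1 (x, y)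
     - 2 / 3 * (d2 a0 (x, y) * a2 (x, y) + a0 (x, y) * d2 a2 (x, y))).
  { rewrite <- cm by auto. apply is_derive_unique; simpl. eapply der_eq; [unfold kappa11; der ltac:(leaf2 D)|simpl; field]. }
  assert (R12 : d1 (kappa12 a0 a1 a2 a3) (x, y) = 1 / 3 * d1 (d2 a1) (x, y) - 1 / 3 * d1 (d1 a2) (x, y) +
      1 / 9 * (d1 a1 (x, y) * a2 (x, y) + a1 (x, y) * d1 a2 (x, y)) - (d1 a0 (x, y) * a3 (x, y) + a0 (x, y) * d1 a3 (x, y))).
  { apply is_derive_unique; simpl. eapply der_eq; [unfold kappa12; der ltac:(leaf1 D)|simpl; field]. }
  assert (R12' : d2 (kappa12 a0 a1 a2 a3) (x, y) = 1 / 3 * d2 (d2 a1) (x, y) - 1 / 3 * d1 (d2 a2) (x, y) +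
      1 / 9 * (d2 a1 (x, y) * a2 (x, y) + a1 (x, y) * d2 a2 (x, y)) - (d2 a0 (x, y) * a3 (x, y) + a0 (x, y) * d2 a3 (x, y))).
  { rewrite <- cm by auto. apply is_derive_unique; simpl. eapply der_eq; [unfold kappa12; der ltac:(leaf2 D)|simpl; field]. }
  assert (R22 : d1 (kappa22 a0 a1 a2 a3) (x, y) = 1 / 3 * d1 (d2 a2) (x, y) - d1 (d1 a3) (x, y) + 4 / 9 * a2 (x, y) * d1 a2 (x, y)
     - 2 / 3 * (d1 a1 (x, y) * a3 (x, y) + a1 (x, y) * d1 a3 (x, y))).
  { apply is_derive_unique; simpl. eapply der_eq; [unfold kappa22; der ltac:(leaf1 D)|simpl; field]. }
  assert (S1 : forall f, sm D f -> d1 (fun p => 1 / 3 * f p) (x, y) = 1 / 3 * d1 f (x, y)).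
  { intros f sf. apply is_derive_unique; simpl. eapply der_eq; [der ltac:(leaf1 D)|simpl; field]. }
  assert (S2 : forall f, sm D f -> d2 (fun p => 1 / 3 * f p) (x, y) = 1 / 3 * d2 f (x, y)).
  { intros f sf. apply is_derive_unique; simpl. eapply der_eq; [der ltac:(leaf2 D)|simpl; field]. }
  assert (N1 : forall f, sm D f -> d1 (fun p => - (1 / 3 * f p)) (x, y) = - (1 / 3) * d1 f (x, y)).
  { intros f sf. apply is_derive_unique; simpl. eapply der_eq; [der ltac:(leaf1 D)|simpl; field]. }
  assert (N2 : forall f, sm D f -> d2 (fun p => - (1 / 3 * f p)) (x, y) = - (1 / 3) * d2 f (x, y)).
  { intros f sf. apply is_derive_unique; simpl. eapply der_eq; [der ltac:(leaf2 D)|simpl; field]. }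
  assert (N0 : forall f, sm D f -> d2 (fun p => - f p) (x, y) = - d2 f (x, y)).
  { intros f sf. apply is_derive_unique; simpl. eapply der_eq; [der ltac:(leaf2 D)|simpl; ring]. }
  destruct i, k; unfold M1, M2, lie_mx1, lie_mx2, threes, sumL; cbv beta iota;
    rewrite ?R11, ?R12, ?R12', ?R22, ?d1_const, ?d2_const, ?S1, ?S2, ?N1, ?N2, ?N0 by auto;
    unfold kappa11, kappa12, kappa22; try (field; fail); lra.
Qed.

Lemma quotient_d1 (D : R2 -> Prop) (f h : R2 -> R) (q : R2) : open2 D -> sm D f -> sm D h -> D q -> h q <> 0 ->
  d1 (fun z => f z / h z) q = (d1 f q * h q - f q * d1 h q) / h q ^ 2.
Proof.
  intros o sf sh Dq hq. destruct q as [x y]. apply is_derive_unique; simpl fst; simpl snd.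
  eapply der_eq; [der ltac:(leaf1 D); auto|]. reflexivity.
Qed.

Lemma quotient_d2 (D : R2 -> Prop) (f h : R2 -> R) (q : R2) : open2 D -> sm D f -> sm D h -> D q -> h q <> 0 ->
  d2 (fun z => f z / h z) q = (d2 f q * h q - f q * d2 h q) / h q ^ 2.
Proof.
  intros o sf sh Dq hq. destruct q as [x y]. apply is_derive_unique; simpl fst; simpl snd.
  eapply der_eq; [der ltac:(leaf2 D); auto|]. reflexivity.
Qed.

(** First derivatives of the denominator enter only as multiples of the differential of the ratio,
    and the second derivatives through the combination of numerator and denominator in which the
    psi-coefficients of a common linear system cancel. *)
Lemma quotient_hessian (D : R2 -> Prop) (f f1 f2 h h1 h2 : R2 -> R) (q : R2) : open2 D ->
  sm D f -> sm D f1 -> sm D f2 -> sm D h -> sm D h1 -> sm D h2 ->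
  (forall z, D z -> h z <> 0) ->
  (forall z, D z -> d1 f z = f1 z /\ d2 f z = f2 z /\ d1 h z = h1 z /\ d2 h z = h2 z) -> D q ->
  let phi := fun z => f z / h z in
  d1 (d1 phi) q = (d1 f1 q - phi q * d1 h1 q) / h q - 2 * (h1 q / h q) * d1 phi q /\
  d1 (d2 phi) q = (d1 f2 q - phi q * d1 h2 q) / h q - (h1 q / h q) * d2 phi q - (h2 q / h q) * d1 phi q /\
  d2 (d2 phi) q = (d2 f2 q - phi q * d2 h2 q) / h q - 2 * (h2 q / h q) * d2 phi q.
Proof.
  intros o sf sf1 sf2 sh sh1 sh2 nz hd Dq phi.
  set (N1 := fun z => f1 z * h z - f z * h1 z). set (N2 := fun z => f2 z * h z - f z * h2 z).
  set (h' := fun z => h z ^ 2).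
  assert (nz' : forall z, D z -> h' z <> 0) by (intros; apply pow_nonzero; auto).
  assert (E1 : forall z, D z -> d1 phi z = N1 z / h' z).
  { intros z Dz. destruct (hd z Dz) as (e1 & e2 & e3 & e4). unfold phi, N1, h'. rewrite (quotient_d1 D) by auto. now rewrite e1, e3. }
  assert (E2 : forall z, D z -> d2 phi z = N2 z / h' z).
  { intros z Dz. destruct (hd z Dz) as (e1 & e2 & e3 & e4). unfold phi, N2, h'. rewrite (quotient_d2 D) by auto. now rewrite e2, e4. }
  assert (sN1 : sm D N1) by (unfold N1; smt). assert (sN2 : sm D N2) by (unfold N2; smt).
  assert (sh' : sm D h') by (unfold h'; smt).
  assert (A1 : d1 N1 q = d1 f1 q * h q - f q * d1 h1 q).
  { destruct q as [x y]. destruct (hd _ Dq) as (e1 & e2 & e3 & e4). apply is_derive_unique; simpl fst; simpl snd.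
    unfold N1. eapply der_eq; [der ltac:(leaf1 D)|]. rewrite e1, e3. ring. }
  assert (A2 : d1 N2 q = d1 f2 q * h q + f2 q * h1 q - f1 q * h2 q - f q * d1 h2 q).
  { destruct q as [x y]. destruct (hd _ Dq) as (e1 & e2 & e3 & e4). apply is_derive_unique; simpl fst; simpl snd.
    unfold N2. eapply der_eq; [der ltac:(leaf1 D)|]. rewrite e1, e3. ring. }
  assert (A3 : d2 N2 q = d2 f2 q * h q - f q * d2 h2 q).
  { destruct q as [x y]. destruct (hd _ Dq) as (e1 & e2 & e3 & e4). apply is_derive_unique; simpl fst; simpl snd.
    unfold N2. eapply der_eq; [der ltac:(leaf2 D)|]. rewrite e2, e4. ring. }
  assert (B1 : d1 h' q = 2 * h q * h1 q).
  { destruct q as [x y]. destruct (hd _ Dq) as (e1 & e2 & e3 & e4). apply is_derive_unique; simpl fst; simpl snd.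
    unfold h'. eapply der_eq; [der ltac:(leaf1 D)|]. rewrite e3. simpl; ring. }
  assert (B2 : d2 h' q = 2 * h q * h2 q).
  { destruct q as [x y]. destruct (hd _ Dq) as (e1 & e2 & e3 & e4). apply is_derive_unique; simpl fst; simpl snd.
    unfold h'. eapply der_eq; [der ltac:(leaf2 D)|]. rewrite e4. simpl; ring. }
  rewrite (d1_ext D (d1 phi) (fun z => N1 z / h' z)) by auto.
  rewrite (d1_ext D (d2 phi) (fun z => N2 z / h' z)) by auto.
  rewrite (d2_ext D (d2 phi) (fun z => N2 z / h' z)) by auto.
  rewrite !(quotient_d1 D), !(quotient_d2 D), A1, A2, A3, B1, B2, E1, E2 by auto.
  unfold N1, N2, h', phi. repeat split; field; auto.
Qed.

(** The terms in [w1] and [w2] cancel: they are a projective change of the connection with flat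
    coordinates [f1], [f2], and such a change does not affect unparametrised geodesics. *)
Lemma lift0_flat (f1 f2 : R2 -> R) (q : R2) (a0 a1 a2 a3 w1 w2 : R) :
  jac f1 f2 q <> 0 ->
  (forall f, f = f1 \/ f = f2 ->
    d1 (d1 f) q = 1 / 3 * a1 * d1 f q - a0 * d2 f q - 2 * w1 * d1 f q /\
    d1 (d2 f) q = 1 / 3 * a2 * d1 f q - 1 / 3 * a1 * d2 f q - w1 * d2 f q - w2 * d1 f q /\
    d2 (d2 f) q = a3 * d1 f q - 1 / 3 * a2 * d2 f q - 2 * w2 * d2 f q) ->
  lift0 (fun z => (f1 z, f2 z)) q (0, 0, 0, 0) = (a0, a1, a2, a3).
Proof.
  intros hJ h. destruct (h f1 (or_introl eq_refl)) as (e1 & e2 & e3).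
  destruct (h f2 (or_intror eq_refl)) as (e4 & e5 & e6).
  unfold lift0, u1, u2, u3, u4; simpl fst; simpl snd.
  change (d1 (fun z => f1 z)) with (d1 f1). change (d2 (fun z => f1 z)) with (d2 f1).
  change (d1 (fun z => f2 z)) with (d1 f2). change (d2 (fun z => f2 z)) with (d2 f2).
  rewrite e1, e2, e3, e4, e5, e6. unfold jac in hJ.
  repeat apply f_equal2; field; auto.
Qed.

(** The conclusion is recorded as the pull-back of [y'' = 0] by [f], since [lift0] then involves
    derivatives of the known ratios only and none of their inverse; [lift0_inverse] translates this
    into a statement about [transform]. *)
Theorem flatten (U : R2 -> Prop) a0 a1 a2 a3 (p : R2) :
  open2 U -> U p -> sm U a0 -> sm U a1 -> sm U a2 -> sm U a3 ->
  (forall q, U q -> lieF1 a0 a1 a2 a3 q = 0 /\ lieF2 a0 a1 a2 a3 q = 0) ->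
  exists (V V' : R2 -> Prop) (f1 f2 g1 g2 : R2 -> R),
    V p /\ (forall q, V q -> U q) /\ open2 V /\ open2 V' /\
    sm V f1 /\ sm V f2 /\ sm V' g1 /\ sm V' g2 /\
    (forall z, V z -> V' (f1 z, f2 z) /\ (g1 (f1 z, f2 z), g2 (f1 z, f2 z)) = z) /\
    (forall q, V' q -> V (g1 q, g2 q) /\ (f1 (g1 q, g2 q), f2 (g1 q, g2 q)) = q) /\
    (forall z, V z -> jac f1 f2 z <> 0 /\
       lift0 (fun z => (f1 z, f2 z)) z (0, 0, 0, 0) = section_of a0 a1 a2 a3 z).
Proof.
  intros oU Up s0 s1 s2 s3 hF. destruct p as [x0 y0].
  destruct (open_has_box U x0 y0 oU Up) as [r [hr hb]].
  set (B := box x0 y0 r). pose proof (open_box x0 y0 r) as oB. fold B in oB.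
  assert (sB : forall f, sm U f -> sm B f) by (intros f sf; eapply smooth_sub; [exact hb|exact sf]).
  assert (C := lie_curvature B a0 a1 a2 a3 oB (sB _ s0) (sB _ s1) (sB _ s2) (sB _ s3) (fun q hq => hF q (hb q hq))).
  cbv zeta in C.
  set (M1 := lie_mx1 a0 a1 a2 a3) in *. set (M2 := lie_mx2 a0 a1 a2 a3) in *.
  assert (sr : sm B (kappa11 a0 a1 a2 a3) /\ sm B (kappa12 a0 a1 a2 a3) /\ sm B (kappa22 a0 a1 a2 a3)).
  { unfold kappa11, kappa12, kappa22. repeat split; smt. }
  destruct sr as (r11 & r12 & r22).
  assert (sM1 : forall i j, sm B (M1 i j)).
  { intros [] []; unfold M1, lie_mx1; auto; smt. }
  assert (sM2 : forall i j, sm B (M2 i j)).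
  { intros [] []; unfold M2, lie_mx2; auto; smt. }
  assert (fl : forall i, In i threes) by (intros []; simpl; auto).
  set (B' := box x0 y0 (r / 4)).
  pose proof (open_box x0 y0 (r / 4)) as oB'. fold B' in oB'.
  (* The initial vectors are the standard basis: [H] starts with value 1 and serves as denominator,
     and the ratios of [X] and [Y] to it have the identity as Jacobian matrix at the centre. *)
  destruct (flat_system x0 y0 r threes M1 M2 (fun i => match i with T0 => 1 | _ => 0 end) hr fl sM1 sM2 C) as (H & sH & H0 & dH).
  destruct (flat_system x0 y0 r threes M1 M2 (fun i => match i with T1 => 1 | _ => 0 end) hr fl sM1 sM2 C) as (X & sX & X0 & dX).
  destruct (flat_system x0 y0 r threes M1 M2 (fun i => match i with T2 => 1 | _ => 0 end) hr fl sM1 sM2 C) as (Y & sY & Y0 & dY).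
  fold B' in sH, dH, sX, dX, sY, dY.
  set (W := fun z => B' z /\ H T0 z <> 0).
  assert (oW : open2 W).
  { intros z [Bz hz]. apply filter_and; [now apply oB'|].
    pose proof (sm_continuous B' (H T0) z (sH T0) Bz) as cH.
    apply (cH (fun t => t <> 0)). apply (open_neq 0). exact hz. }
  assert (bc : B' (x0, y0)) by (apply box_center; lra).
  assert (Wp : W (x0, y0)) by (split; [auto|rewrite H0; lra]).
  assert (WB : forall z, W z -> B' z) by (intros z hz; apply hz).
  assert (WU : forall z, W z -> U z) by (intros z [hz _]; apply hb; eapply box_mono; [|apply hz]; lra).
  assert (sW : forall f, sm B' f -> sm W f) by (intros f sf; eapply smooth_sub; [exact WB|exact sf]).
  assert (nz : forall z, W z -> H T0 z <> 0) by (intros z hz; apply hz).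
  assert (quot : forall Z : three -> R2 -> R, (forall i, sm B' (Z i)) ->
     (forall i p, B' p -> d1 (Z i) p = sumL threes (fun j => M1 i j p * Z j p) /\ d2 (Z i) p = sumL threes (fun j => M2 i j p * Z j p)) ->
     forall q, W q -> let f := fun z => Z T0 z / H T0 z in
     let w1 := H T1 q / H T0 q in let w2 := H T2 q / H T0 q in
     d1 f q = (Z T1 q * H T0 q - Z T0 q * H T1 q) / H T0 q ^ 2 /\
     d2 f q = (Z T2 q * H T0 q - Z T0 q * H T2 q) / H T0 q ^ 2 /\
     d1 (d1 f) q = 1 / 3 * a1 q * d1 f q - a0 q * d2 f q - 2 * w1 * d1 f q /\
     d1 (d2 f) q = 1 / 3 * a2 q * d1 f q - 1 / 3 * a1 q * d2 f q - w1 * d2 f q - w2 * d1 f q /\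
     d2 (d2 f) q = a3 q * d1 f q - 1 / 3 * a2 q * d2 f q - 2 * w2 * d2 f q).
  { intros Z sZ dZ q Wq f w1 w2.
    assert (dd0 : forall (Z' : three -> R2 -> R), (forall i p, B' p -> d1 (Z' i) p = sumL threes (fun j => M1 i j p * Z' j p) /\ d2 (Z' i) p = sumL threes (fun j => M2 i j p * Z' j p)) ->
      forall z, W z -> d1 (Z' T0) z = Z' T1 z /\ d2 (Z' T0) z = Z' T2 z).
    { intros Z' dZ' z hz. destruct (dZ' T0 z (WB z hz)) as [e1 e2]. rewrite e1, e2. simpl. split; ring. }
    destruct (dd0 Z dZ q Wq) as [z1 z2]. destruct (dd0 H dH q Wq) as [k1 k2].
    assert (D1 : d1 f q = (Z T1 q * H T0 q - Z T0 q * H T1 q) / H T0 q ^ 2).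
    { unfold f. rewrite (quotient_d1 W) by auto. now rewrite z1, k1. }
    assert (D2 : d2 f q = (Z T2 q * H T0 q - Z T0 q * H T2 q) / H T0 q ^ 2).
    { unfold f. rewrite (quotient_d2 W) by auto. now rewrite z2, k2. }
    destruct (quotient_hessian W (Z T0) (Z T1) (Z T2) (H T0) (H T1) (H T2) q oW) as (h1 & h2 & h3); auto.
    { intros z hz. destruct (dd0 Z dZ z hz), (dd0 H dH z hz). auto. }
    unfold f, w1, w2 in *. clear f w1 w2.
    destruct (dZ T1 q (WB q Wq)) as [p1 p2]. destruct (dZ T2 q (WB q Wq)) as [p3 p4].
    destruct (dH T1 q (WB q Wq)) as [q1 q2]. destruct (dH T2 q (WB q Wq)) as [q3 q4].
    rewrite h1, h2, h3, p1, p3, p4, q1, q3, q4, D1, D2. pose proof (nz q Wq).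
    split; [reflexivity|]. split; [reflexivity|]. unfold sumL, threes, M1, M2, lie_mx1, lie_mx2.
    repeat split; field; auto. }
  set (f1 := fun z => X T0 z / H T0 z). set (f2 := fun z => Y T0 z / H T0 z).
  assert (sf1 : sm W f1) by (unfold f1; smt; auto).
  assert (sf2 : sm W f2) by (unfold f2; smt; auto).
  assert (hJ : jac f1 f2 (x0, y0) <> 0).
  { unfold jac. destruct (quot X sX dX _ Wp) as (j1 & j2 & _). destruct (quot Y sY dY _ Wp) as (j3 & j4 & _).
    fold f1 in j1, j2. fold f2 in j3, j4. rewrite j1, j2, j3, j4, !H0, !X0, !Y0. lra. }
  destruct (inverse_function W f1 f2 (x0, y0) oW Wp sf1 sf2 hJ) as (V & V' & g1 & g2 & oV & oV' & Vp & VW & sg1 & sg2 & hfg & hgf & hJV).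
  exists V, V', f1, f2, g1, g2.
  assert (sV : forall f, sm W f -> sm V f) by (intros f sf; eapply smooth_sub; [exact VW|exact sf]).
  refine (conj Vp (conj _ (conj oV (conj oV' (conj (sV _ sf1) (conj (sV _ sf2) (conj sg1 (conj sg2 (conj hfg (conj hgf _)))))))))).
  - intros q hq. apply WU, VW, hq.
  - intros z Vz. split; [now apply hJV|].
    apply (lift0_flat f1 f2 z _ _ _ _ (H T1 z / H T0 z) (H T2 z / H T0 z)); [now apply hJV|].
    intros f [->| ->]; [apply (quot X sX dX z (VW z Vz))|apply (quot Y sY dY z (VW z Vz))].
Qed.

(** * Functoriality of the lift *)

Lemma chain_d1 (V V' : R2 -> Prop) (h g1 g2 : R2 -> R) (q : R2) : open2 V -> sm V h -> sm V' g1 -> sm V' g2 ->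
  V' q -> V (g1 q, g2 q) ->
  d1 (fun z => h (g1 z, g2 z)) q = d1 g1 q * d1 h (g1 q, g2 q) + d1 g2 q * d2 h (g1 q, g2 q).
Proof.
  intros oV sh s1 s2 hq hg. destruct q as [x y]. apply is_derive_unique; simpl fst; simpl snd.
  apply (is_derive_comp_R2 V h (fun s => g1 (s, y)) (fun s => g2 (s, y))); auto; try (apply (is_d1 V'); auto).
Qed.

Lemma chain_d2 (V V' : R2 -> Prop) (h g1 g2 : R2 -> R) (q : R2) : open2 V -> sm V h -> sm V' g1 -> sm V' g2 ->
  V' q -> V (g1 q, g2 q) ->
  d2 (fun z => h (g1 z, g2 z)) q = d2 g1 q * d1 h (g1 q, g2 q) + d2 g2 q * d2 h (g1 q, g2 q).
Proof.
  intros oV sh s1 s2 hq hg. destruct q as [x y]. apply is_derive_unique; simpl fst; simpl snd.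
  apply (is_derive_comp_R2 V h (fun s => g1 (x, s)) (fun s => g2 (x, s))); auto; try (apply (is_d2 V'); auto).
Qed.

Lemma smooth_chain (V V' : R2 -> Prop) (h g1 g2 : R2 -> R) : open2 V -> sm V h -> sm V' g1 -> sm V' g2 ->
  (forall q, V' q -> V (g1 q, g2 q)) -> sm V' (fun z => h (g1 z, g2 z)).
Proof. intros. now apply (smooth_comp_R2 (V := NR2) V' V). Qed.

Lemma d1_mult (D : R2 -> Prop) (f h : R2 -> R) (q : R2) : sm D f -> sm D h -> D q ->
  d1 (fun z => f z * h z) q = d1 f q * h q + f q * d1 h q.
Proof.
  intros sf sh Dq. destruct q as [x y]. apply is_derive_unique; simpl fst; simpl snd.
  eapply der_eq; [der ltac:(leaf1 D)|]. reflexivity.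
Qed.

Lemma d2_mult (D : R2 -> Prop) (f h : R2 -> R) (q : R2) : sm D f -> sm D h -> D q ->
  d2 (fun z => f z * h z) q = d2 f q * h q + f q * d2 h q.
Proof.
  intros sf sh Dq. destruct q as [x y]. apply is_derive_unique; simpl fst; simpl snd.
  eapply der_eq; [der ltac:(leaf2 D)|]. reflexivity.
Qed.

Lemma d1_plus (D : R2 -> Prop) (f h : R2 -> R) (q : R2) : sm D f -> sm D h -> D q ->
  d1 (fun z => f z + h z) q = d1 f q + d1 h q.
Proof.
  intros sf sh Dq. destruct q as [x y]. apply is_derive_unique; simpl fst; simpl snd.
  eapply der_eq; [der ltac:(leaf1 D)|]. reflexivity.
Qed.

Lemma d2_plus (D : R2 -> Prop) (f h : R2 -> R) (q : R2) : sm D f -> sm D h -> D q ->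
  d2 (fun z => f z + h z) q = d2 f q + d2 h q.
Proof.
  intros sf sh Dq. destruct q as [x y]. apply is_derive_unique; simpl fst; simpl snd.
  eapply der_eq; [der ltac:(leaf2 D)|]. reflexivity.
Qed.

Lemma chain_second (V V' : R2 -> Prop) (h g1 g2 : R2 -> R) (q : R2) : open2 V -> open2 V' ->
  sm V h -> sm V' g1 -> sm V' g2 -> (forall q, V' q -> V (g1 q, g2 q)) -> V' q ->
  let k := fun z => h (g1 z, g2 z) in let w := (g1 q, g2 q) in
  d1 (d1 k) q = d1 (d1 g1) q * d1 h w + d1 (d1 g2) q * d2 h w
     + d1 g1 q ^ 2 * d1 (d1 h) w + 2 * (d1 g1 q * d1 g2 q) * d1 (d2 h) w + d1 g2 q ^ 2 * d2 (d2 h) w /\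
  d1 (d2 k) q = d1 (d2 g1) q * d1 h w + d1 (d2 g2) q * d2 h w
     + d1 g1 q * d2 g1 q * d1 (d1 h) w + (d1 g1 q * d2 g2 q + d2 g1 q * d1 g2 q) * d1 (d2 h) w
     + d1 g2 q * d2 g2 q * d2 (d2 h) w /\
  d2 (d2 k) q = d2 (d2 g1) q * d1 h w + d2 (d2 g2) q * d2 h w
     + d2 g1 q ^ 2 * d1 (d1 h) w + 2 * (d2 g1 q * d2 g2 q) * d1 (d2 h) w + d2 g2 q ^ 2 * d2 (d2 h) w.
Proof.
  intros oV oV' sh s1 s2 hg hq k w.
  assert (E1 : forall z, V' z -> d1 k z = d1 g1 z * d1 h (g1 z, g2 z) + d1 g2 z * d2 h (g1 z, g2 z)).
  { intros z hz. apply (chain_d1 V V'); auto. }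
  assert (E2 : forall z, V' z -> d2 k z = d2 g1 z * d1 h (g1 z, g2 z) + d2 g2 z * d2 h (g1 z, g2 z)).
  { intros z hz. apply (chain_d2 V V'); auto. }
  assert (sh1 : sm V (d1 h)) by smt. assert (sh2 : sm V (d2 h)) by smt.
  assert (t1 : sm V' (d1 g1)) by smt. assert (t2 : sm V' (d2 g1)) by smt.
  assert (t3 : sm V' (d1 g2)) by smt. assert (t4 : sm V' (d2 g2)) by smt.
  assert (c1 := smooth_chain V V' (d1 h) g1 g2 oV sh1 s1 s2 hg).
  assert (c2 := smooth_chain V V' (d2 h) g1 g2 oV sh2 s1 s2 hg).
  assert (cm : d2 (d1 h) w = d1 (d2 h) w) by (symmetry; apply (smooth_d12 V); auto; now apply hg).
  rewrite (d1_ext V' (d1 k) _ q oV' hq E1), (d1_ext V' (d2 k) _ q oV' hq E2), (d2_ext V' (d2 k) _ q oV' hq E2).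
  rewrite !(d1_plus V'), !(d2_plus V') by (auto; smt).
  rewrite !(d1_mult V'), !(d2_mult V') by (auto; smt).
  rewrite !(chain_d1 V V'), !(chain_d2 V V') by auto. fold w. rewrite cm. repeat split; ring.
Qed.

Lemma jac_comp (V V' : R2 -> Prop) (f1 f2 g1 g2 : R2 -> R) (q : R2) : open2 V -> sm V f1 -> sm V f2 ->
  sm V' g1 -> sm V' g2 -> V' q -> V (g1 q, g2 q) ->
  jac (fun z => f1 (g1 z, g2 z)) (fun z => f2 (g1 z, g2 z)) q = jac f1 f2 (g1 q, g2 q) * jac g1 g2 q.
Proof.
  intros oV sf1 sf2 s1 s2 hq hg. unfold jac. rewrite !(chain_d1 V V'), !(chain_d2 V V') by auto. ring.
Qed.

(** The argument of [lift0] is the inverse of the transformation, so composition is contravariant: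
    lifting by [f] and then by [g] is lifting by f o g. *)
Lemma lift0_comp (V V' : R2 -> Prop) (f1 f2 g1 g2 : R2 -> R) (q : R2) (u : R4) : open2 V -> open2 V' ->
  sm V f1 -> sm V f2 -> sm V' g1 -> sm V' g2 -> (forall q, V' q -> V (g1 q, g2 q)) -> V' q ->
  jac f1 f2 (g1 q, g2 q) <> 0 -> jac g1 g2 q <> 0 ->
  lift0 (fun z => (g1 z, g2 z)) q (lift0 (fun z => (f1 z, f2 z)) (g1 q, g2 q) u)
  = lift0 (fun z => (f1 (g1 z, g2 z), f2 (g1 z, g2 z))) q u.
Proof.
  intros oV oV' sf1 sf2 s1 s2 hg hq Jf Jg.
  destruct (chain_second V V' f1 g1 g2 q) as (e1 & e2 & e3); auto.
  destruct (chain_second V V' f2 g1 g2 q) as (e4 & e5 & e6); auto.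
  unfold lift0; simpl fst; simpl snd.
  change (d1 (fun z => f1 z)) with (d1 f1). change (d2 (fun z => f1 z)) with (d2 f1).
  change (d1 (fun z => f2 z)) with (d1 f2). change (d2 (fun z => f2 z)) with (d2 f2).
  change (d1 (fun z => g1 z)) with (d1 g1). change (d2 (fun z => g1 z)) with (d2 g1).
  change (d1 (fun z => g2 z)) with (d1 g2). change (d2 (fun z => g2 z)) with (d2 g2).
  rewrite e1, e2, e3, e4, e5, e6. rewrite !(chain_d1 V V'), !(chain_d2 V V') by auto.
  assert (Jfg : jac f1 f2 (g1 q, g2 q) * jac g1 g2 q <> 0) by now apply Rmult_integral_contrapositive.
  unfold jac in *.
  (* All partial derivatives become independent variables; what remains is a rational identity whose
     denominators are the two Jacobians and their product. *)
  set (w := (g1 q, g2 q)) in *. clearbody w. clear - Jf Jg Jfg.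
  generalize dependent (d1 (d1 g1) q). generalize dependent (d1 (d2 g1) q). generalize dependent (d2 (d2 g1) q).
  generalize dependent (d1 (d1 g2) q). generalize dependent (d1 (d2 g2) q). generalize dependent (d2 (d2 g2) q).
  generalize dependent (d1 (d1 f1) w). generalize dependent (d1 (d2 f1) w). generalize dependent (d2 (d2 f1) w).
  generalize dependent (d1 (d1 f2) w). generalize dependent (d1 (d2 f2) w). generalize dependent (d2 (d2 f2) w).
  generalize dependent (d1 g1 q). generalize dependent (d2 g1 q). generalize dependent (d1 g2 q). generalize dependent (d2 g2 q).
  generalize dependent (d1 f1 w). generalize dependent (d2 f1 w). generalize dependent (d1 f2 w). generalize dependent (d2 f2 w).
  generalize (u1 u) (u2 u) (u3 u) (u4 u). unfold u1, u2, u3, u4; simpl fst; simpl snd. clear.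
  intros a0 a1 a2 a3 D C B A Jf d c b a Jg Jfg.
  assert (Jfg' : (a * A + c * B) * (b * C + d * D) - (b * A + d * B) * (a * C + c * D) <> 0).
  { replace ((a * A + c * B) * (b * C + d * D) - (b * A + d * B) * (a * C + c * D)) with ((A * D - B * C) * (a * d - b * c)) by ring. auto. }
  intros. apply f_equal2; [apply f_equal2; [apply f_equal2|]|]; field; repeat split; auto.
Qed.

Lemma second_ext (D : R2 -> Prop) (f g : R2 -> R) p : open2 D -> D p -> (forall q, D q -> f q = g q) ->
  d1 f p = d1 g p /\ d2 f p = d2 g p /\ d1 (d1 f) p = d1 (d1 g) p /\ d1 (d2 f) p = d1 (d2 g) p /\ d2 (d2 f) p = d2 (d2 g) p.
Proof.
  intros o Dp e.
  assert (e1 : forall q, D q -> d1 f q = d1 g q) by (intros; now apply (d1_ext D)).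
  assert (e2 : forall q, D q -> d2 f q = d2 g q) by (intros; now apply (d2_ext D)).
  repeat split; auto; [apply (d1_ext D)|apply (d1_ext D)|apply (d2_ext D)]; auto.
Qed.

Lemma lift0_ext (D : R2 -> Prop) (g h : R2 -> R2) q u : open2 D -> D q -> (forall z, D z -> g z = h z) ->
  lift0 g q u = lift0 h q u.
Proof.
  intros o Dq e.
  destruct (second_ext D (fun z => fst (g z)) (fun z => fst (h z)) q o Dq) as (e1 & e2 & e3 & e4 & e5).
  { intros z hz. now rewrite e. }
  destruct (second_ext D (fun z => snd (g z)) (fun z => snd (h z)) q o Dq) as (k1 & k2 & k3 & k4 & k5).
  { intros z hz. now rewrite e. }
  unfold lift0. now rewrite e1, e2, e3, e4, e5, k1, k2, k3, k4, k5.
Qed.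

Lemma d1_fst : d1 (fun z : R2 => fst z) = fun _ => 1.
Proof. apply functional_extensionality; intros p. apply is_derive_unique; simpl. apply der_id. Qed.
Lemma d2_fst : d2 (fun z : R2 => fst z) = fun _ => 0.
Proof. apply functional_extensionality; intros p. apply is_derive_unique; simpl. apply der_const. Qed.
Lemma d1_snd : d1 (fun z : R2 => snd z) = fun _ => 0.
Proof. apply functional_extensionality; intros p. apply is_derive_unique; simpl. apply der_const. Qed.
Lemma d2_snd : d2 (fun z : R2 => snd z) = fun _ => 1.
Proof. apply functional_extensionality; intros p. apply is_derive_unique; simpl. apply der_id. Qed.

Lemma lift0_id q u : lift0 (fun z => z) q u = u.
Proof.
  unfold lift0. rewrite d1_fst, d2_fst, d1_snd, d2_snd, !d1_const, !d2_const.
  destruct u as [[[a b] c] d]; unfold u1, u2, u3, u4; simpl fst; simpl snd.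
  apply f_equal2; [apply f_equal2; [apply f_equal2|]|]; field.
Qed.

Lemma jac_ext (D : R2 -> Prop) (f1 f2 g1 g2 : R2 -> R) q : open2 D -> D q ->
  (forall z, D z -> f1 z = g1 z /\ f2 z = g2 z) -> jac f1 f2 q = jac g1 g2 q.
Proof.
  intros o Dq e.
  destruct (second_ext D f1 g1 q o Dq) as (e1 & e2 & _); [intros; now apply e|].
  destruct (second_ext D f2 g2 q o Dq) as (k1 & k2 & _); [intros; now apply e|].
  unfold jac. now rewrite e1, e2, k1, k2.
Qed.

Lemma jac_id q : jac (fun z => fst z) (fun z => snd z) q = 1.
Proof. unfold jac. rewrite d1_fst, d2_fst, d1_snd, d2_snd. ring. Qed.

(** By the chain rule for f o g = id the two Jacobians have product 1, so neither vanishes and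
    functoriality applies. *)
Lemma lift0_inverse (V V' : R2 -> Prop) (f1 f2 g1 g2 : R2 -> R) (q : R2) (u : R4) : open2 V -> open2 V' ->
  sm V f1 -> sm V f2 -> sm V' g1 -> sm V' g2 -> (forall q, V' q -> V (g1 q, g2 q)) ->
  (forall q, V' q -> (f1 (g1 q, g2 q), f2 (g1 q, g2 q)) = q) -> V' q ->
  jac f1 f2 (g1 q, g2 q) <> 0 /\ jac g1 g2 q <> 0 /\
  lift0 (fun z => (g1 z, g2 z)) q (lift0 (fun z => (f1 z, f2 z)) (g1 q, g2 q) u) = u.
Proof.
  intros oV oV' sf1 sf2 s1 s2 hg hfg hq.
  pose proof (jac_comp V V' f1 f2 g1 g2 q oV sf1 sf2 s1 s2 hq (hg q hq)) as J.
  rewrite (jac_ext V' _ _ (fun z => fst z) (fun z => snd z) q oV' hq), jac_id in J.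
  2: { intros z hz. specialize (hfg z hz). destruct z; simpl. now injection hfg. }
  assert (Jf : jac f1 f2 (g1 q, g2 q) <> 0) by (intros h; rewrite h in J; lra).
  assert (Jg : jac g1 g2 q <> 0) by (intros h; rewrite h in J; lra).
  split; auto. split; auto.
  rewrite (lift0_comp V V') by auto.
  rewrite (lift0_ext V' _ (fun z => z)) by auto. apply lift0_id.
Qed.

(** * Invariance of the vanishing of F *)

Lemma lieF_ext (D : R2 -> Prop) a0 a1 a2 a3 b0 b1 b2 b3 p : open2 D -> D p ->
  (forall q, D q -> a0 q = b0 q /\ a1 q = b1 q /\ a2 q = b2 q /\ a3 q = b3 q) ->
  lieF1 a0 a1 a2 a3 p = lieF1 b0 b1 b2 b3 p /\ lieF2 a0 a1 a2 a3 p = lieF2 b0 b1 b2 b3 p.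
Proof.
  intros o Dp e.
  destruct (second_ext D a0 b0 p o Dp) as (h1 & h2 & h3 & h4 & h5); [intros; now apply e|].
  destruct (second_ext D a1 b1 p o Dp) as (i1 & i2 & i3 & i4 & i5); [intros; now apply e|].
  destruct (second_ext D a2 b2 p o Dp) as (j1 & j2 & j3 & j4 & j5); [intros; now apply e|].
  destruct (second_ext D a3 b3 p o Dp) as (k1 & k2 & k3 & k4 & k5); [intros; now apply e|].
  destruct (e p Dp) as (l1 & l2 & l3 & l4).
  unfold lieF1, lieF2. now rewrite ?h1, ?h2, ?h3, ?h4, ?h5, ?i1, ?i2, ?i3, ?i4, ?i5, ?j1, ?j2, ?j3, ?j4, ?j5, ?k1, ?k2, ?k3, ?k4, ?k5, l1, l2, l3, l4.
Qed.

(* G^k_ij are the Christoffel symbols of a flat torsion-free connection. *)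
Lemma lieF_flat_connection (D : R2 -> Prop) (G111 G112 G122 G211 G212 G222 : R2 -> R) : open2 D ->
  sm D G111 -> sm D G112 -> sm D G122 -> sm D G211 -> sm D G212 -> sm D G222 ->
  (forall z, D z ->
    d2 G111 z = d1 G112 z + (G212 z * G112 z - G211 z * G122 z) /\
    d2 G211 z = d1 G212 z + (G112 z * G211 z + G212 z * G212 z - G111 z * G212 z - G211 z * G222 z) /\
    d2 G112 z = d1 G122 z + (G122 z * G111 z + G222 z * G112 z - G112 z * G112 z - G212 z * G122 z) /\
    d2 G212 z = d1 G222 z + (G122 z * G211 z - G112 z * G212 z)) ->
  forall p, D p ->
  lieF1 (fun z => - G211 z) (fun z => G111 z - 2 * G212 z) (fun z => 2 * G112 z - G222 z) G122 p = 0 /\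
  lieF2 (fun z => - G211 z) (fun z => G111 z - 2 * G212 z) (fun z => 2 * G112 z - G222 z) G122 p = 0.
Proof.
  intros o s111 s112 s122 s211 s212 s222 e [x y] Dp.
  set (p := (x, y)) in *.
  assert (opp1 : forall f, sm D f -> forall q, D q -> d1 (fun z => - f z) q = - d1 f q).
  { intros f sf [a b] hq. apply is_derive_unique; simpl fst; simpl snd. eapply der_eq; [der ltac:(leaf1 D)|]. reflexivity. }
  assert (opp2 : forall f, sm D f -> forall q, D q -> d2 (fun z => - f z) q = - d2 f q).
  { intros f sf [a b] hq. apply is_derive_unique; simpl fst; simpl snd. eapply der_eq; [der ltac:(leaf2 D)|]. reflexivity. }
  assert (m1 : forall f h, sm D f -> sm D h -> forall q, D q -> d1 (fun z => f z - 2 * h z) q = d1 f q - 2 * d1 h q).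
  { intros f h sf sh [a b] hq. apply is_derive_unique; simpl fst; simpl snd. eapply der_eq; [der ltac:(leaf1 D)|]. ring. }
  assert (m2 : forall f h, sm D f -> sm D h -> forall q, D q -> d2 (fun z => f z - 2 * h z) q = d2 f q - 2 * d2 h q).
  { intros f h sf sh [a b] hq. apply is_derive_unique; simpl fst; simpl snd. eapply der_eq; [der ltac:(leaf2 D)|]. ring. }
  assert (n1 : forall f h, sm D f -> sm D h -> forall q, D q -> d1 (fun z => 2 * f z - h z) q = 2 * d1 f q - d1 h q).
  { intros f h sf sh [a b] hq. apply is_derive_unique; simpl fst; simpl snd. eapply der_eq; [der ltac:(leaf1 D)|]. ring. }
  assert (n2 : forall f h, sm D f -> sm D h -> forall q, D q -> d2 (fun z => 2 * f z - h z) q = 2 * d2 f q - d2 h q).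
  { intros f h sf sh [a b] hq. apply is_derive_unique; simpl fst; simpl snd. eapply der_eq; [der ltac:(leaf2 D)|]. ring. }
  assert (dd_ : forall f, sm D f -> sm D (d1 f) /\ sm D (d2 f)) by (intros; split; smt).
  assert (cm : forall f, sm D f -> d2 (d1 f) p = d1 (d2 f) p) by (intros; symmetry; now apply (smooth_d12 D)).
  destruct (e p Dp) as (p1 & p2 & p3 & p4).
  (* Derivatives of the flatness equations: they eliminate the second derivatives containing a
     y-derivative of [G111], [G211], [G112] or [G212] wherever these occur, after which both
     expressions cancel identically. *)
  assert (A1 : d1 (d2 G111) p = d1 (d1 G112) p + (d1 G212 p * G112 p + G212 p * d1 G112 p - (d1 G211 p * G122 p + G211 p * d1 G122 p))).
  { rewrite (d1_ext D _ _ p o Dp (fun z hz => proj1 (e z hz))). apply is_derive_unique; unfold p; simpl fst; simpl snd.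
    eapply der_eq; [der ltac:(leaf1 D)|]. ring. }
  assert (A2 : d2 (d2 G211) p = d1 (d2 G212) p + (d2 G112 p * G211 p + G112 p * d2 G211 p + 2 * G212 p * d2 G212 p
      - (d2 G111 p * G212 p + G111 p * d2 G212 p) - (d2 G211 p * G222 p + G211 p * d2 G222 p))).
  { rewrite (d2_ext D _ _ p o Dp (fun z hz => proj1 (proj2 (e z hz)))). rewrite <- cm by auto. apply is_derive_unique; unfold p; simpl fst; simpl snd.
    eapply der_eq; [der ltac:(leaf2 D)|]. ring. }
  assert (A3 : d1 (d2 G212) p = d1 (d1 G222) p + (d1 G122 p * G211 p + G122 p * d1 G211 p - (d1 G112 p * G212 p + G112 p * d1 G212 p))).
  { rewrite (d1_ext D _ _ p o Dp (fun z hz => proj2 (proj2 (proj2 (e z hz))))). apply is_derive_unique; unfold p; simpl fst; simpl snd.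
    eapply der_eq; [der ltac:(leaf1 D)|]. ring. }
  assert (A4 : d1 (d2 G112) p = d1 (d1 G122) p + (d1 G122 p * G111 p + G122 p * d1 G111 p + d1 G222 p * G112 p + G222 p * d1 G112 p
     - 2 * G112 p * d1 G112 p - (d1 G212 p * G122 p + G212 p * d1 G122 p))).
  { rewrite (d1_ext D _ _ p o Dp (fun z hz => proj1 (proj2 (proj2 (e z hz))))). apply is_derive_unique; unfold p; simpl fst; simpl snd.
    eapply der_eq; [der ltac:(leaf1 D)|]. ring. }
  assert (A5 : d2 (d2 G111) p = d1 (d2 G112) p + (d2 G212 p * G112 p + G212 p * d2 G112 p - (d2 G211 p * G122 p + G211 p * d2 G122 p))).
  { rewrite (d2_ext D _ _ p o Dp (fun z hz => proj1 (e z hz))). rewrite <- cm by auto. apply is_derive_unique; unfold p; simpl fst; simpl snd.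
    eapply der_eq; [der ltac:(leaf2 D)|]. ring. }
  assert (A6 : d2 (d2 G212) p = d1 (d2 G222) p + (d2 G122 p * G211 p + G122 p * d2 G211 p - (d2 G112 p * G212 p + G112 p * d2 G212 p))).
  { rewrite (d2_ext D _ _ p o Dp (fun z hz => proj2 (proj2 (proj2 (e z hz))))). rewrite <- cm by auto. apply is_derive_unique; unfold p; simpl fst; simpl snd.
    eapply der_eq; [der ltac:(leaf2 D)|]. ring. }
  unfold lieF1, lieF2.
  rewrite (d2_ext D (d2 (fun z => - G211 z)) (fun z => - d2 G211 z)) by auto.
  rewrite (d1_ext D (d2 (fun z => G111 z - 2 * G212 z)) (fun z => d2 G111 z - 2 * d2 G212 z)) by auto.
  rewrite (d2_ext D (d2 (fun z => G111 z - 2 * G212 z)) (fun z => d2 G111 z - 2 * d2 G212 z)) by auto.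
  rewrite (d1_ext D (d1 (fun z => 2 * G112 z - G222 z)) (fun z => 2 * d1 G112 z - d1 G222 z)) by auto.
  rewrite (d1_ext D (d2 (fun z => 2 * G112 z - G222 z)) (fun z => 2 * d2 G112 z - d2 G222 z)) by auto.
  destruct (dd_ _ s111), (dd_ _ s112), (dd_ _ s122), (dd_ _ s211), (dd_ _ s212), (dd_ _ s222).
  rewrite !opp1, !opp2, !m1, !m2, !n1, !n2 by auto.
  rewrite A5, A6, A2, A1, A3, A4, p1, p2, p3, p4. split; ring.
Qed.

(** Cramer's rule: [chr1] and [chr2] are the coefficients of [d1 f] and [d2 f] when [e1], [e2] are
    expressed through the gradients of [f1], [f2]. For second derivatives of [f1], [f2] these are
    the Christoffel symbols of the connection with affine coordinates [f1], [f2]. *)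
Definition chr1 (f1 f2 e1 e2 : R2 -> R) (z : R2) : R := (e1 z * d2 f2 z - e2 z * d2 f1 z) / jac f1 f2 z.
Definition chr2 (f1 f2 e1 e2 : R2 -> R) (z : R2) : R := (d1 f1 z * e2 z - d1 f2 z * e1 z) / jac f1 f2 z.

(** Comparing the lift of [y'' = 0] with these symbols gives [a0 = - G211], [a1 = G111 - 2 G212],
    [a2 = 2 G112 - G222], [a3 = G122]; the flatness equations express that third derivatives of [f1]
    and [f2] commute. *)
Lemma lieF_of_flat (V : R2 -> Prop) (f1 f2 a0 a1 a2 a3 : R2 -> R) : open2 V -> sm V f1 -> sm V f2 ->
  (forall z, V z -> jac f1 f2 z <> 0 /\ lift0 (fun z => (f1 z, f2 z)) z (0, 0, 0, 0) = section_of a0 a1 a2 a3 z) ->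
  forall p, V p -> lieF1 a0 a1 a2 a3 p = 0 /\ lieF2 a0 a1 a2 a3 p = 0.
Proof.
  intros o s1 s2 h p Vp.
  set (G111 := chr1 f1 f2 (d1 (d1 f1)) (d1 (d1 f2))). set (G211 := chr2 f1 f2 (d1 (d1 f1)) (d1 (d1 f2))).
  set (G112 := chr1 f1 f2 (d1 (d2 f1)) (d1 (d2 f2))). set (G212 := chr2 f1 f2 (d1 (d2 f1)) (d1 (d2 f2))).
  set (G122 := chr1 f1 f2 (d2 (d2 f1)) (d2 (d2 f2))). set (G222 := chr2 f1 f2 (d2 (d2 f1)) (d2 (d2 f2))).
  assert (nz : forall z, V z -> jac f1 f2 z <> 0) by (intros; now apply h).
  assert (sJ : sm V (jac f1 f2)) by (unfold jac; smt).
  assert (sc1 : forall e1 e2, sm V e1 -> sm V e2 -> sm V (chr1 f1 f2 e1 e2)).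
  { intros e1 e2 h1 h2. unfold chr1. smt; auto. }
  assert (sc2 : forall e1 e2, sm V e1 -> sm V e2 -> sm V (chr2 f1 f2 e1 e2)).
  { intros e1 e2 h1 h2. unfold chr2. smt; auto. }
  assert (eqs : forall z, V z -> a0 z = - G211 z /\ a1 z = G111 z - 2 * G212 z /\ a2 z = 2 * G112 z - G222 z /\ a3 z = G122 z).
  { intros z hz. destruct (h z hz) as [hJ e]. unfold section_of in e.
    unfold lift0, u1, u2, u3, u4 in e; simpl fst in e; simpl snd in e.
    change (d1 (fun z => f1 z)) with (d1 f1) in e. change (d2 (fun z => f1 z)) with (d2 f1) in e.
    change (d1 (fun z => f2 z)) with (d1 f2) in e. change (d2 (fun z => f2 z)) with (d2 f2) in e.
    injection e as e0 e1 e2 e3. rewrite <- e0, <- e1, <- e2, <- e3.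
    unfold G111, G112, G122, G211, G212, G222, chr1, chr2. unfold jac in *. repeat split; field; auto. }
  destruct (lieF_ext V a0 a1 a2 a3 _ _ _ _ p o Vp eqs) as [-> ->].
  apply (lieF_flat_connection V); auto; try (apply sc1; smt); try (apply sc2; smt).
  clear eqs p Vp h. intros [x y] Vp. set (p := (x, y)).
  assert (cm : forall f, sm V f -> forall z, V z -> d2 (d1 f) z = d1 (d2 f) z) by (intros; symmetry; now apply (smooth_d12 V)).
  assert (cm112 : forall f, sm V f -> d2 (d1 (d1 f)) p = d1 (d1 (d2 f)) p).
  { intros f sf. rewrite cm by (auto; smt). apply (d1_ext V _ _ p o Vp). intros z hz; now apply cm. }
  assert (cm122 : forall f, sm V f -> d2 (d1 (d2 f)) p = d1 (d2 (d2 f)) p).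
  { intros f sf. rewrite cm by (auto; smt). reflexivity. }
  (* Quotient rule for the symbols, with mixed derivatives brought to the order [d1 (d2 _)] so that
     both sides of the flatness equations are built from the same atoms. *)
  assert (C1 : forall e1 e2, sm V e1 -> sm V e2 ->
     d1 (chr1 f1 f2 e1 e2) p = ((d1 e1 p * d2 f2 p + e1 p * d1 (d2 f2) p - (d1 e2 p * d2 f1 p + e2 p * d1 (d2 f1) p)) * jac f1 f2 p
       - (e1 p * d2 f2 p - e2 p * d2 f1 p) * (d1 (d1 f1) p * d2 f2 p + d1 f1 p * d1 (d2 f2) p - (d1 (d2 f1) p * d1 f2 p + d2 f1 p * d1 (d1 f2) p))) / jac f1 f2 p ^ 2 /\
     d2 (chr1 f1 f2 e1 e2) p = ((d2 e1 p * d2 f2 p + e1 p * d2 (d2 f2) p - (d2 e2 p * d2 f1 p + e2 p * d2 (d2 f1) p)) * jac f1 f2 p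
       - (e1 p * d2 f2 p - e2 p * d2 f1 p) * (d1 (d2 f1) p * d2 f2 p + d1 f1 p * d2 (d2 f2) p - (d2 (d2 f1) p * d1 f2 p + d2 f1 p * d1 (d2 f2) p))) / jac f1 f2 p ^ 2 /\
     d1 (chr2 f1 f2 e1 e2) p = ((d1 (d1 f1) p * e2 p + d1 f1 p * d1 e2 p - (d1 (d1 f2) p * e1 p + d1 f2 p * d1 e1 p)) * jac f1 f2 p
       - (d1 f1 p * e2 p - d1 f2 p * e1 p) * (d1 (d1 f1) p * d2 f2 p + d1 f1 p * d1 (d2 f2) p - (d1 (d2 f1) p * d1 f2 p + d2 f1 p * d1 (d1 f2) p))) / jac f1 f2 p ^ 2 /\
     d2 (chr2 f1 f2 e1 e2) p = ((d1 (d2 f1) p * e2 p + d1 f1 p * d2 e2 p - (d1 (d2 f2) p * e1 p + d1 f2 p * d2 e1 p)) * jac f1 f2 p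
       - (d1 f1 p * e2 p - d1 f2 p * e1 p) * (d1 (d2 f1) p * d2 f2 p + d1 f1 p * d2 (d2 f2) p - (d2 (d2 f1) p * d1 f2 p + d2 f1 p * d1 (d2 f2) p))) / jac f1 f2 p ^ 2).
  { intros e1 e2 h1 h2. pose proof (cm f1 s1 p Vp) as k1. pose proof (cm f2 s2 p Vp) as k2. pose proof (nz _ Vp) as hJ.
    repeat split; apply is_derive_unique; unfold p; simpl fst; simpl snd; unfold chr1, chr2, jac in *.
    - eapply der_eq; [der ltac:(leaf1 V); auto|]. unfold p in *. reflexivity.
    - eapply der_eq; [der ltac:(leaf2 V); auto|]. unfold p in *. rewrite k1, k2. reflexivity.
    - eapply der_eq; [der ltac:(leaf1 V); auto|]. unfold p in *. reflexivity.
    - eapply der_eq; [der ltac:(leaf2 V); auto|]. unfold p in *. rewrite k1, k2. reflexivity. }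
  destruct (C1 (d1 (d1 f1)) (d1 (d1 f2))) as (_ & k1 & _ & k2); [smt|smt|].
  destruct (C1 (d1 (d2 f1)) (d1 (d2 f2))) as (k3 & k4 & k5 & k6); [smt|smt|].
  destruct (C1 (d2 (d2 f1)) (d2 (d2 f2))) as (k7 & _ & k8 & _); [smt|smt|].
  unfold G111, G112, G122, G211, G212, G222. rewrite k1, k2, k3, k4, k5, k6, k7, k8.
  rewrite !cm112, !cm122 by auto. pose proof (nz _ Vp) as hJ. fold p in hJ.
  unfold chr1, chr2. unfold jac in *.
  repeat split; field; auto.
Qed.

(** Since [a2] and [a3] are zero, [a1] is free of y and [a0] is affine in y, each term has a
    vanishing factor. The witnesses are the linear formulas on the whole plane, which agree with the
    section on [V]. *)
Lemma linear_lieF (V : R2 -> Prop) (S : R2 -> R4) : open2 V -> linear_on V S ->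
  exists b0 b1 : R2 -> R, sm V b0 /\ sm V b1 /\ (forall z, V z -> S z = section_of b0 b1 (fun _ => 0) (fun _ => 0) z) /\
    forall z, V z -> lieF1 b0 b1 (fun _ => 0) (fun _ => 0) z = 0 /\ lieF2 b0 b1 (fun _ => 0) (fun _ => 0) z = 0.
Proof.
  intros o (a & b & c & sa & sb & sc & hS).
  set (I := fun x => exists y, V (x, y)) in *.
  assert (oI : open I).
  { intros x [y hy]. generalize (near_d1 V x y o hy). apply filter_imp. intros s hs. now exists y. }
  assert (lift : forall h, smooth (V := R_NormedModule) (W := R_NormedModule) I h -> sm V (fun z : R2 => h (fst z))).
  { intros h sh. apply (smooth_comp_R (V := NR2) V I h (fun z : R2 => fst z)); auto.
    - apply smooth_coord_fst.
    - intros [x y] hz. now exists y. }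
  pose proof (lift a sa) as la. pose proof (lift b sb) as lb. pose proof (lift c sc) as lc.
  pose proof (smooth_coord_snd V) as ls.
  exists (fun z : R2 => b (fst z) * snd z + c (fst z)), (fun z : R2 => a (fst z)).
  assert (s0 : sm V (fun z : R2 => b (fst z) * snd z + c (fst z))) by smt.
  split; auto. split; auto. split.
  { intros [x y] hz. now apply hS. }
  assert (dx : forall h z, d2 (fun z : R2 => h (fst z)) z = 0).
  { intros h z. apply is_derive_unique; simpl. apply der_const. }
  intros z hz. unfold lieF1, lieF2.
  assert (E0 : d1 (fun _ : R2 => 0) = fun _ => 0) by (apply functional_extensionality; intros; apply d1_const).
  assert (E0' : d2 (fun _ : R2 => 0) = fun _ => 0) by (apply functional_extensionality; intros; apply d2_const).
  assert (E1 : d2 (fun z : R2 => a (fst z)) = fun _ => 0) by (apply functional_extensionality; intros q; apply (dx a)).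
  assert (E2 : forall q, V q -> d2 (fun z : R2 => b (fst z) * snd z + c (fst z)) q = b (fst q)).
  { intros [x y] hq. apply is_derive_unique; simpl fst; simpl snd. eapply der_eq; [der ltac:(leaf2 V)|]. ring. }
  rewrite (d2_ext V (d2 (fun z : R2 => b (fst z) * snd z + c (fst z))) (fun q => b (fst q)) z o hz E2), (dx b).
  rewrite ?E0, ?E0', ?E1, ?E0, ?E0'. cbv beta. split; ring.
Qed.

Theorem linearizable_iff (U : R2 -> Prop) (a0 a1 a2 a3 : R2 -> R) : open2 U ->
  sm U a0 -> sm U a1 -> sm U a2 -> sm U a3 ->
  (locally_linearizable U (section_of a0 a1 a2 a3) <->
   forall p, U p -> lieF1 a0 a1 a2 a3 p = 0 /\ lieF2 a0 a1 a2 a3 p = 0).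
Proof.
  intros oU s0 s1 s2 s3. split.
  - intros hl p Up.
    destruct (hl p Up) as (V & V' & f & g & Vp & VU & (oV & oV' & sf & sg & hf & hg) & lin).
    destruct (linear_lieF V' _ oV' lin) as (b0 & b1 & sb0 & sb1 & hb & Fb).
    assert (V'p : V' (f p)) by now apply hf.
    set (z0 := fun _ : R2 => 0) in *.
    assert (sz : sm V' z0) by apply (smooth_const (V := NR2) (W := R_NormedModule) V' 0).
    destruct (flatten V' b0 b1 z0 z0 (f p) oV' V'p sb0 sb1 sz sz Fb)
      as (W & W' & h1 & h2 & k1 & k2 & Wp & WV & oW & oW' & sh1 & sh2 & sk1 & sk2 & hh & hk & hfl).
    set (f1 := fun z => fst (f z)). set (f2 := fun z => snd (f z)).
    set (g1 := fun z => fst (g z)). set (g2 := fun z => snd (g z)).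
    assert (sf1 : sm V f1) by (now apply (smooth_fst (V := NR2) (W := R_NormedModule) (Z := R_NormedModule))).
    assert (sf2 : sm V f2) by (now apply (smooth_snd (V := NR2) (W := R_NormedModule) (Z := R_NormedModule))).
    assert (sg1 : sm V' g1) by (now apply (smooth_fst (V := NR2) (W := R_NormedModule) (Z := R_NormedModule))).
    assert (sg2 : sm V' g2) by (now apply (smooth_snd (V := NR2) (W := R_NormedModule) (Z := R_NormedModule))).
    assert (pf : forall z, (f1 z, f2 z) = f z) by (intros z; unfold f1, f2; now destruct (f z)).
    assert (pg : forall z, (g1 z, g2 z) = g z) by (intros z; unfold g1, g2; now destruct (g z)).
    set (Q := fun z => V z /\ W (f1 z, f2 z)).
    assert (oQ : open2 Q).
    { intros z [Vz Wz]. apply filter_and; [now apply oV|].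
      assert (CC : continuous (fun z : NR2 => (f1 z, f2 z) : NR2) z).
      { apply continuous_pair; [apply (sm_continuous V f1)|apply (sm_continuous V f2)]; auto. }
      apply (CC W). now apply oW. }
    assert (Qp : Q p) by (split; auto; now rewrite pf).
    assert (sQ : forall h, sm V h -> sm Q h) by (intros h sh; eapply smooth_sub; [|exact sh]; intros z hz; apply hz).
    apply (lieF_of_flat Q (fun z => h1 (f1 z, f2 z)) (fun z => h2 (f1 z, f2 z))); auto.
    + apply (smooth_chain W Q); auto. intros z hz; apply hz.
    + apply (smooth_chain W Q); auto. intros z hz; apply hz.
    + intros z [Vz Wz].
      (* The roles of [f] and [g] are exchanged: lifting the transformed section back along [f]
         recovers the original one. *)
      destruct (lift0_inverse V' V g1 g2 f1 f2 z (section_of a0 a1 a2 a3 z)) as (Jg & Jf & inv); auto.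
      { intros q hq. rewrite pf. now apply hf. }
      { intros q hq. rewrite pf, pg. now apply hf. }
      destruct (hfl _ Wz) as [Jh hflat].
      split.
      * rewrite (jac_comp W Q); auto. split; auto.
      * rewrite <- (lift0_comp W Q) by (auto; try split; auto; intros q hq; apply hq).
        rewrite hflat, <- hb by (rewrite pf; now apply hf). rewrite <- inv. f_equal.
        unfold transform. rewrite pf. destruct (hf z Vz) as [_ egf]. rewrite egf.
        apply (lift0_ext V' _ _ _ _ oV'); [now apply hf|]. intros q _. auto using pg, eq_sym.
  - intros hF p Up.
    destruct (flatten U a0 a1 a2 a3 p oU Up s0 s1 s2 s3 hF)
      as (V & V' & f1 & f2 & g1 & g2 & Vp & VU & oV & oV' & sf1 & sf2 & sg1 & sg2 & hfg & hgf & hfl).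
    exists V, V', (fun z => (f1 z, f2 z)), (fun z => (g1 z, g2 z)).
    split; auto. split; auto. split.
    { repeat split; auto; try (now apply (smooth_pair (V := NR2) (W := R_NormedModule) (Z := R_NormedModule)));
      intros; try (now apply hfg); try (now apply hgf). }
    (* The linear equation that is reached is [y'' = 0] itself. *)
    exists (fun _ => 0), (fun _ => 0), (fun _ => 0).
    cbv zeta. split; [apply (smooth_const (W := R_NormedModule))|]. split; [apply (smooth_const (W := R_NormedModule))|].
    split; [apply (smooth_const (W := R_NormedModule))|].
    intros x y hq. unfold transform.
    destruct (hgf _ hq) as [hV _].
    rewrite <- (proj2 (hfl _ hV)).
    destruct (lift0_inverse V V' f1 f2 g1 g2 (x, y) (0, 0, 0, 0)) as (_ & _ & inv); auto.
    { intros q hq'. now apply hgf. }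
    { intros q hq'. now apply hgf. }
    rewrite inv. repeat apply f_equal2; auto. ring.
Qed.

(** * Prolongation of vector fields *)

Definition lin2 (a b : R) (u v : R4) : R4 :=
  (a * u1 u + b * u1 v, a * u2 u + b * u2 v, a * u3 u + b * u3 v, a * u4 u + b * u4 v).

Definition add4 (u v : R4) : R4 := (u1 u + u1 v, u2 u + u2 v, u3 u + u3 v, u4 u + u4 v).

(* The infinitesimal lift of X at the fibre point u is Lb + Ls: [Lb] is the part bilinear in the
   first derivatives X_1, X_2 and u, [Ls] the part given by the second derivatives of X. *)
Definition Lb (X_1 X_2 : R2) (u : R4) : R4 :=
  let a := fst X_1 in let b := fst X_2 in let c := snd X_1 in let d := snd X_2 in
  ((a + d) * u1 u - 3 * a * u1 u - c * u2 u,
   (a + d) * u2 u - 3 * b * u1 u - 2 * a * u2 u - d * u2 u - 2 * c * u3 u,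
   (a + d) * u3 u - 2 * b * u2 u - a * u3 u - 2 * d * u3 u - 3 * c * u4 u,
   (a + d) * u4 u - b * u3 u - 3 * d * u4 u).

Definition Ls (X11 X12 X22 : R2) : R4 :=
  (snd X11, 2 * snd X12 - fst X11, snd X22 - 2 * fst X12, - fst X22).

Definition prol (xi : W3) (theta : J1) : J1 :=
  let '(X, (X_1, X_2), (X11, X12, X22), (X111, X112, X122, X222)) := xi in
  let '(p, u, (v1, v2)) := theta in
  (X, add4 (Lb X_1 X_2 u) (Ls X11 X12 X22),
   (add4 (add4 (Lb X11 X12 u) (Lb X_1 X_2 v1)) (add4 (Ls X111 X112 X122) (lin2 (- fst X_1) (- snd X_1) v1 v2)),
    add4 (add4 (Lb X12 X22 u) (Lb X_1 X_2 v2)) (add4 (Ls X112 X122 X222) (lin2 (- fst X_2) (- snd X_2) v1 v2)))).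

Definition e0 : R * R2 := (1, (0, 0)).
Definition e1 : R * R2 := (0, (1, 0)).
Definition e2 : R * R2 := (0, (0, 1)).

Lemma dd_e0 (K : R * R2 -> R) (t : R) (q : R2) : dd (V := NR3) e0 K (t, q) = Derive (fun s => K (s, q)) t.
Proof.
  destruct q as [x y]. unfold dd, Derive. f_equal. apply Lim_ext; intros h.
  change (plus ((t, (x, y)) : NR3) (scal (0 + h) (e0 : NR3))) with ((t + (0 + h) * 1, (x + (0 + h) * 0, y + (0 + h) * 0)) : R * R2).
  change (plus ((t, (x, y)) : NR3) (scal 0 (e0 : NR3))) with ((t + 0 * 1, (x + 0 * 0, y + 0 * 0)) : R * R2).
  replace (t + (0 + h) * 1) with (t + h) by ring. replace (t + 0 * 1) with t by ring.
  replace (x + (0 + h) * 0) with x by ring. replace (y + (0 + h) * 0) with y by ring.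
  replace (x + 0 * 0) with x by ring. now replace (y + 0 * 0) with y by ring.
Qed.

Lemma d1_slice (K : R * R2 -> R) (t : R) : d1 (fun z => K (t, z)) = fun q => dd (V := NR3) e1 K (t, q).
Proof.
  apply (functional_extensionality (A := R2)); intros [x y]. unfold d1, dd, Derive; simpl fst; simpl snd. f_equal.
  apply Lim_ext; intros h.
  change (plus ((t, (x, y)) : NR3) (scal (0 + h) (e1 : NR3))) with ((t + (0 + h) * 0, (x + (0 + h) * 1, y + (0 + h) * 0)) : R * R2).
  change (plus ((t, (x, y)) : NR3) (scal 0 (e1 : NR3))) with ((t + 0 * 0, (x + 0 * 1, y + 0 * 0)) : R * R2).
  replace (x + (0 + h) * 1) with (x + h) by ring. replace (x + 0 * 1) with x by ring.
  replace (t + (0 + h) * 0) with t by ring. replace (y + (0 + h) * 0) with y by ring.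
  replace (t + 0 * 0) with t by ring. now replace (y + 0 * 0) with y by ring.
Qed.

Lemma d2_slice (K : R * R2 -> R) (t : R) : d2 (fun z => K (t, z)) = fun q => dd (V := NR3) e2 K (t, q).
Proof.
  apply (functional_extensionality (A := R2)); intros [x y]. unfold d2, dd, Derive; simpl fst; simpl snd. f_equal.
  apply Lim_ext; intros h.
  change (plus ((t, (x, y)) : NR3) (scal (0 + h) (e2 : NR3))) with ((t + (0 + h) * 0, (x + (0 + h) * 0, y + (0 + h) * 1)) : R * R2).
  change (plus ((t, (x, y)) : NR3) (scal 0 (e2 : NR3))) with ((t + 0 * 0, (x + 0 * 0, y + 0 * 1)) : R * R2).
  replace (y + (0 + h) * 1) with (y + h) by ring. replace (y + 0 * 1) with y by ring.
  replace (t + (0 + h) * 0) with t by ring. replace (x + (0 + h) * 0) with x by ring.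
  replace (t + 0 * 0) with t by ring. now replace (x + 0 * 0) with x by ring.
Qed.

Notation open3 := (@open NR3).
Notation sm3 := (@smooth NR3 R_NormedModule).

(* The components of [lift0] as functions of the 2-jet of g = f^-1, so that they can be differentiated
   along a flow. *)
Definition lift_formula (A0 A1 B0 B1 P0 P1 P2 Q0 Q1 Q2 : R) (u : R4) : R4 :=
  let J := A0 * B1 - A1 * B0 in
  ( / J * (u1 u * A0 ^ 3 + u2 u * (B0 * A0 ^ 2) + u3 u * (B0 ^ 2 * A0) + u4 u * B0 ^ 3
           - A0 * Q0 + B0 * P0),
    / J * (u1 u * (3 * A0 ^ 2 * A1) + u2 u * (B1 * A0 ^ 2 + 2 * B0 * A0 * A1)
           + u3 u * (2 * B0 * B1 * A0 + B0 ^ 2 * A1) + u4 u * (3 * B0 ^ 2 * B1)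
           - (A0 * (2 * Q1) + A1 * Q0) + (B0 * (2 * P1) + B1 * P0)),
    / J * (u1 u * (3 * A0 * A1 ^ 2) + u2 u * (2 * B1 * A0 * A1 + B0 * A1 ^ 2)
           + u3 u * (B1 ^ 2 * A0 + 2 * B0 * B1 * A1) + u4 u * (3 * B0 * B1 ^ 2)
           - (A0 * Q2 + A1 * (2 * Q1)) + (B0 * P2 + B1 * (2 * P1))),
    / J * (u1 u * A1 ^ 3 + u2 u * (B1 * A1 ^ 2) + u3 u * (B1 ^ 2 * A1) + u4 u * B1 ^ 3
           - A1 * Q2 + B1 * P2) ).

(** Differentiation at the jet of the identity map. The minus signs are there because the entries
    will be jets of [Phi (- t)], whose velocity is [- X]. *)
Lemma lift_formula_der (A0 A1 B0 B1 P0 P1 P2 Q0 Q1 Q2 U1 U2 U3 U4 : R -> R) t0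
    (a0 a1 b0 b1 x0 x1 x2 y0 y1 y2 v1 v2 v3 v4 : R) :
  is_derive A0 t0 (- a0) -> is_derive A1 t0 (- a1) -> is_derive B0 t0 (- b0) -> is_derive B1 t0 (- b1) ->
  is_derive P0 t0 (- x0) -> is_derive P1 t0 (- x1) -> is_derive P2 t0 (- x2) ->
  is_derive Q0 t0 (- y0) -> is_derive Q1 t0 (- y1) -> is_derive Q2 t0 (- y2) ->
  is_derive U1 t0 v1 -> is_derive U2 t0 v2 -> is_derive U3 t0 v3 -> is_derive U4 t0 v4 ->
  A0 t0 = 1 -> A1 t0 = 0 -> B0 t0 = 0 -> B1 t0 = 1 -> P0 t0 = 0 -> P1 t0 = 0 -> P2 t0 = 0 ->
  Q0 t0 = 0 -> Q1 t0 = 0 -> Q2 t0 = 0 ->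
  let F t := lift_formula (A0 t) (A1 t) (B0 t) (B1 t) (P0 t) (P1 t) (P2 t) (Q0 t) (Q1 t) (Q2 t) (U1 t, U2 t, U3 t, U4 t) in
  let D := add4 (v1, v2, v3, v4) (add4 (Lb (a0, b0) (a1, b1) (U1 t0, U2 t0, U3 t0, U4 t0)) (Ls (x0, y0) (x1, y1) (x2, y2))) in
  is_derive (fun t => u1 (F t)) t0 (u1 D) /\ is_derive (fun t => u2 (F t)) t0 (u2 D) /\
  is_derive (fun t => u3 (F t)) t0 (u3 D) /\ is_derive (fun t => u4 (F t)) t0 (u4 D).
Proof.
  intros dA0 dA1 dB0 dB1 dP0 dP1 dP2 dQ0 dQ1 dQ2 dU1 dU2 dU3 dU4 eA0 eA1 eB0 eB1 eP0 eP1 eP2 eQ0 eQ1 eQ2 F D.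
  assert (J0 : A0 t0 * B1 t0 - A1 t0 * B0 t0 <> 0) by (rewrite eA0, eA1, eB0, eB1; lra).
  unfold F, D, lift_formula, add4, Lb, Ls, u1, u2, u3, u4; simpl fst; simpl snd.
  assert (L : 1 * 1 - 0 * 0 = 1) by ring.
  split; [|split; [|split]]; (eapply der_eq; [der ltac:(idtac; (lazymatch goal with |- is_derive (fun t => ?f t) _ _ => match goal with H : is_derive f _ _ |- _ => exact H end | |- is_derive ?f _ _ => match goal with H : is_derive f _ _ |- _ => exact H end end)); exact J0|]);
   rewrite ?eA0, ?eA1, ?eB0, ?eB1, ?eP0, ?eP1, ?eP2, ?eQ0, ?eQ1, ?eQ2, L, Rinv_1; simpl; field.
Qed.

Notation NR4 := (prod_NormedModule R_AbsRing (prod_NormedModule R_AbsRing NR2 R_NormedModule) R_NormedModule).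
Notation NJ1 := (prod_NormedModule R_AbsRing (prod_NormedModule R_AbsRing NR2 NR4) (prod_NormedModule R_AbsRing NR4 NR4)).

Lemma is_derive_R2 (a b : R -> R) t la lb : is_derive a t la -> is_derive b t lb ->
  is_derive (V := NR2) (fun t => (a t, b t)) t (la, lb).
Proof. intros. now apply (is_derive_prod (V := R_NormedModule) (W := R_NormedModule)). Qed.

Lemma is_derive_R4 (a b c d : R -> R) t la lb lc ld :
  is_derive a t la -> is_derive b t lb -> is_derive c t lc -> is_derive d t ld ->
  is_derive (V := NR4) (fun t => (a t, b t, c t, d t)) t (la, lb, lc, ld).
Proof.
  intros. apply (is_derive_prod (V := prod_NormedModule R_AbsRing NR2 R_NormedModule) (W := R_NormedModule)); auto.
  apply (is_derive_prod (V := NR2) (W := R_NormedModule)); auto. now apply is_derive_R2.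
Qed.

Lemma is_derive_J1 (p : R -> R2) (u v w : R -> R4) t lp lu lv lw :
  is_derive (V := NR2) p t lp -> is_derive (V := NR4) u t lu -> is_derive (V := NR4) v t lv -> is_derive (V := NR4) w t lw ->
  is_derive (V := NJ1) (fun t => (p t, u t, (v t, w t))) t (lp, lu, (lv, lw)).
Proof.
  intros. apply (is_derive_prod (V := prod_NormedModule R_AbsRing NR2 NR4) (W := prod_NormedModule R_AbsRing NR4 NR4)).
  - now apply (is_derive_prod (V := NR2) (W := NR4)).
  - now apply (is_derive_prod (V := NR4) (W := NR4)).
Qed.

Lemma smooth_R4 {V : NormedModule R_AbsRing} (D : V -> Prop) (S : V -> R4) : smooth (W := NR4) D S ->
  smooth (W := R_NormedModule) D (fun z => u1 (S z)) /\ smooth (W := R_NormedModule) D (fun z => u2 (S z)) /\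
  smooth (W := R_NormedModule) D (fun z => u3 (S z)) /\ smooth (W := R_NormedModule) D (fun z => u4 (S z)).
Proof.
  intros h.
  pose proof (smooth_fst (W := prod_NormedModule R_AbsRing NR2 R_NormedModule) (Z := R_NormedModule) D S h) as h1.
  pose proof (smooth_fst (W := NR2) (Z := R_NormedModule) D _ h1) as h2.
  split; [|split; [|split]].
  - apply (smooth_fst (W := R_NormedModule) (Z := R_NormedModule) D _ h2).
  - apply (smooth_snd (W := R_NormedModule) (Z := R_NormedModule) D _ h2).
  - apply (smooth_snd (W := NR2) (Z := R_NormedModule) D _ h1).
  - apply (smooth_snd (W := prod_NormedModule R_AbsRing NR2 R_NormedModule) (Z := R_NormedModule) D S h).
Qed.

Lemma smooth_R2 {V : NormedModule R_AbsRing} (D : V -> Prop) (X : V -> R2) : smooth (W := NR2) D X ->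
  smooth (W := R_NormedModule) D (fun z => fst (X z)) /\ smooth (W := R_NormedModule) D (fun z => snd (X z)).
Proof.
  intros h. split; [apply (smooth_fst (W := R_NormedModule) (Z := R_NormedModule) D _ h)|apply (smooth_snd (W := R_NormedModule) (Z := R_NormedModule) D _ h)].
Qed.

Lemma dd_ext {V : NormedModule R_AbsRing} (D : V -> Prop) (F F' : V -> R) (p v : V) :
  open D -> D p -> (forall q, D q -> F q = F' q) -> dd v F p = dd v F' p.
Proof.
  intros o Dp e. apply Derive_ext_loc. generalize (near_line D p v o Dp). apply filter_imp. intros; now apply e.
Qed.

Lemma slices (K : R * R2 -> R) (t : R) (q : R2) :
  d1 (fun z => K (t, z)) q = dd (V := NR3) e1 K (t, q) /\ d2 (fun z => K (t, z)) q = dd (V := NR3) e2 K (t, q) /\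
  d1 (d1 (fun z => K (t, z))) q = dd (V := NR3) e1 (dd (V := NR3) e1 K) (t, q) /\
  d1 (d2 (fun z => K (t, z))) q = dd (V := NR3) e1 (dd (V := NR3) e2 K) (t, q) /\
  d2 (d2 (fun z => K (t, z))) q = dd (V := NR3) e2 (dd (V := NR3) e2 K) (t, q).
Proof.
  rewrite (d1_slice K t), (d2_slice K t).
  rewrite (d1_slice (dd (V := NR3) e1 K) t), (d1_slice (dd (V := NR3) e2 K) t), (d2_slice (dd (V := NR3) e2 K) t). auto.
Qed.

Lemma is_dd_e0 (N : R * R2 -> Prop) (K : R * R2 -> R) (t : R) (q : R2) : sm3 N K -> N (t, q) ->
  is_derive (fun s => K (s, q)) t (dd (V := NR3) e0 K (t, q)).
Proof.
  intros sK Nq. rewrite dd_e0.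
  pose proof (Ck_is_dd 0 N K e0 (t, q) (sK 1%nat) Nq) as H.
  apply Derive_correct. eexists. apply line1. eapply is_derive_ext; [|apply H].
  intros s. simpl. destruct q as [x y]. f_equal.
  change ((t + s * 1, (x + s * 0, y + s * 0)) = (t + s * 1, (x, y))).
  replace (x + s * 0) with x by ring. now replace (y + s * 0) with y by ring.
Qed.

Lemma opp_second (D : R2 -> Prop) (f : R2 -> R) (q : R2) : open2 D -> sm D f -> D q ->
  d1 (fun z => - f z) q = - d1 f q /\ d2 (fun z => - f z) q = - d2 f q /\
  d1 (d1 (fun z => - f z)) q = - d1 (d1 f) q /\ d1 (d2 (fun z => - f z)) q = - d1 (d2 f) q /\ d2 (d2 (fun z => - f z)) q = - d2 (d2 f) q.
Proof.
  intros o sf Dq.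
  assert (E1 : forall f, sm D f -> forall q, D q -> d1 (fun z => - f z) q = - d1 f q).
  { intros h sh [x y] hq. apply is_derive_unique; simpl fst; simpl snd. eapply der_eq; [der ltac:(leaf1 D)|]. reflexivity. }
  assert (E2 : forall f, sm D f -> forall q, D q -> d2 (fun z => - f z) q = - d2 f q).
  { intros h sh [x y] hq. apply is_derive_unique; simpl fst; simpl snd. eapply der_eq; [der ltac:(leaf2 D)|]. reflexivity. }
  rewrite (d1_ext D (d1 (fun z => - f z)) (fun z => - d1 f z)) by auto.
  rewrite (d1_ext D (d2 (fun z => - f z)) (fun z => - d2 f z)) by auto.
  rewrite (d2_ext D (d2 (fun z => - f z)) (fun z => - d2 f z)) by auto.
  rewrite !E1, !E2 by (auto; smt). repeat split.
Qed.

Lemma dd_e0_space (N : R * R2 -> Prop) (K : R * R2 -> R) (v w z : R * R2) : open3 N -> sm3 N K -> N z ->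
  dd (V := NR3) e0 (dd (V := NR3) v K) z = dd (V := NR3) v (dd (V := NR3) e0 K) z /\
  dd (V := NR3) e0 (dd (V := NR3) v (dd (V := NR3) w K)) z = dd (V := NR3) v (dd (V := NR3) w (dd (V := NR3) e0 K)) z.
Proof.
  intros o sK Nz.
  assert (C : forall K, sm3 N K -> forall v z, N z -> dd (V := NR3) e0 (dd (V := NR3) v K) z = dd (V := NR3) v (dd (V := NR3) e0 K) z).
  { intros K' sK' v' z' hz. apply (dd_comm (V := NR3) N); auto. }
  split; [now apply C|].
  rewrite C by (auto; apply (smooth_dd (V := NR3)); auto).
  apply (dd_ext (V := NR3) N); auto.
Qed.

(** Velocity at time 0 of the transformed section over a fixed base point: the infinitesimal lift of
    [X] minus the transport of [S] along [X], known as the characteristic of the lifted field. *)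
Definition hvec (X : R2 -> R2) (S : R2 -> R4) (z : R2) : R4 :=
  add4 (lin2 (- fst (X z)) (- snd (X z)) (on_R4 d1 S z) (on_R4 d2 S z))
    (add4 (Lb (on_R2 d1 X z) (on_R2 d2 X z) (S z))
       (Ls (on_R2 (fun h => d1 (d1 h)) X z) (on_R2 (fun h => d1 (d2 h)) X z) (on_R2 (fun h => d2 (d2 h)) X z))).

Lemma open_pre {V W : NormedModule R_AbsRing} (A : V -> W) (D : W -> Prop) : (forall z, continuous A z) -> open D ->
  open (fun z => D (A z)).
Proof. intros c o. apply (open_comp A D); auto. intros z _; apply c. Qed.

(** Joint smoothness in time and position is what is wanted: the velocity of the 1-jet along a
    moving base point needs total derivatives and commuting time and space derivatives of the
    transformed section. *)
Lemma prolong_derive (X : R2 -> R2) (p : R2) (Phi : R -> R2 -> R2) (S : R2 -> R4) :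
  local_flow X p Phi -> smooth_near p X -> smooth_near p S ->
  exists H1 H2 H3 H4 : R * R2 -> R, exists N : R * R2 -> Prop,
    open3 N /\ N (0, p) /\ sm3 N H1 /\ sm3 N H2 /\ sm3 N H3 /\ sm3 N H4 /\
    (forall t q, transform (Phi (- t)) S q = (H1 (t, q), H2 (t, q), H3 (t, q), H4 (t, q))) /\
    (forall z, N (0, z) ->
       (H1 (0, z), H2 (0, z), H3 (0, z), H4 (0, z)) = S z /\
       (dd (V := NR3) e0 H1 (0, z), dd (V := NR3) e0 H2 (0, z), dd (V := NR3) e0 H3 (0, z), dd (V := NR3) e0 H4 (0, z)) = hvec X S z).
Proof.
  intros (O & oO & Op & sPhi & Phi0 & dPhi) (DX & oDX & DXp & sX) (DS & oDS & DSp & sS).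
  destruct (smooth_R2 DX X sX) as [sX1 sX2]. destruct (smooth_R4 DS S sS) as (sS1 & sS2 & sS3 & sS4).
  set (Ps1 := fun z : R * R2 => fst (Phi (- fst z) (snd z))). set (Ps2 := fun z : R * R2 => snd (Phi (- fst z) (snd z))).
  set (A := fun z : NR3 => (- fst z, snd z) : NR3).
  assert (cA : forall z, continuous A z).
  { intros z. apply linear_cont. apply (is_linear_prod (U := R_NormedModule) (V := NR2)).
    - apply (is_linear_comp (V := R_NormedModule) (W := R_NormedModule) (fst : NR3 -> R) opp); [apply is_linear_fst|apply is_linear_opp].
    - apply is_linear_snd. }
  set (O' := fun z : R * R2 => O (- fst z, snd z) /\ DX (snd z)).
  assert (oO' : open3 O').
  { apply (open_and (T := NR3)).
    - apply (open_pre (V := NR3) (W := NR3) A O); auto.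
    - apply (open_pre (V := NR3) (W := NR2) (fun z => snd z) DX); auto. intros z; apply continuous_snd. }
  assert (sA : forall (W : NormedModule R_AbsRing) (F : R * R2 -> W), smooth (V := NR3) O F -> smooth (V := NR3) (fun z => O (A z)) (fun z => F (A z))).
  { intros W F sF k. apply (Ck_pre (V' := NR3) (V := NR3) k O F A A); auto.
    intros [t1 q1] [t2 q2] s. unfold A. simpl.
    change ((- (t1 + s * t2), plus q1 (scal s q2)) = ((- t1 + s * (- t2), plus q1 (scal s q2)) : R * R2)).
    assert (E : forall a b c : R, - (a + c * b) = - a + c * - b) by (intros; ring). now rewrite E. }
  destruct (smooth_R2 (V := NR3) _ _ (sA NR2 _ sPhi)) as [sP1 sP2].
  assert (s1 : sm3 O' Ps1) by (eapply smooth_sub; [|exact sP1]; intros z hz; apply hz).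
  assert (s2 : sm3 O' Ps2) by (eapply smooth_sub; [|exact sP2]; intros z hz; apply hz).
  clear sP1 sP2 sA.
  set (Jf := fun z => dd (V := NR3) e1 Ps1 z * dd (V := NR3) e2 Ps2 z - dd (V := NR3) e2 Ps1 z * dd (V := NR3) e1 Ps2 z).
  assert (sJ : sm3 O' Jf) by (unfold Jf; smt).
  (* Where the backward flow is defined, lands in the domain of [S] and has nonzero Jacobian; at
     time 0 the flow is the identity, so [(0, p)] belongs to this set. *)
  set (N := fun z : R * R2 => O' z /\ (DS (Ps1 z, Ps2 z) /\ Jf z <> 0)).
  assert (oN : open3 N).
  { intros z [Oz [Dz Jz]]. apply filter_and; [now apply oO'|]. apply filter_and.
    - assert (CC : continuous (fun z : NR3 => (Ps1 z, Ps2 z) : NR2) z).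
      { apply continuous_pair; [apply (s1 0%nat)|apply (s2 0%nat)]; auto. }
      apply (CC DS). now apply oDS.
    - assert (CC : continuous (Jf : NR3 -> R) z) by (apply (sJ 0%nat); auto).
      apply (CC (fun t => t <> 0)). apply (open_neq 0). exact Jz. }
  assert (NO : forall z, N z -> O' z) by (intros z hz; apply hz).
  assert (sN : forall F, sm3 O' F -> sm3 N F) by (intros F sF; eapply smooth_sub; [exact NO|exact sF]).
  assert (s1' := sN _ s1). assert (s2' := sN _ s2).
  set (V1 := fun z : R * R2 => u1 (S (Phi (- fst z) (snd z)))). set (V2 := fun z : R * R2 => u2 (S (Phi (- fst z) (snd z)))).
  set (V3 := fun z : R * R2 => u3 (S (Phi (- fst z) (snd z)))). set (V4 := fun z : R * R2 => u4 (S (Phi (- fst z) (snd z)))).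
  assert (PsE : forall z, (Ps1 z, Ps2 z) = Phi (- fst z) (snd z)) by (intros z; unfold Ps1, Ps2; now destruct (Phi (- fst z) (snd z))).
  assert (sV : forall h, sm DS h -> sm3 N (fun z => h (Phi (- fst z) (snd z)))).
  { intros h sh. apply (smooth_ext (V := NR3) N (fun z => h (Ps1 z, Ps2 z))); auto.
    - intros z _. now rewrite PsE.
    - apply (smooth_comp_R2 (V := NR3) N DS); auto. intros z hz; apply hz. }
  assert (sV1 : sm3 N V1) by apply (sV _ sS1). assert (sV2 : sm3 N V2) by apply (sV _ sS2).
  assert (sV3 : sm3 N V3) by apply (sV _ sS3). assert (sV4 : sm3 N V4) by apply (sV _ sS4).
  set (LF := fun z : R * R2 => lift_formula (dd (V := NR3) e1 Ps1 z) (dd (V := NR3) e2 Ps1 z) (dd (V := NR3) e1 Ps2 z) (dd (V := NR3) e2 Ps2 z)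
     (dd (V := NR3) e1 (dd (V := NR3) e1 Ps1) z) (dd (V := NR3) e1 (dd (V := NR3) e2 Ps1) z) (dd (V := NR3) e2 (dd (V := NR3) e2 Ps1) z)
     (dd (V := NR3) e1 (dd (V := NR3) e1 Ps2) z) (dd (V := NR3) e1 (dd (V := NR3) e2 Ps2) z) (dd (V := NR3) e2 (dd (V := NR3) e2 Ps2) z)
     (V1 z, V2 z, V3 z, V4 z)).
  assert (sJ' : sm3 N Jf) by (now apply sN).
  assert (nzJ : forall z, N z -> Jf z <> 0) by (intros z hz; apply hz).
  assert (siJ : sm3 N (fun z => / (dd (V := NR3) e1 Ps1 z * dd (V := NR3) e2 Ps2 z - dd (V := NR3) e2 Ps1 z * dd (V := NR3) e1 Ps2 z))).
  { apply (smooth_inv (V := NR3) N Jf); auto. }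
  exists (fun z => u1 (LF z)), (fun z => u2 (LF z)), (fun z => u3 (LF z)), (fun z => u4 (LF z)), N.
  assert (pr : forall K : R2 -> R2 -> R, K (fst p, snd p) = K p) by (intros K; now destruct p).
  set (D0 := fun z : R2 => N (0, z)).
  assert (oD0 : open2 D0).
  { apply (open_pre (V := NR2) (W := NR3) (fun z => (0, z)) N); auto. intros z.
    apply (continuous_pair (fun _ => 0) (fun z : NR2 => z)); [apply continuous_const|apply continuous_id]. }
  assert (P0 : forall z, O (0, z) -> Phi (- 0) z = z) by (intros z hz; rewrite Ropp_0; auto).
  assert (OD : forall z, D0 z -> O (0, z) /\ DX z).
  { intros z [[h1 h2] _]. simpl in h1, h2. rewrite Ropp_0 in h1. auto. }
  assert (val1 : forall z, D0 z -> Ps1 (0, z) = fst z) by (intros z hz; unfold Ps1; simpl; rewrite P0; auto; now apply OD).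
  assert (val2 : forall z, D0 z -> Ps2 (0, z) = snd z) by (intros z hz; unfold Ps2; simpl; rewrite P0; auto; now apply OD).
  assert (td : forall z, O (0, z) -> dd (V := NR3) e0 Ps1 (0, z) = - fst (X z) /\ dd (V := NR3) e0 Ps2 (0, z) = - snd (X z)).
  { intros z hz. rewrite !dd_e0.
    pose proof (dPhi 0 z hz) as H. rewrite Phi0 in H by auto.
    assert (G : is_derive (V := NR2) (fun s : R => Phi (- s) z) 0 (scal (-1) (X z : NR2))).
    { apply (is_derive_comp (V := NR2) (fun s : R => Phi s z) (fun s => - s) 0 (X z) (-1)).
      - rewrite Ropp_0. exact H.
      - auto_derive; auto. }
    split; apply is_derive_unique; unfold Ps1, Ps2; simpl.
    - eapply der_eq; [apply (is_derive_lin_post (W := NR2) (Z := R_NormedModule) _ fst 0 _ is_linear_fst G)|].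
      change (-1 * fst (X z) = - fst (X z)). ring.
    - eapply der_eq; [apply (is_derive_lin_post (W := NR2) (Z := R_NormedModule) _ snd 0 _ is_linear_snd G)|].
      change (-1 * snd (X z) = - snd (X z)). ring. }
  assert (Np : N (0, p)).
  { assert (O'p : O' (0, p)) by (split; simpl; [now rewrite Ropp_0|auto]).
    split; auto. split.
    - rewrite PsE. simpl. now rewrite P0.
    - set (E0 := fun z : R2 => O' (0, z)).
      assert (oE0 : open2 E0).
      { apply (open_pre (V := NR2) (W := NR3) (fun z => (0, z)) O'); auto. intros z.
        apply (continuous_pair (fun _ => 0) (fun z : NR2 => z)); [apply continuous_const|apply continuous_id]. }
      assert (w1 : forall z, E0 z -> Ps1 (0, z) = fst z).
      { intros z [h1 _]. unfold Ps1; simpl in *. rewrite Ropp_0 in *. now rewrite Phi0. }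
      assert (w2 : forall z, E0 z -> Ps2 (0, z) = snd z).
      { intros z [h1 _]. unfold Ps2; simpl in *. rewrite Ropp_0 in *. now rewrite Phi0. }
      destruct (slices Ps1 0 p) as (a1 & a2 & _). destruct (slices Ps2 0 p) as (b1 & b2 & _).
      destruct (second_ext E0 (fun z => Ps1 (0, z)) (fun z => fst z) p oE0 O'p w1) as (c1 & c2 & _). destruct (second_ext E0 (fun z => Ps2 (0, z)) (fun z => snd z) p oE0 O'p w2) as (c3 & c4 & _).
      unfold Jf. rewrite <- a1, <- a2, <- b1, <- b2, c1, c2, c3, c4, d1_fst, d2_fst, d1_snd, d2_snd. lra. }
  split; [exact oN|]. split; [exact Np|].
  split; [unfold LF, lift_formula, u1, u2, u3, u4; simpl fst; simpl snd; smt; exact nzJ|].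
  split; [unfold LF, lift_formula, u1, u2, u3, u4; simpl fst; simpl snd; smt; exact nzJ|].
  split; [unfold LF, lift_formula, u1, u2, u3, u4; simpl fst; simpl snd; smt; exact nzJ|].
  split; [unfold LF, lift_formula, u1, u2, u3, u4; simpl fst; simpl snd; smt; exact nzJ|].
  split.
  (* This holds for all [t] and [q], also outside [N]: [slices] is an equality of total derivative
     operators. *)
  { intros t q.
    destruct (slices Ps1 t q) as (a1 & a2 & a3 & a4 & a5). destruct (slices Ps2 t q) as (b1 & b2 & b3 & b4 & b5).
    unfold transform, lift0.
    change (fun z => fst (Phi (- t) z)) with (fun z => Ps1 (t, z)). change (fun z => snd (Phi (- t) z)) with (fun z => Ps2 (t, z)).
    rewrite a1, a2, a3, a4, a5, b1, b2, b3, b4, b5. reflexivity. }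
  intros z hz.
  destruct (OD z hz) as [Oz DXz].
  destruct (slices Ps1 0 z) as (a1 & a2 & a3 & a4 & a5). destruct (slices Ps2 0 z) as (b1 & b2 & b3 & b4 & b5).
  destruct (second_ext D0 (fun z => Ps1 (0, z)) (fun z => fst z) z oD0 hz val1) as (c1 & c2 & c3 & c4 & c5).
  destruct (second_ext D0 (fun z => Ps2 (0, z)) (fun z => snd z) z oD0 hz val2) as (k1 & k2 & k3 & k4 & k5).
  rewrite c1 in a1. rewrite c2 in a2. rewrite c3 in a3. rewrite c4 in a4. rewrite c5 in a5.
  rewrite k1 in b1. rewrite k2 in b2. rewrite k3 in b3. rewrite k4 in b4. rewrite k5 in b5.
  clear c1 c2 c3 c4 c5 k1 k2 k3 k4 k5.
  rewrite d1_fst in a1. rewrite d2_fst in a2. rewrite d1_fst, d1_const in a3. rewrite d2_fst, d1_const in a4. rewrite d2_fst, d2_const in a5.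
  rewrite d1_snd in b1. rewrite d2_snd in b2. rewrite d1_snd, d1_const in b3. rewrite d2_snd, d1_const in b4. rewrite d2_snd, d2_const in b5.
  assert (vV : (V1 (0, z), V2 (0, z), V3 (0, z), V4 (0, z)) = S z).
  { unfold V1, V2, V3, V4; simpl. rewrite P0 by auto. destruct (S z) as [[[? ?] ?] ?]; reflexivity. }
  split.
  { unfold LF. rewrite <- a1, <- a2, <- a3, <- a4, <- a5, <- b1, <- b2, <- b3, <- b4, <- b5, vV.
    destruct (S z) as [[[v1 v2] v3] v4]. unfold lift_formula, u1, u2, u3, u4; simpl fst; simpl snd.
    apply f_equal2; [apply f_equal2; [apply f_equal2|]|]; field. }
  set (Y1 := fun z => fst (X z)). set (Y2 := fun z => snd (X z)).
  assert (D0X : forall q, D0 q -> DX q) by (intros q hq; now apply OD).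
  assert (sY1 : sm D0 Y1) by (eapply smooth_sub; [exact D0X|exact sX1]).
  assert (sY2 : sm D0 Y2) by (eapply smooth_sub; [exact D0X|exact sX2]).
  assert (te1 : forall q, D0 q -> (fun q : R2 => dd (V := NR3) e0 Ps1 (0, q)) q = - Y1 q) by (intros q hq; exact (proj1 (td q (proj1 (OD q hq))))).
  assert (te2 : forall q, D0 q -> (fun q : R2 => dd (V := NR3) e0 Ps2 (0, q)) q = - Y2 q) by (intros q hq; exact (proj2 (td q (proj1 (OD q hq))))).
  destruct (slices (dd (V := NR3) e0 Ps1) 0 z) as (i1 & i2 & i3 & i4 & i5). destruct (slices (dd (V := NR3) e0 Ps2) 0 z) as (j1 & j2 & j3 & j4 & j5).
  destruct (second_ext D0 (fun q : R2 => dd (V := NR3) e0 Ps1 (0, q)) (fun q : R2 => - Y1 q) z oD0 hz te1) as (c1 & c2 & c3 & c4 & c5).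
  destruct (second_ext D0 (fun q : R2 => dd (V := NR3) e0 Ps2 (0, q)) (fun q : R2 => - Y2 q) z oD0 hz te2) as (k1 & k2 & k3 & k4 & k5).
  destruct (opp_second D0 Y1 z oD0 sY1 hz) as (m1 & m2 & m3 & m4 & m5). destruct (opp_second D0 Y2 z oD0 sY2 hz) as (n1 & n2 & n3 & n4 & n5).
  rewrite c1, m1 in i1. rewrite c2, m2 in i2. rewrite c3, m3 in i3. rewrite c4, m4 in i4. rewrite c5, m5 in i5.
  rewrite k1, n1 in j1. rewrite k2, n2 in j2. rewrite k3, n3 in j3. rewrite k4, n4 in j4. rewrite k5, n5 in j5.
  clear c1 c2 c3 c4 c5 k1 k2 k3 k4 k5 m1 m2 m3 m4 m5 n1 n2 n3 n4 n5.
  assert (T : forall K, sm3 N K -> is_derive (fun t => K (t, z)) 0 (dd (V := NR3) e0 K (0, z))) by (intros K sK; now apply (is_dd_e0 N)).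
  assert (DV : forall h, sm DS h -> is_derive (fun t => h (Phi (- t) z)) 0 (- fst (X z) * d1 h z + - snd (X z) * d2 h z)).
  { intros h sh. destruct (td z Oz) as [t1 t2].
    apply (is_derive_ext (fun t => h (Ps1 (t, z), Ps2 (t, z)))); [intros t; now rewrite PsE|].
    assert (B : (Ps1 (0, z), Ps2 (0, z)) = z) by (rewrite PsE; simpl; now apply P0).
    assert (DSz : DS z) by (rewrite <- B; apply hz).
    pose proof (is_derive_comp_R2 DS h (fun t => Ps1 (t, z)) (fun t => Ps2 (t, z)) 0 (- fst (X z)) (- snd (X z)) oDS (sh 1%nat)) as CR.
    cbv beta in CR. rewrite B in CR. apply CR; auto.
    - rewrite <- t1. now apply T.
    - rewrite <- t2. now apply T. }
  (* Time and space derivatives commute, so at time 0 the time derivatives of the spatial jet of the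
     backward flow are the jet of [- X]. *)
  assert (Q1 := fun v => proj1 (dd_e0_space O' Ps1 v e0 (0, z) oO' s1 (NO _ hz))).
  assert (Q2 := fun v => proj1 (dd_e0_space O' Ps2 v e0 (0, z) oO' s2 (NO _ hz))).
  assert (Q3 := fun v w => proj2 (dd_e0_space O' Ps1 v w (0, z) oO' s1 (NO _ hz))).
  assert (Q4 := fun v w => proj2 (dd_e0_space O' Ps2 v w (0, z) oO' s2 (NO _ hz))).
  assert (TT : forall K l, sm3 N K -> dd (V := NR3) e0 K (0, z) = l -> is_derive (fun t => K (t, z)) 0 l) by (intros K l sK <-; now apply T).
  destruct (lift_formula_der (fun t => dd (V := NR3) e1 Ps1 (t, z)) (fun t => dd (V := NR3) e2 Ps1 (t, z)) (fun t => dd (V := NR3) e1 Ps2 (t, z)) (fun t => dd (V := NR3) e2 Ps2 (t, z))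
     (fun t => dd (V := NR3) e1 (dd (V := NR3) e1 Ps1) (t, z)) (fun t => dd (V := NR3) e1 (dd (V := NR3) e2 Ps1) (t, z)) (fun t => dd (V := NR3) e2 (dd (V := NR3) e2 Ps1) (t, z))
     (fun t => dd (V := NR3) e1 (dd (V := NR3) e1 Ps2) (t, z)) (fun t => dd (V := NR3) e1 (dd (V := NR3) e2 Ps2) (t, z)) (fun t => dd (V := NR3) e2 (dd (V := NR3) e2 Ps2) (t, z))
     (fun t => V1 (t, z)) (fun t => V2 (t, z)) (fun t => V3 (t, z)) (fun t => V4 (t, z)) 0
     (d1 Y1 z) (d2 Y1 z) (d1 Y2 z) (d2 Y2 z) (d1 (d1 Y1) z) (d1 (d2 Y1) z) (d2 (d2 Y1) z) (d1 (d1 Y2) z) (d1 (d2 Y2) z) (d2 (d2 Y2) z)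
     (- fst (X z) * d1 (fun q => u1 (S q)) z + - snd (X z) * d2 (fun q => u1 (S q)) z)
     (- fst (X z) * d1 (fun q => u2 (S q)) z + - snd (X z) * d2 (fun q => u2 (S q)) z)
     (- fst (X z) * d1 (fun q => u3 (S q)) z + - snd (X z) * d2 (fun q => u3 (S q)) z)
     (- fst (X z) * d1 (fun q => u4 (S q)) z + - snd (X z) * d2 (fun q => u4 (S q)) z))
    as (r1 & r2 & r3 & r4);
    try (symmetry; assumption);
    try (apply TT; [smt|first [rewrite Q1|rewrite Q2|rewrite Q3|rewrite Q4]; symmetry; assumption]);
    try (apply DV; assumption).
  simpl in vV.
  rewrite !dd_e0.
  etransitivity.
  { apply f_equal2; [apply f_equal2; [apply f_equal2|]|]; apply is_derive_unique; [exact r1|exact r2|exact r3|exact r4]. }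
  cbv beta. rewrite vV. reflexivity.
Qed.

(** The prolongation formula: the derivative components of the prolonged field are the derivatives
    of the characteristic plus the transport of the first derivatives of the section. Hence second
    derivatives of [S] drop out of [prol]. *)
Lemma hvec_d (D : R2 -> Prop) (X : R2 -> R2) (S : R2 -> R4) (p : R2) : open2 D -> smooth (V := NR2) (W := NR2) D X ->
  smooth (V := NR2) (W := NR4) D S -> D p ->
  on_R4 d1 (hvec X S) p = add4 (fst (snd (prol (vj3 X p) (j1 S p))))
    (lin2 (- fst (X p)) (- snd (X p)) (on_R4 (fun h => d1 (d1 h)) S p) (on_R4 (fun h => d1 (d2 h)) S p)) /\
  on_R4 d2 (hvec X S) p = add4 (snd (snd (prol (vj3 X p) (j1 S p))))
    (lin2 (- fst (X p)) (- snd (X p)) (on_R4 (fun h => d1 (d2 h)) S p) (on_R4 (fun h => d2 (d2 h)) S p)).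
Proof.
  intros o sX sS Dp. destruct p as [x y].
  destruct (smooth_R2 (V := NR2) D X sX) as [sX1 sX2]. destruct (smooth_R4 (V := NR2) D S sS) as (sS1 & sS2 & sS3 & sS4).
  assert (EX : exists X1 X2 : R2 -> R, X = fun z => (X1 z, X2 z)).
  { exists (fun z => fst (X z)), (fun z => snd (X z)). apply functional_extensionality; intros z; now destruct (X z). }
  assert (ES : exists S1 S2 S3 S4 : R2 -> R, S = fun z => (S1 z, S2 z, S3 z, S4 z)).
  { exists (fun z => u1 (S z)), (fun z => u2 (S z)), (fun z => u3 (S z)), (fun z => u4 (S z)).
    apply functional_extensionality; intros z; now destruct (S z) as [[[? ?] ?] ?]. }
  destruct EX as (X1 & X2 & ->). destruct ES as (S1 & S2 & S3 & S4 & ->).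
  unfold hvec, prol, vj3, vj2, vj1, j1, on_R4, on_R2, add4, Lb, Ls, lin2, u1, u2, u3, u4 in *. cbn [fst snd] in *.
  change (fun z => X1 z) with X1 in *. change (fun z => X2 z) with X2 in *.
  change (fun z => S1 z) with S1 in *. change (fun z => S2 z) with S2 in *.
  change (fun z => S3 z) with S3 in *. change (fun z => S4 z) with S4 in *.
  change (sm D X1) in sX1. change (sm D X2) in sX2. change (sm D S1) in sS1. change (sm D S2) in sS2. change (sm D S3) in sS3. change (sm D S4) in sS4.
  assert (cm : forall f, sm D f -> forall z, D z -> d2 (d1 f) z = d1 (d2 f) z) by (intros; symmetry; now apply (smooth_d12 D)).
  assert (cm112 : forall f, sm D f -> d2 (d1 (d1 f)) (x, y) = d1 (d1 (d2 f)) (x, y)).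
  { intros f sf. rewrite cm by (auto; smt). apply (d1_ext D _ _ (x, y) o Dp). intros z hz; now apply cm. }
  assert (cm122 : forall f, sm D f -> d2 (d1 (d2 f)) (x, y) = d1 (d2 (d2 f)) (x, y)).
  { intros f sf. rewrite cm by (auto; smt). reflexivity. }
  split; (apply f_equal2; [apply f_equal2; [apply f_equal2|]|]); apply is_derive_unique; cbn [fst snd].
  1-4: (eapply der_eq; [der ltac:(idtac; leaf1 D)|ring]).
  all: (eapply der_eq; [der ltac:(idtac; leaf2 D)|]; rewrite ?cm112, ?cm122 by assumption; rewrite ?cm by assumption; ring).
Qed.

Lemma chain_time (N : R * R2 -> Prop) (K : R * R2 -> R) (c : R -> R2) (a : R2) : open3 N -> sm3 N K -> N (0, c 0) ->
  is_derive (V := NR2) c 0 a ->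
  is_derive (fun t => K (t, c t)) 0
   (dd (V := NR3) e0 K (0, c 0) + fst a * dd (V := NR3) e1 K (0, c 0) + snd a * dd (V := NR3) e2 K (0, c 0)).
Proof.
  intros o sK Np hc.
  pose proof (is_derive_lin_post (W := NR2) (Z := R_NormedModule) c fst 0 a is_linear_fst hc) as h1.
  pose proof (is_derive_lin_post (W := NR2) (Z := R_NormedModule) c snd 0 a is_linear_snd hc) as h2.
  assert (pr : forall t, (t, (fst (c t), snd (c t))) = (t, c t)) by (intros t; now destruct (c t)).
  pose proof (dd_R3 N K (fun t => t) (fun t => fst (c t)) (fun t => snd (c t)) 0 1 (fst a) (snd a) o (sK 1%nat)) as H.
  cbv beta in H. rewrite (pr 0) in H. specialize (H Np (der_id 0) h1 h2).
  apply (is_derive_ext (fun t => K (t, (fst (c t), snd (c t))))); [intros t; now rewrite pr|].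
  eapply der_eq; [exact H|].
  assert (E : ((1, (fst a, snd a)) : NR3) = plus (plus (e0 : NR3) (scal (fst a) (e1 : NR3))) (scal (snd a) (e2 : NR3))).
  { change ((1, (fst a, snd a)) = ((1 + fst a * 0 + snd a * 0, (0 + fst a * 1 + snd a * 0, 0 + fst a * 0 + snd a * 1)) : R * R2)).
    apply f_equal2; [ring|apply f_equal2; ring]. }
  rewrite E. pose proof (sK 1%nat) as cK.
  rewrite !(dd_plus (V := NR3) N), !(dd_scal (V := NR3) N); auto; apply diffble_R3.
Qed.

(** The limit defining the prolonged field exists and depends only on the 3-jet of [X] and the 1-jet
    of [S], which makes membership in [calA] a matter of linear algebra. *)
Lemma prolong_value (X : R2 -> R2) (p : R2) (Phi : R -> R2 -> R2) (S : R2 -> R4) :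
  local_flow X p Phi -> smooth_near p X -> smooth_near p S ->
  is_derive (V := NJ1) (fun t : R => j1 (transform (Phi (- t)) S) (Phi t p)) 0 (prol (vj3 X p) (j1 S p)).
Proof.
  intros fl sX sS.
  destruct (prolong_derive X p Phi S fl sX sS) as (H1 & H2 & H3 & H4 & N & oN & Np & s1 & s2 & s3 & s4 & tr & v0).
  destruct fl as (O & oO & Op & _ & Phi0 & dPhi).
  destruct sX as (DX & oDX & DXp & sX). destruct sS as (DS & oDS & DSp & sS).
  assert (hPhi0 : Phi 0 p = p) by auto.
  assert (hc : is_derive (V := NR2) (fun t => Phi t p) 0 (X p)) by (pose proof (dPhi 0 p Op) as h; now rewrite hPhi0 in h).
  assert (CT : forall K, sm3 N K -> is_derive (fun t => K (t, Phi t p)) 0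
    (dd (V := NR3) e0 K (0, p) + fst (X p) * dd (V := NR3) e1 K (0, p) + snd (X p) * dd (V := NR3) e2 K (0, p))).
  { intros K sK. pose proof (chain_time N K (fun t => Phi t p) (X p) oN sK) as h. cbv beta in h. rewrite hPhi0 in h. now apply h. }
  set (D := fun z : R2 => N (0, z) /\ DX z /\ DS z).
  assert (oD : open2 D).
  { apply (open_and (T := NR2)); [|apply (open_and (T := NR2)); auto].
    apply (open_pre (V := NR2) (W := NR3) (fun z => (0, z)) N); auto. intros z.
    apply (continuous_pair (fun _ => 0) (fun z : NR2 => z)); [apply continuous_const|apply continuous_id]. }
  assert (Dp : D p) by (split; auto).
  destruct (hvec_d D X S p oD) as [hd1 hd2]; auto.
  { eapply smooth_sub; [|exact sX]. intros z hz; apply hz. }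
  { eapply smooth_sub; [|exact sS]. intros z hz; apply hz. }
  assert (comp : forall (H : R * R2 -> R) (f h : R2 -> R), sm3 N H -> (forall z, N (0, z) -> H (0, z) = f z) ->
     (forall z, N (0, z) -> dd (V := NR3) e0 H (0, z) = h z) ->
     is_derive (fun t => H (t, Phi t p)) 0 (h p + fst (X p) * d1 f p + snd (X p) * d2 f p) /\
     is_derive (fun t => dd (V := NR3) e1 H (t, Phi t p)) 0 (d1 h p + fst (X p) * d1 (d1 f) p + snd (X p) * d1 (d2 f) p) /\
     is_derive (fun t => dd (V := NR3) e2 H (t, Phi t p)) 0 (d2 h p + fst (X p) * d1 (d2 f) p + snd (X p) * d2 (d2 f) p)).
  { intros H f h sH ef eh.
    destruct (slices H 0 p) as (a1 & a2 & a3 & a4 & a5).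
    destruct (second_ext D (fun z => H (0, z)) f p oD Dp) as (b1 & b2 & b3 & b4 & b5); [intros z hz; apply ef, hz|].
    destruct (slices (dd (V := NR3) e0 H) 0 p) as (c1 & c2 & _).
    destruct (second_ext D (fun z : R2 => dd (V := NR3) e0 H (0, z)) h p oD Dp) as (k1 & k2 & _); [intros z hz; apply eh, hz|].
    destruct (dd_e0_space N H e1 e1 (0, p) oN sH Np) as [q1 _]. destruct (dd_e0_space N H e2 e2 (0, p) oN sH Np) as [q2 _].
    assert (q3 : dd (V := NR3) e2 (dd (V := NR3) e1 H) (0, p) = dd (V := NR3) e1 (dd (V := NR3) e2 H) (0, p)).
    { apply (dd_comm (V := NR3) N); auto. }
    split; [|split].
    - eapply der_eq; [now apply CT|]. rewrite eh, <- a1, <- a2, b1, b2 by auto. reflexivity.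
    - eapply der_eq; [apply CT; now apply (smooth_dd (V := NR3))|]. rewrite q1, <- c1, k1, q3, <- a3, <- a4, b3, b4. reflexivity.
    - eapply der_eq; [apply CT; now apply (smooth_dd (V := NR3))|]. rewrite q2, <- c2, k2, <- a4, <- a5, b4, b5. reflexivity. }
  assert (vS : forall z, N (0, z) -> H1 (0, z) = u1 (S z) /\ H2 (0, z) = u2 (S z) /\ H3 (0, z) = u3 (S z) /\ H4 (0, z) = u4 (S z)).
  { intros z hz. destruct (v0 z hz) as [e _]. rewrite <- e. auto. }
  assert (vh : forall z, N (0, z) -> dd (V := NR3) e0 H1 (0, z) = u1 (hvec X S z) /\ dd (V := NR3) e0 H2 (0, z) = u2 (hvec X S z) /\
     dd (V := NR3) e0 H3 (0, z) = u3 (hvec X S z) /\ dd (V := NR3) e0 H4 (0, z) = u4 (hvec X S z)).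
  { intros z hz. destruct (v0 z hz) as [_ e]. rewrite <- e. auto. }
  destruct (comp H1 (fun z => u1 (S z)) (fun z => u1 (hvec X S z)) s1) as (x1 & y1 & z1); [intros; now apply vS|intros; now apply vh|].
  destruct (comp H2 (fun z => u2 (S z)) (fun z => u2 (hvec X S z)) s2) as (x2 & y2 & z2); [intros; now apply vS|intros; now apply vh|].
  destruct (comp H3 (fun z => u3 (S z)) (fun z => u3 (hvec X S z)) s3) as (x3 & y3 & z3); [intros; now apply vS|intros; now apply vh|].
  destruct (comp H4 (fun z => u4 (S z)) (fun z => u4 (hvec X S z)) s4) as (x4 & y4 & z4); [intros; now apply vS|intros; now apply vh|].
  apply (is_derive_ext (V := NJ1) (fun t => (Phi t p, (H1 (t, Phi t p), H2 (t, Phi t p), H3 (t, Phi t p), H4 (t, Phi t p)),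
     ((dd (V := NR3) e1 H1 (t, Phi t p), dd (V := NR3) e1 H2 (t, Phi t p), dd (V := NR3) e1 H3 (t, Phi t p), dd (V := NR3) e1 H4 (t, Phi t p)),
      (dd (V := NR3) e2 H1 (t, Phi t p), dd (V := NR3) e2 H2 (t, Phi t p), dd (V := NR3) e2 H3 (t, Phi t p), dd (V := NR3) e2 H4 (t, Phi t p)))))).
  { intros t. cbv beta. change R in t. unfold j1, on_R4. rewrite tr.
    assert (F : forall (u : R4 -> R) (H : R * R2 -> R), (forall q, u (H1 (t, q), H2 (t, q), H3 (t, q), H4 (t, q)) = H (t, q)) ->
       (fun q => u (transform (Phi (- t)) S q)) = fun q => H (t, q)).
    { intros u H e. apply functional_extensionality; intros q. now rewrite tr. }
    rewrite (F u1 H1), (F u2 H2), (F u3 H3), (F u4 H4) by reflexivity.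
    apply f_equal2; [reflexivity|]. apply f_equal2; (apply f_equal2; [apply f_equal2; [apply f_equal2|]|]); symmetry;
      [exact (proj1 (slices H1 t _))|exact (proj1 (slices H2 t _))|exact (proj1 (slices H3 t _))|exact (proj1 (slices H4 t _))
      |exact (proj1 (proj2 (slices H1 t _)))|exact (proj1 (proj2 (slices H2 t _)))|exact (proj1 (proj2 (slices H3 t _)))|exact (proj1 (proj2 (slices H4 t _)))]. }
  assert (E : prol (vj3 X p) (j1 S p) = (X p,
    (u1 (hvec X S p) + fst (X p) * d1 (fun z => u1 (S z)) p + snd (X p) * d2 (fun z => u1 (S z)) p,
     u2 (hvec X S p) + fst (X p) * d1 (fun z => u2 (S z)) p + snd (X p) * d2 (fun z => u2 (S z)) p,
     u3 (hvec X S p) + fst (X p) * d1 (fun z => u3 (S z)) p + snd (X p) * d2 (fun z => u3 (S z)) p,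
     u4 (hvec X S p) + fst (X p) * d1 (fun z => u4 (S z)) p + snd (X p) * d2 (fun z => u4 (S z)) p),
    (add4 (on_R4 d1 (hvec X S) p) (lin2 (fst (X p)) (snd (X p)) (on_R4 (fun h => d1 (d1 h)) S p) (on_R4 (fun h => d1 (d2 h)) S p)),
     add4 (on_R4 d2 (hvec X S) p) (lin2 (fst (X p)) (snd (X p)) (on_R4 (fun h => d1 (d2 h)) S p) (on_R4 (fun h => d2 (d2 h)) S p))))).
  { rewrite hd1, hd2.
    (* Following the moving base point adds the transport term that the characteristic subtracts. *)
    assert (canc : forall (v a b : R4) (s t : R), add4 (add4 v (lin2 (- s) (- t) a b)) (lin2 s t a b) = v).
    { intros [[[? ?] ?] ?] a b s t. unfold add4, lin2, u1, u2, u3, u4; cbn [fst snd].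
      apply f_equal2; [apply f_equal2; [apply f_equal2|]|]; ring. }
    rewrite !canc.
    assert (M : fst (prol (vj3 X p) (j1 S p)) = (X p,
    (u1 (hvec X S p) + fst (X p) * d1 (fun z => u1 (S z)) p + snd (X p) * d2 (fun z => u1 (S z)) p,
     u2 (hvec X S p) + fst (X p) * d1 (fun z => u2 (S z)) p + snd (X p) * d2 (fun z => u2 (S z)) p,
     u3 (hvec X S p) + fst (X p) * d1 (fun z => u3 (S z)) p + snd (X p) * d2 (fun z => u3 (S z)) p,
     u4 (hvec X S p) + fst (X p) * d1 (fun z => u4 (S z)) p + snd (X p) * d2 (fun z => u4 (S z)) p))).
    { unfold prol, vj3, vj2, vj1, j1, hvec, on_R4, add4, lin2; cbn [fst snd u1 u2 u3 u4]. apply f_equal2; [reflexivity|].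
      unfold u1, u2, u3, u4; cbn [fst snd]. apply f_equal2; [apply f_equal2; [apply f_equal2|]|]; ring. }
    rewrite <- M. now destruct (prol (vj3 X p) (j1 S p)) as [? [? ?]]. }
  rewrite E.
  apply (is_derive_J1 (fun t => Phi t p) (fun t => (H1 (t, Phi t p), H2 (t, Phi t p), H3 (t, Phi t p), H4 (t, Phi t p)))); auto;
    apply is_derive_R4; auto.
  all: unfold on_R4, lin2, add4; cbn [fst snd]; unfold u1, u2, u3, u4 in *; cbn [fst snd] in *.
  all: eapply der_eq; [eassumption|ring].
Qed.

(** * Polynomials with prescribed jets *)

(** The coefficients are the partial derivatives at [p]; the denominators are chosen so that [d1]
    and [d2] merely shift them. *)
Definition poly3 (p : R2) (c00 c10 c01 c20 c11 c02 c30 c21 c12 c03 : R) (z : R2) : R :=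
  let x := fst z - fst p in let y := snd z - snd p in
  c00 + c10 * x + c01 * y + c20 / 2 * x ^ 2 + c11 * (x * y) + c02 / 2 * y ^ 2
  + c30 / 6 * x ^ 3 + c21 / 2 * (x ^ 2 * y) + c12 / 2 * (x * y ^ 2) + c03 / 6 * y ^ 3.

Lemma d1_poly3 p c00 c10 c01 c20 c11 c02 c30 c21 c12 c03 :
  d1 (poly3 p c00 c10 c01 c20 c11 c02 c30 c21 c12 c03) = poly3 p c10 c20 c11 c30 c21 c12 0 0 0 0.
Proof.
  apply functional_extensionality; intros [x y]. apply is_derive_unique; unfold poly3; cbn [fst snd].
  eapply der_eq; [der ltac:(idtac; fail)|]. simpl. field.
Qed.

Lemma d2_poly3 p c00 c10 c01 c20 c11 c02 c30 c21 c12 c03 :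
  d2 (poly3 p c00 c10 c01 c20 c11 c02 c30 c21 c12 c03) = poly3 p c01 c11 c02 c21 c12 c03 0 0 0 0.
Proof.
  apply functional_extensionality; intros [x y]. apply is_derive_unique; unfold poly3; cbn [fst snd].
  eapply der_eq; [der ltac:(idtac; fail)|]. simpl. field.
Qed.

Lemma poly3_at p c00 c10 c01 c20 c11 c02 c30 c21 c12 c03 : poly3 p c00 c10 c01 c20 c11 c02 c30 c21 c12 c03 p = c00.
Proof. unfold poly3. simpl. field. Qed.

Lemma poly3_smooth p c00 c10 c01 c20 c11 c02 c30 c21 c12 c03 (D : R2 -> Prop) :
  sm D (poly3 p c00 c10 c01 c20 c11 c02 c30 c21 c12 c03).
Proof.
  pose proof (smooth_coord_fst D). pose proof (smooth_coord_snd D).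
  unfold poly3. smt; intros; lra.
Qed.

(** * Fields with a prescribed jet and an explicit flow *)

Definition everywhere : R2 -> Prop := fun _ => True.
Lemma open_everywhere : open2 everywhere.
Proof. apply open_true. Qed.

Fixpoint vanish (k : nat) (f : R2 -> R) (p : R2) : Prop :=
  f p = 0 /\ match k with O => True | S k => vanish k (d1 f) p /\ vanish k (d2 f) p end.

Lemma vanish_S k f p : vanish (S k) f p -> vanish k f p.
Proof.
  revert f; induction k as [|k IH]; intros f [h [h1 h2]]; split; auto.
Qed.

Lemma vanish_ext k (D : R2 -> Prop) (f g : R2 -> R) (p : R2) : open2 D -> D p -> (forall z, D z -> f z = g z) -> vanish k f p -> vanish k g p.
Proof.
  intros o Dp; revert f g; induction k as [|k IH]; intros f g e [h H]; (split; [now rewrite <- e|]); auto.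
  destruct H as [h1 h2]. split.
  - apply (IH (d1 f)); auto. intros z hz; now apply (d1_ext D).
  - apply (IH (d2 f)); auto. intros z hz; now apply (d2_ext D).
Qed.

Lemma vanish_plus k (D : R2 -> Prop) (f g : R2 -> R) (p : R2) : open2 D -> D p -> sm D f -> sm D g -> vanish k f p -> vanish k g p ->
  vanish k (fun z => f z + g z) p.
Proof.
  intros o Dp; revert f g; induction k as [|k IH]; intros f g sf sg [h H] [h' H']; (split; [rewrite h, h'; ring|]); auto.
  destruct H as [h1 h2], H' as [h1' h2']. split.
  - apply (vanish_ext k D (fun z => d1 f z + d1 g z)); auto; [intros z hz; symmetry; now apply (d1_plus D)|].
    apply IH; auto; smt.
  - apply (vanish_ext k D (fun z => d2 f z + d2 g z)); auto; [intros z hz; symmetry; now apply (d2_plus D)|].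
    apply IH; auto; smt.
Qed.

Lemma vanish_mult k (D : R2 -> Prop) (f g : R2 -> R) (p : R2) : open2 D -> D p -> sm D f -> sm D g -> vanish k f p ->
  vanish k (fun z => f z * g z) p.
Proof.
  intros o Dp; revert f g; induction k as [|k IH]; intros f g sf sg [h H]; (split; [rewrite h; ring|]); auto.
  assert (hf : vanish k f p) by (apply vanish_S; split; auto).
  destruct H as [h1 h2]. split.
  - apply (vanish_ext k D (fun z => d1 f z * g z + f z * d1 g z)); auto; [intros z hz; symmetry; now apply (d1_mult D)|].
    apply (vanish_plus k D); auto; try smt; apply IH; auto; smt.
  - apply (vanish_ext k D (fun z => d2 f z * g z + f z * d2 g z)); auto; [intros z hz; symmetry; now apply (d2_mult D)|].
    apply (vanish_plus k D); auto; try smt; apply IH; auto; smt.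
Qed.

(** By the chain rule, derivatives of the composite are combinations of derivatives of [h] at the
    image point, so a vanishing jet survives any smooth change of coordinates. *)
Lemma vanish_comp k (V V' : R2 -> Prop) (h g1 g2 : R2 -> R) (p : R2) : open2 V -> open2 V' -> sm V h -> sm V' g1 -> sm V' g2 ->
  (forall z, V' z -> V (g1 z, g2 z)) -> V' p -> vanish k h (g1 p, g2 p) -> vanish k (fun z => h (g1 z, g2 z)) p.
Proof.
  intros oV oV' sh s1 s2 hg hp; revert h sh; induction k as [|k IH]; intros h sh [e H]; split; auto.
  assert (c1 : sm V' (fun z => d1 h (g1 z, g2 z))) by (apply (smooth_chain V V'); auto; smt).
  assert (c2 : sm V' (fun z => d2 h (g1 z, g2 z))) by (apply (smooth_chain V V'); auto; smt).
  assert (i1 : vanish k (fun z => d1 h (g1 z, g2 z)) p) by (apply IH; [smt|apply H]).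
  assert (i2 : vanish k (fun z => d2 h (g1 z, g2 z)) p) by (apply IH; [smt|apply H]).
  split.
  - apply (vanish_ext k V' (fun z => d1 h (g1 z, g2 z) * d1 g1 z + d2 h (g1 z, g2 z) * d1 g2 z)); auto.
    + intros z hz. rewrite (chain_d1 V V' h g1 g2) by auto. ring.
    + apply (vanish_plus k V'); auto; try smt; apply (vanish_mult k V'); auto; smt.
  - apply (vanish_ext k V' (fun z => d1 h (g1 z, g2 z) * d2 g1 z + d2 h (g1 z, g2 z) * d2 g2 z)); auto.
    + intros z hz. rewrite (chain_d2 V V' h g1 g2) by auto. ring.
    + apply (vanish_plus k V'); auto; try smt; apply (vanish_mult k V'); auto; smt.
Qed.

Fixpoint flat_on_axis (n : nat) (f : R2 -> R) : Prop :=
  match n with O => True | S n => (forall s, f (0, s) = 0) /\ flat_on_axis n (d1 f) end.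

Lemma flat_on_axis_d2 n (f : R2 -> R) : sm everywhere f -> flat_on_axis n f -> flat_on_axis n (d2 f).
Proof.
  pose proof open_everywhere as o.
  revert f; induction n as [|n IH]; intros f sf; auto. intros [h H]. split.
  - intros s. unfold d2; simpl. rewrite (Derive_ext _ (fun _ => 0)) by auto. apply Derive_const.
  - assert (E : d1 (d2 f) = d2 (d1 f)) by (apply functional_extensionality; intros z; now apply (smooth_d12 everywhere)).
    rewrite E. apply IH; auto. smt.
Qed.

Lemma flat_on_axis_S n f : flat_on_axis (S n) f -> flat_on_axis n f.
Proof. revert f; induction n as [|n IH]; intros f [h H]; simpl; auto. Qed.

(** On the axis a function that vanishes there has vanishing tangential derivatives too, so only
    normal derivatives matter. [flat_on_axis (S n)] controls normal orders 0 to [n], which is the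
    full [n]-jet. *)
Lemma flat_on_axis_vanish n (f : R2 -> R) (s : R) : sm everywhere f -> flat_on_axis (S n) f -> vanish n f (0, s).
Proof.
  pose proof open_everywhere as o.
  revert f; induction n as [|n IH]; intros f sf [h H]; split; auto.
  split; [apply IH; auto; smt|]. apply IH; [smt|]. apply flat_on_axis_S. apply flat_on_axis_d2; auto. split; auto.
Qed.

Lemma flat_on_axis_mult n (f g : R2 -> R) : sm everywhere f -> sm everywhere g -> flat_on_axis n f -> flat_on_axis n (fun z => f z * g z).
Proof.
  pose proof open_everywhere as o.
  assert (P : forall n (f g : R2 -> R), sm everywhere f -> sm everywhere g -> flat_on_axis n f -> flat_on_axis n g -> flat_on_axis n (fun z => f z + g z)).
  { clear n f g. induction n as [|n IH]; intros f g sf sg; simpl; auto. intros [h H] [h' H']. split.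
    - intros s. rewrite h, h'. ring.
    - assert (E : d1 (fun z => f z + g z) = fun z => d1 f z + d1 g z) by (apply functional_extensionality; intros z; now apply (d1_plus everywhere)).
      rewrite E. apply IH; auto; smt. }
  revert f g; induction n as [|n IH]; intros f g sf sg; simpl; auto. intros [h H].
  assert (h' : flat_on_axis n f) by (apply flat_on_axis_S; split; auto).
  split.
  - intros s. rewrite h. ring.
  - assert (E : d1 (fun z => f z * g z) = fun z => d1 f z * g z + f z * d1 g z) by (apply functional_extensionality; intros z; now apply (d1_mult everywhere)).
    rewrite E. apply P; try smt; apply IH; auto; smt.
Qed.

Definition iter_d1 (j : nat) (f : R2 -> R) : R2 -> R := Nat.iter j d1 f.

Lemma iter_d1_S j f : iter_d1 (S j) f = iter_d1 j (d1 f).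
Proof. unfold iter_d1. apply Nat.iter_succ_r. Qed.

Lemma iter_d1_smooth j (f : R2 -> R) : sm everywhere f -> sm everywhere (iter_d1 j f).
Proof. pose proof open_everywhere as o. intros sf. induction j; simpl; auto. change (sm everywhere (d1 (iter_d1 j f))). smt. Qed.

Lemma iter_d1_plus j (f g : R2 -> R) : sm everywhere f -> sm everywhere g ->
  iter_d1 j (fun z => f z + g z) = fun z => iter_d1 j f z + iter_d1 j g z.
Proof.
  intros sf sg. induction j as [|j IH]; auto. change (d1 (iter_d1 j (fun z => f z + g z)) = fun z => d1 (iter_d1 j f) z + d1 (iter_d1 j g) z).
  rewrite IH. apply functional_extensionality; intros z. apply (d1_plus everywhere); try (now apply iter_d1_smooth). exact I.
Qed.

Lemma flat_on_axis_iff n f : flat_on_axis n f <-> forall j s, (j < n)%nat -> iter_d1 j f (0, s) = 0.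
Proof.
  revert f; induction n as [|n IH]; intros f; simpl; [split; auto; intros; lia|].
  rewrite IH. split.
  - intros [h H] [|j] s hj; [apply h|]. rewrite iter_d1_S. apply H. lia.
  - intros H. split; [intros s; apply (H 0%nat); lia|]. intros j s hj. rewrite <- iter_d1_S. apply H. lia.
Qed.

Definition lie_der (a b h : R2 -> R) (z : R2) : R := a z * d1 h z + b z * d2 h z.
Definition lie_iter (a b : R2 -> R) (j : nat) (h : R2 -> R) : R2 -> R := Nat.iter j (lie_der a b) h.

(* Taylor polynomial in the first variable, with coefficients given along the curve c. *)
Definition taylor (c : R -> R2) (f0 f1 f2 f3 f4 : R2 -> R) (s : R2) : R :=
  f0 (c (snd s)) + fst s * f1 (c (snd s)) + fst s ^ 2 / 2 * f2 (c (snd s))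
  + fst s ^ 3 / 6 * f3 (c (snd s)) + fst s ^ 4 / 24 * f4 (c (snd s)).

Lemma d1_taylor c f0 f1 f2 f3 f4 : d1 (taylor c f0 f1 f2 f3 f4) = taylor c f1 f2 f3 f4 (fun _ => 0).
Proof.
  apply functional_extensionality; intros [x y]. apply is_derive_unique; unfold taylor; cbn [fst snd].
  eapply der_eq; [der ltac:(idtac; fail); lra|]. simpl. field.
Qed.

Lemma taylor_smooth (c : R -> R2) (f0 f1 f2 f3 f4 : R2 -> R) : (forall f : R2 -> R, sm everywhere f -> sm everywhere (fun s => f (c (snd s)))) ->
  sm everywhere f0 -> sm everywhere f1 -> sm everywhere f2 -> sm everywhere f3 -> sm everywhere f4 ->
  sm everywhere (taylor c f0 f1 f2 f3 f4).
Proof.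
  intros hc s0 s1 s2 s3 s4. pose proof (smooth_coord_fst everywhere).
  apply hc in s0, s1, s2, s3, s4. unfold taylor. smt; intros; lra.
Qed.

Lemma lie_iter_smooth (a b : R2 -> R) j (h : R2 -> R) : sm everywhere a -> sm everywhere b -> sm everywhere h -> sm everywhere (lie_iter a b j h).
Proof.
  pose proof open_everywhere as o. intros sa sb sh. induction j as [|j IH]; auto.
  change (sm everywhere (lie_der a b (lie_iter a b j h))). unfold lie_der. smt.
Qed.

(** The Taylor coefficients of an integral curve of the field [(a, b)] are the iterated Lie
    derivatives of the coordinates, taken at the starting point [c s]. A polynomial of degree four
    thus solves the flow equation up to an error of order four on the axis, as a 3-jet requires. *)
Lemma taylor_straightens (a b : R2 -> R) (c : R -> R2) :
  sm everywhere a -> sm everywhere b -> (forall f : R2 -> R, sm everywhere f -> sm everywhere (fun s => f (c (snd s)))) ->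
  let L := lie_iter a b in
  let P1 := taylor c (fun z => fst z) a (L 1%nat a) (L 2%nat a) (L 3%nat a) in
  let P2 := taylor c (fun z => snd z) b (L 1%nat b) (L 2%nat b) (L 3%nat b) in
  flat_on_axis 4 (fun s => d1 P1 s - a (P1 s, P2 s)) /\ flat_on_axis 4 (fun s => d1 P2 s - b (P1 s, P2 s)).
Proof.
  intros sa sb hc L P1 P2. pose proof open_everywhere as o.
  assert (sL : forall j (h : R2 -> R), sm everywhere h -> sm everywhere (L j h)) by (intros; now apply lie_iter_smooth).
  assert (sP1 : sm everywhere P1) by (apply taylor_smooth; auto; apply smooth_coord_fst).
  assert (sP2 : sm everywhere P2) by (apply taylor_smooth; auto; apply smooth_coord_snd).
  assert (sc : forall h : R2 -> R, sm everywhere h -> sm everywhere (fun s => h (P1 s, P2 s))).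
  { intros h sh. apply (smooth_chain everywhere everywhere); auto. }
  set (E1 := fun s => d1 P1 s - a (P1 s, P2 s)). set (E2 := fun s => d1 P2 s - b (P1 s, P2 s)).
  pose proof (sc a sa) as sca. pose proof (sc b sb) as scb.
  assert (sE1 : sm everywhere E1) by (unfold E1; smt). assert (sE2 : sm everywhere E2) by (unfold E2; smt).
  assert (P0 : forall s, (P1 (0, s), P2 (0, s)) = c s).
  { intros s. unfold P1, P2, taylor; cbn [fst snd]. destruct (c s) as [u v]. cbn [fst snd]. f_equal; field. }
  (* along the axis, derivatives of h o P are iterated Lie derivatives of h, as long as P is an integral curve to that order *)
  assert (step : forall n, flat_on_axis n E1 -> flat_on_axis n E2 -> forall j (h : R2 -> R) s, (j <= n)%nat -> sm everywhere h ->
     iter_d1 j (fun s => h (P1 s, P2 s)) (0, s) = L j h (c s)).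
  { intros n h1 h2. induction j as [|j IH]; intros h s hj sh.
    - simpl. now rewrite P0.
    - rewrite iter_d1_S.
      assert (sh1 : sm everywhere (d1 h)) by smt. assert (sh2 : sm everywhere (d2 h)) by smt.
      pose proof (sc _ sh1) as c1. pose proof (sc _ sh2) as c2.
      assert (sl : sm everywhere (lie_der a b h)) by (unfold lie_der; smt). pose proof (sc _ sl) as c3.
      assert (E : d1 (fun s => h (P1 s, P2 s)) = fun s => lie_der a b h (P1 s, P2 s) + (E1 s * d1 h (P1 s, P2 s) + E2 s * d2 h (P1 s, P2 s))).
      { apply functional_extensionality; intros z. rewrite (chain_d1 everywhere everywhere h P1 P2) by (auto; exact I). unfold E1, E2, lie_der. ring. }
      rewrite E, !iter_d1_plus by (auto; smt). rewrite IH by (auto; lia).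
      pose proof (flat_on_axis_mult n E1 _ sE1 c1 h1) as f1. pose proof (flat_on_axis_mult n E2 _ sE2 c2 h2) as f2.
      rewrite flat_on_axis_iff in f1, f2. rewrite f1, f2 by lia.
      unfold L, lie_iter. rewrite Nat.iter_succ_r. ring. }
  assert (D1 : forall j s, (j < 4)%nat -> iter_d1 j (d1 P1) (0, s) = L j a (c s)).
  { intros j s hj. unfold P1.
    destruct j as [|[|[|[|j]]]]; [..|lia]; cbv [iter_d1 L lie_iter Nat.iter nat_rect]; rewrite !d1_taylor;
      unfold taylor; cbn [fst snd]; field. }
  assert (D2 : forall j s, (j < 4)%nat -> iter_d1 j (d1 P2) (0, s) = L j b (c s)).
  { intros j s hj. unfold P2.
    destruct j as [|[|[|[|j]]]]; [..|lia]; cbv [iter_d1 L lie_iter Nat.iter nat_rect]; rewrite !d1_taylor;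
      unfold taylor; cbn [fst snd]; field. }
  (* If the error is flat to order [n], its normal derivative of order [n] compares the iterated Lie
     derivative read off from the Taylor coefficients with the one obtained by differentiating the
     field along [P]; they agree, so flatness improves by one. *)
  assert (all : forall n, (n <= 4)%nat -> flat_on_axis n E1 /\ flat_on_axis n E2).
  { induction n as [|n IH]; intros hn; [split; exact I|].
    destruct IH as [h1 h2]; [lia|].
    assert (neg : forall f : R2 -> R, sm everywhere f -> forall j, iter_d1 j (fun z => - f z) = fun z => - iter_d1 j f z).
    { intros f sf. induction j as [|j IH]; auto.
      change (d1 (iter_d1 j (fun z => - f z)) = fun z => - d1 (iter_d1 j f) z). rewrite IH.
      apply functional_extensionality; intros z. apply (opp_second everywhere); auto. now apply iter_d1_smooth. exact I. }
    split; apply flat_on_axis_iff; intros j s hj.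
    - unfold E1, Rminus. rewrite (iter_d1_plus j (d1 P1) (fun z => - a (P1 z, P2 z))) by smt.
      rewrite (neg (fun z => a (P1 z, P2 z))) by auto. rewrite D1 by lia. rewrite (step n h1 h2) by (auto; lia). ring.
    - unfold E2, Rminus. rewrite (iter_d1_plus j (d1 P2) (fun z => - b (P1 z, P2 z))) by smt.
      rewrite (neg (fun z => b (P1 z, P2 z))) by auto. rewrite D2 by lia. rewrite (step n h1 h2) by (auto; lia). ring. }
  apply all. lia.
Qed.

Definition field_of (p : R2) (xi : W3) (z : R2) : R2 :=
  let '(X, (X_1, X_2), (X11, X12, X22), (X111, X112, X122, X222)) := xi in
  (poly3 p (fst X) (fst X_1) (fst X_2) (fst X11) (fst X12) (fst X22) (fst X111) (fst X112) (fst X122) (fst X222) z,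
   poly3 p (snd X) (snd X_1) (snd X_2) (snd X11) (snd X12) (snd X22) (snd X111) (snd X112) (snd X122) (snd X222) z).

Lemma vj3_field_of p xi : vj3 (field_of p xi) p = xi.
Proof.
  destruct xi as [[[[a a'] [[b b'] [c c']]] [[[d d'] [e e']] [f f']]] [[[[g g'] [h h']] [i i']] [j j']]].
  unfold vj3, vj2, vj1, on_R2, field_of. cbn [fst snd].
  repeat match goal with |- context [d1 (fun q : R2 => poly3 ?p ?c0 ?c1 ?c2 ?c3 ?c4 ?c5 ?c6 ?c7 ?c8 ?c9 q)] =>
     change (d1 (fun q : R2 => poly3 p c0 c1 c2 c3 c4 c5 c6 c7 c8 c9 q)) with (d1 (poly3 p c0 c1 c2 c3 c4 c5 c6 c7 c8 c9)) end.
  repeat match goal with |- context [d2 (fun q : R2 => poly3 ?p ?c0 ?c1 ?c2 ?c3 ?c4 ?c5 ?c6 ?c7 ?c8 ?c9 q)] =>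
     change (d2 (fun q : R2 => poly3 p c0 c1 c2 c3 c4 c5 c6 c7 c8 c9 q)) with (d2 (poly3 p c0 c1 c2 c3 c4 c5 c6 c7 c8 c9)) end.
  repeat first [rewrite d1_poly3 | rewrite d2_poly3]. rewrite !poly3_at. reflexivity.
Qed.

Lemma field_of_smooth p xi (D : R2 -> Prop) : smooth (V := NR2) (W := NR2) D (field_of p xi).
Proof.
  destruct xi as [[[X [X_1 X_2]] [[X11 X12] X22]] [[[X111 X112] X122] X222]].
  apply (smooth_pair (V := NR2) (W := R_NormedModule) (Z := R_NormedModule)); apply poly3_smooth.
Qed.

Lemma vanish_minus k (D : R2 -> Prop) (f g : R2 -> R) (p : R2) : open2 D -> D p -> sm D f -> sm D g ->
  vanish (S k) (fun z => f z - g z) p ->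
  f p = g p /\ vanish k (fun z => d1 f z - d1 g z) p /\ vanish k (fun z => d2 f z - d2 g z) p.
Proof.
  intros o Dp sf sg [h [h1 h2]]. split; [lra|].
  split; [apply (vanish_ext k D (d1 (fun z => f z - g z)))|apply (vanish_ext k D (d2 (fun z => f z - g z)))]; auto;
    intros [x y] hz; apply is_derive_unique; cbn [fst snd].
  - eapply der_eq; [der ltac:(idtac; leaf1 D)|reflexivity].
  - eapply der_eq; [der ltac:(idtac; leaf2 D)|reflexivity].
Qed.

Lemma vanish_3_jet (D : R2 -> Prop) (f g : R2 -> R) (p : R2) : open2 D -> D p -> sm D f -> sm D g ->
  vanish 3 (fun z => f z - g z) p ->
  f p = g p /\ d1 f p = d1 g p /\ d2 f p = d2 g p /\
  d1 (d1 f) p = d1 (d1 g) p /\ d1 (d2 f) p = d1 (d2 g) p /\ d2 (d2 f) p = d2 (d2 g) p /\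
  d1 (d1 (d1 f)) p = d1 (d1 (d1 g)) p /\ d1 (d1 (d2 f)) p = d1 (d1 (d2 g)) p /\
  d1 (d2 (d2 f)) p = d1 (d2 (d2 g)) p /\ d2 (d2 (d2 f)) p = d2 (d2 (d2 g)) p.
Proof.
  intros o Dp sf sg h.
  assert (V := fun k f g => vanish_minus k D f g p o Dp).
  destruct (V _ _ _ sf sg h) as (e0 & h1 & h2).
  apply V in h1; [|smt|smt]. apply V in h2; [|smt|smt]. destruct h1 as (e1 & h11 & h21), h2 as (e2 & h12 & h22).
  apply V in h11; [|smt|smt]. apply V in h12; [|smt|smt]. apply V in h22; [|smt|smt].
  destruct h11 as (e11 & [h111 _] & _), h12 as (e12 & [h112 _] & _), h22 as (e22 & [h122 _] & [h222 _]).
  repeat split; auto; lra.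
Qed.

(** The polynomial field with jet [xi] is replaced by the image of the first coordinate field under
    an approximate straightening chart: the 3-jet is the same, and the flow is translation in the
    chart. *)
Lemma flow_exists (p : R2) (xi : W3) : rho30 xi <> (0, 0) ->
  exists (X : R2 -> R2) (Phi : R -> R2 -> R2), smooth_near p X /\ vj3 X p = xi /\ local_flow X p Phi.
Proof.
  intros hv. pose proof open_everywhere as o.
  set (a := fun z => fst (field_of p xi z)). set (b := fun z => snd (field_of p xi z)).
  destruct (smooth_R2 (V := NR2) everywhere _ (field_of_smooth p xi everywhere)) as [sa sb].
  change (sm everywhere a) in sa. change (sm everywhere b) in sb.
  set (v := rho30 xi) in *.
  assert (Zp : field_of p xi p = v) by (unfold v; rewrite <- (vj3_field_of p xi) at 2; reflexivity).
  assert (ap : a p = fst v) by (unfold a; now rewrite Zp). assert (bp : b p = snd v) by (unfold b; now rewrite Zp).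
  (* The transversal runs in the direction of [v] turned by a right angle, so the chart has Jacobian
     equal to the squared length of [v] at the origin. *)
  set (c := fun s : R => (fst p - s * snd v, snd p + s * fst v) : R2).
  pose proof (smooth_coord_snd everywhere) as scs. pose proof (smooth_coord_fst everywhere) as scf.
  assert (hc : forall f : R2 -> R, sm everywhere f -> sm everywhere (fun s => f (c (snd s)))).
  { intros f sf. apply (smooth_chain everywhere everywhere f (fun s => fst p - snd s * snd v) (fun s => snd p + snd s * fst v)); auto; smt. }
  destruct (taylor_straightens a b c sa sb hc) as [fl1 fl2].
  set (P1 := taylor c (fun z => fst z) a (lie_iter a b 1 a) (lie_iter a b 2 a) (lie_iter a b 3 a)) in *.
  set (P2 := taylor c (fun z => snd z) b (lie_iter a b 1 b) (lie_iter a b 2 b) (lie_iter a b 3 b)) in *.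
  assert (sP1 : sm everywhere P1) by (apply taylor_smooth; auto; now apply lie_iter_smooth).
  assert (sP2 : sm everywhere P2) by (apply taylor_smooth; auto; now apply lie_iter_smooth).
  assert (c0 : c 0 = p) by (unfold c; destruct p; cbn [fst snd]; f_equal; ring).
  assert (P0 : forall s, P1 (0, s) = fst (c s) /\ P2 (0, s) = snd (c s)).
  { intros s. unfold P1, P2, taylor; cbn [fst snd]. split; field. }
  assert (J0 : jac P1 P2 (0, 0) = fst v ^ 2 + snd v ^ 2).
  { unfold jac.
    assert (x1 : d1 P1 (0, 0) = fst v) by (unfold P1; rewrite d1_taylor; unfold taylor; cbn [fst snd]; rewrite c0, ap; field).
    assert (x2 : d1 P2 (0, 0) = snd v) by (unfold P2; rewrite d1_taylor; unfold taylor; cbn [fst snd]; rewrite c0, bp; field).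
    assert (x3 : d2 P1 (0, 0) = - snd v).
    { unfold d2; cbn [fst snd]. rewrite (Derive_ext _ (fun s => fst p - s * snd v)); [|intros s; apply P0].
      apply is_derive_unique. eapply der_eq; [der ltac:(idtac; fail)|ring]. }
    assert (x4 : d2 P2 (0, 0) = fst v).
    { unfold d2; cbn [fst snd]. rewrite (Derive_ext _ (fun s => snd p + s * fst v)); [|intros s; apply P0].
      apply is_derive_unique. eapply der_eq; [der ltac:(idtac; fail)|ring]. }
    rewrite x1, x2, x3, x4. ring. }
  assert (Jn : jac P1 P2 (0, 0) <> 0).
  { rewrite J0. intros h. apply hv. destruct v as [v1 v2]; cbn [fst snd] in *. f_equal; nra. }
  destruct (inverse_function everywhere P1 P2 (0, 0) o I sP1 sP2 Jn) as (V & V' & g1 & g2 & oV & oV' & V0 & _ & sg1 & sg2 & hPg & hgP & _).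
  assert (P00 : (P1 (0, 0), P2 (0, 0)) = p).
  { destruct (P0 0) as [-> ->]. rewrite c0. now destruct p. }
  destruct (hPg _ V0) as [V'p gp]. rewrite P00 in V'p, gp.
  assert (sDP1 : sm everywhere (d1 P1)) by smt. assert (sDP2 : sm everywhere (d1 P2)) by smt.
  set (x1 := fun q : R2 => d1 P1 (g1 q, g2 q)). set (x2 := fun q : R2 => d1 P2 (g1 q, g2 q)).
  assert (tr : forall q, V' q -> everywhere (g1 q, g2 q)) by (intros; exact I).
  assert (sx1 : sm V' x1) by (apply (smooth_chain everywhere V'); auto).
  assert (sx2 : sm V' x2) by (apply (smooth_chain everywhere V'); auto).
  assert (sub : forall f : R2 -> R, sm everywhere f -> sm V' f) by (intros f sf; eapply smooth_sub; [|exact sf]; intros; exact I).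
  assert (sc : forall h : R2 -> R, sm everywhere h -> sm everywhere (fun s => h (P1 s, P2 s))).
  { intros h sh. apply (smooth_chain everywhere everywhere); auto. }
  (* The difference of the two fields is the straightening error composed with the inverse chart,
     and vanishing of a jet is preserved by composition. *)
  assert (W1 : vanish 3 (fun z => x1 z - a z) p).
  { apply (vanish_ext 3 V' (fun q => (fun s => d1 P1 s - a (P1 s, P2 s)) (g1 q, g2 q))); auto.
    - intros q hq. unfold x1. cbv beta. destruct (hgP q hq) as [_ e]. now rewrite e.
    - apply (vanish_comp 3 everywhere V' (fun s => d1 P1 s - a (P1 s, P2 s)) g1 g2); auto.
      + pose proof (sc a sa). smt.
      + rewrite gp. apply flat_on_axis_vanish; auto. pose proof (sc a sa). smt. }
  assert (W2 : vanish 3 (fun z => x2 z - b z) p).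
  { apply (vanish_ext 3 V' (fun q => (fun s => d1 P2 s - b (P1 s, P2 s)) (g1 q, g2 q))); auto.
    - intros q hq. unfold x2. cbv beta. destruct (hgP q hq) as [_ e]. now rewrite e.
    - apply (vanish_comp 3 everywhere V' (fun s => d1 P2 s - b (P1 s, P2 s)) g1 g2); auto.
      + pose proof (sc b sb). smt.
      + rewrite gp. apply flat_on_axis_vanish; auto. pose proof (sc b sb). smt. }
  (* The push-forward of the first coordinate field, and its flow: translation by [t] in the first
     chart coordinate. *)
  exists (fun q => (x1 q, x2 q)), (fun t q => (P1 (g1 q + t, g2 q), P2 (g1 q + t, g2 q))).
  split; [|split].
  - exists V'. split; [exact oV'|]. split; auto. now apply (smooth_pair (V := NR2) (W := R_NormedModule) (Z := R_NormedModule)).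
  - apply (vanish_3_jet V') in W1; auto. apply (vanish_3_jet V') in W2; auto.
    destruct W1 as (a0 & a1 & a2 & a3 & a4 & a5 & a6 & a7 & a8 & a9). destruct W2 as (b0 & b1 & b2 & b3 & b4 & b5 & b6 & b7 & b8 & b9).
    rewrite <- (vj3_field_of p xi). unfold vj3, vj2, vj1, on_R2. cbn [fst snd].
    change (fun q => x1 q) with x1. change (fun q => x2 q) with x2.
    change (fun q => fst (field_of p xi q)) with a. change (fun q => snd (field_of p xi q)) with b.
    rewrite a0, a1, a2, a3, a4, a5, a6, a7, a8, a9, b0, b1, b2, b3, b4, b5, b6, b7, b8, b9.
    do 3 f_equal. unfold a, b. now destruct (field_of p xi p).
  - set (O := fun z : R * R2 => V' (snd z) /\ V (g1 (snd z) + fst z, g2 (snd z))).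
    set (O1 := fun z : R * R2 => V' (snd z)).
    assert (oO1 : open3 O1) by (apply (open_pre (V := NR3) (W := NR2) (fun z => snd z) V'); auto; intros z; apply continuous_snd).
    assert (sl : forall g : R2 -> R, sm V' g -> sm3 O1 (fun z => g (snd z))).
    { intros g sg k. apply (Ck_pre (V' := NR3) (V := NR2) k V' g (fun z => snd z) (fun z => snd z)); auto. intros z; apply continuous_snd. }
    pose proof (sl _ sg1) as sl1. pose proof (sl _ sg2) as sl2.
    assert (st : sm3 O1 (fun z => fst z)) by (apply (smooth_linear (V := NR3) (W := R_NormedModule)), is_linear_fst).
    assert (s12 : sm3 O1 (fun z => g1 (snd z) + fst z)) by smt.
    assert (oO : open3 O).
    { intros z [h1 h2]. apply filter_and; [now apply oO1|].
      assert (CC : continuous (fun z : NR3 => (g1 (snd z) + fst z, g2 (snd z)) : NR2) z).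
      { apply continuous_pair; [apply (s12 0%nat)|apply (sl2 0%nat)]; auto. }
      apply (CC V). now apply oV. }
    assert (OO1 : forall z, O z -> O1 z) by (intros z hz; apply hz).
    assert (sO : forall F : R * R2 -> R, sm3 O1 F -> sm3 O F) by (intros F sF; eapply smooth_sub; [exact OO1|exact sF]).
    exists O. split; [exact oO|]. split.
    { split; cbn [fst snd]; auto. rewrite Rplus_0_r. rewrite gp. exact V0. }
    split.
    { apply (smooth_pair (V := NR3) (W := R_NormedModule) (Z := R_NormedModule)).
      - apply (smooth_comp_R2 (V := NR3) O everywhere P1 (fun z => g1 (snd z) + fst z) (fun z => g2 (snd z))); auto. intros; exact I.
      - apply (smooth_comp_R2 (V := NR3) O everywhere P2 (fun z => g1 (snd z) + fst z) (fun z => g2 (snd z))); auto. intros; exact I. }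
    split.
    { intros q [hq _]. cbn [fst snd] in hq. rewrite Rplus_0_r. now apply hgP. }
    intros t q [h1 h2]. cbn [fst snd] in h1, h2. unfold x1, x2.
    destruct (hPg _ h2) as [_ e]. injection e as e1 e2. rewrite e1, e2.
    apply is_derive_R2.
    + eapply der_eq. apply (is_derive_comp_R2 everywhere P1 (fun s => g1 q + s) (fun _ => g2 q) t 1 0 o (sP1 1%nat) I).
      * eapply der_eq; [der ltac:(idtac; fail)|ring].
      * apply der_const.
      * ring.
    + eapply der_eq. apply (is_derive_comp_R2 everywhere P2 (fun s => g1 q + s) (fun _ => g2 q) t 1 0 o (sP2 1%nat) I).
      * eapply der_eq; [der ltac:(idtac; fail)|ring].
      * apply der_const.
      * ring.
Qed.

(** * The distribution K and the algebra A *)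

Lemma derive_unique {V : NormedModule R_AbsRing} (f : R -> V) (t : R) (l l' : V) :
  is_derive f t l -> is_derive f t l' -> l = l'.
Proof.
  intros h h'.
  assert (H : is_derive (fun s => minus (f s) (f s)) t (minus l l')) by (now apply (is_derive_minus f f)).
  destruct H as [_ H]. specialize (H t (fun P h => h)).
  assert (N : norm (minus l l') <= 0).
  { apply Rnot_lt_le. intros pos.
    assert (e0 : 0 < norm (minus l l') / 2) by lra.
    destruct (H (mkposreal _ e0)) as [d Hd].
    assert (b : ball t d (t + d / 2)).
    { change (Rabs (t + d / 2 - t) < d). pose proof (cond_pos d). rewrite Rabs_pos_eq; lra. }
    specialize (Hd _ b).
    change (norm (minus (minus (minus (f (t + d / 2)) (f (t + d / 2))) (minus (f t) (f t))) (scal (t + d / 2 - t) (minus l l')))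
      <= norm (minus l l') / 2 * Rabs (t + d / 2 - t)) in Hd.
    replace (t + d / 2 - t) with (d / 2) in Hd by ring.
    assert (E : minus (minus (minus (f (t + d / 2)) (f (t + d / 2))) (minus (f t) (f t))) (scal (d / 2) (minus l l'))
       = opp (scal (d / 2) (minus l l'))) by (rewrite !minus_eq_zero; apply plus_zero_l).
    rewrite E in Hd.
    assert (En := norm_opp (K := R_AbsRing) (V := V) (scal (d / 2) (minus l l'))).
    change (norm (opp (scal (d / 2) (minus l l') : V)) <= norm (minus l l') / 2 * Rabs (d / 2)) in Hd. rewrite En in Hd.
    assert (E2 : norm (scal (/ (d / 2)) (scal (d / 2) (minus l l'))) <= Rabs (/ (d / 2)) * norm (scal (d / 2) (minus l l'))) by apply (norm_scal (/ (d / 2))).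
    pose proof (cond_pos d) as dp.
    assert (E3 : scal (/ (d / 2)) (scal (d / 2) (minus l l')) = minus l l').
    { rewrite (scal_assoc (/ (d / 2)) (d / 2) (minus l l')).
      change (scal (/ (d / 2) * (d / 2)) (minus l l') = minus l l'). rewrite Rinv_l by lra. apply (scal_one (minus l l')). }
    rewrite E3 in E2. rewrite Rabs_pos_eq in E2 by (apply Rlt_le, Rinv_0_lt_compat; lra).
    rewrite Rabs_pos_eq in Hd by lra.
    assert (/ (d / 2) * norm (scal (d / 2) (minus l l')) <= / (d / 2) * (norm (minus l l') / 2 * (d / 2))).
    { apply Rmult_le_compat_l; auto. apply Rlt_le, Rinv_0_lt_compat; lra. }
    replace (/ (d / 2) * (norm (minus l l') / 2 * (d / 2))) with (norm (minus l l') / 2) in H0 by (field; lra). lra. }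
  assert (Z : minus l l' = zero) by (apply norm_eq_zero; pose proof (norm_ge_0 (minus l l')); lra).
  apply (plus_reg_r (opp l')). rewrite plus_opp_r. exact Z.
Qed.

Lemma R4_eta (u : R4) : (u1 u, u2 u, u3 u, u4 u) = u.
Proof. now destruct u as [[[? ?] ?] ?]. Qed.

Definition kvec (theta : J2) (w : R2) : J1 :=
  let '((p, u, (v1, v2)), (v11, v12, v22)) := theta in
  (w, lin2 (fst w) (snd w) v1 v2, (lin2 (fst w) (snd w) v11 v12, lin2 (fst w) (snd w) v12 v22)).

Lemma j1_line (S : R2 -> R4) (p w : R2) : smooth_near p S ->
  is_derive (V := NJ1) (fun t : R => j1 S (plus (p : NR2) (scal t (w : NR2)))) 0 (kvec (j2 S p) w).
Proof.
  intros (D & oD & Dp & sS). destruct (smooth_R4 D S sS) as (s1 & s2 & s3 & s4).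
  assert (L : forall f : R2 -> R, sm D f -> is_derive (fun t : R => f (plus (p : NR2) (scal t (w : NR2)))) 0 (fst w * d1 f p + snd w * d2 f p)).
  { intros f sf. apply (is_derive_line_R2 f (d1 f) (d2 f) p w D); auto.
    - intros [x y] hq. now apply (is_d1 D).
    - intros [x y] hq. now apply (is_d2 D).
    - intros q hq. apply (sm_continuous D); auto. smt. }
  assert (cm : forall f : R2 -> R, sm D f -> d2 (d1 f) p = d1 (d2 f) p) by (intros; symmetry; now apply (smooth_d12 D)).
  unfold j1, j2, kvec, on_R4.
  apply (is_derive_J1 (fun t => plus (p : NR2) (scal t (w : NR2)))).
  - eapply is_derive_ext; [intros t; reflexivity|].
    apply (is_derive_ext (fun t : R => (fst p + t * fst w, snd p + t * snd w) : NR2)); [reflexivity|].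
    destruct w as [w1 w2]. apply is_derive_R2; (eapply der_eq; [der ltac:(idtac; fail)|cbn [fst snd]; ring]).
  - apply (is_derive_ext (fun t : R => (u1 (S (plus (p : NR2) (scal t (w : NR2)))), u2 (S (plus (p : NR2) (scal t (w : NR2)))), u3 (S (plus (p : NR2) (scal t (w : NR2)))), u4 (S (plus (p : NR2) (scal t (w : NR2))))))).
    + intros t. exact (R4_eta _).
    + apply is_derive_R4; [apply (L _ s1)|apply (L _ s2)|apply (L _ s3)|apply (L _ s4)].
  - apply is_derive_R4; (eapply der_eq; [apply L; smt|rewrite cm by assumption; reflexivity]).
  - apply is_derive_R4; (eapply der_eq; [apply L; smt|reflexivity]).
Qed.

Definition section_jet (theta : J2) (z : R2) : R4 :=
  let '((p, u, (v1, v2)), (v11, v12, v22)) := theta in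
  (poly3 p (u1 u) (u1 v1) (u1 v2) (u1 v11) (u1 v12) (u1 v22) 0 0 0 0 z,
   poly3 p (u2 u) (u2 v1) (u2 v2) (u2 v11) (u2 v12) (u2 v22) 0 0 0 0 z,
   poly3 p (u3 u) (u3 v1) (u3 v2) (u3 v11) (u3 v12) (u3 v22) 0 0 0 0 z,
   poly3 p (u4 u) (u4 v1) (u4 v2) (u4 v11) (u4 v12) (u4 v22) 0 0 0 0 z).

Lemma section_jet_smooth theta (D : R2 -> Prop) : smooth (V := NR2) (W := NR4) D (section_jet theta).
Proof.
  destruct theta as [[[p u] [v1 v2]] [[v11 v12] v22]].
  apply (smooth_pair (V := NR2) (W := prod_NormedModule R_AbsRing NR2 R_NormedModule) (Z := R_NormedModule)); [|apply poly3_smooth].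
  apply (smooth_pair (V := NR2) (W := NR2) (Z := R_NormedModule)); [|apply poly3_smooth].
  apply (smooth_pair (V := NR2) (W := R_NormedModule) (Z := R_NormedModule)); apply poly3_smooth.
Qed.

Lemma section_jet_j2 theta : j2 (section_jet theta) (base (fst theta)) = theta.
Proof.
  destruct theta as [[[p u] [v1 v2]] [[v11 v12] v22]].
  destruct u as [[[? ?] ?] ?], v1 as [[[? ?] ?] ?], v2 as [[[? ?] ?] ?], v11 as [[[? ?] ?] ?], v12 as [[[? ?] ?] ?], v22 as [[[? ?] ?] ?].
  unfold j2, j1, on_R4, base, section_jet, u1, u2, u3, u4. cbn [fst snd].
  repeat match goal with |- context [d1 (fun q : R2 => poly3 ?p ?c0 ?c1 ?c2 ?c3 ?c4 ?c5 ?c6 ?c7 ?c8 ?c9 q)] =>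
     change (d1 (fun q : R2 => poly3 p c0 c1 c2 c3 c4 c5 c6 c7 c8 c9 q)) with (d1 (poly3 p c0 c1 c2 c3 c4 c5 c6 c7 c8 c9)) end.
  repeat match goal with |- context [d2 (fun q : R2 => poly3 ?p ?c0 ?c1 ?c2 ?c3 ?c4 ?c5 ?c6 ?c7 ?c8 ?c9 q)] =>
     change (d2 (fun q : R2 => poly3 p c0 c1 c2 c3 c4 c5 c6 c7 c8 c9 q)) with (d2 (poly3 p c0 c1 c2 c3 c4 c5 c6 c7 c8 c9)) end.
  repeat first [rewrite d1_poly3 | rewrite d2_poly3]. rewrite !poly3_at.
  reflexivity.
Qed.

Lemma smooth_near_of {W : NormedModule R_AbsRing} (p : R2) (F : R2 -> W) : smooth (V := NR2) everywhere F -> smooth_near (V := NR2) p F.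
Proof. intros sF. exists everywhere. split; [apply open_everywhere|]. split; [exact I|exact sF]. Qed.

(** The differential of a 1-jet section at the point is given by its 2-jet. For the converse, every
    [theta] is the 2-jet of the polynomial section [section_jet theta]. *)
Lemma calK_iff theta (v : J1) : calK theta v <-> exists w, v = kvec theta w.
Proof.
  split.
  - intros (S & sS & eS & w & hw). exists w. cbv zeta in *. rewrite <- eS.
    refine (derive_unique (V := NJ1) _ 0 _ _ hw _). now apply j1_line.
  - intros [w ->]. exists (section_jet theta). cbv zeta.
    assert (sn : smooth_near (V := NR2) (W := NR4) (base (fst theta)) (section_jet theta)) by (apply smooth_near_of, section_jet_smooth).
    split; [exact sn|]. split; [apply section_jet_j2|]. exists w.
    pose proof (j1_line (section_jet theta) (base (fst theta)) w sn) as h. rewrite section_jet_j2 in h. exact h.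
Qed.

(** The base component of the prolonged vector is the value of the field, so [rho30 xi] is the only
    possible direction [w] in [kvec]; what remains is a system of linear equations on the jet. *)
Definition tangent (theta : J2) (xi : W3) : Prop := prol xi (fst theta) = kvec theta (rho30 xi).

Lemma prol_base xi theta : fst (fst (prol xi theta)) = rho30 xi.
Proof. destruct xi as [[[X [X_1 X_2]] [[X11 X12] X22]] [[[X111 X112] X122] X222]], theta as [[p u] [v1 v2]]. reflexivity. Qed.

Lemma calA_tangent theta xi : calA theta xi -> tangent theta xi.
Proof.
  intros (X & sX & eX & v & (Phi & S & fl & sS & eS & dv) & kv). cbv zeta in *.
  pose proof (prolong_value X (base (fst theta)) Phi S fl sX sS) as pv.
  assert (ev : v = prol xi (fst theta)) by (rewrite <- eX, <- eS; exact (derive_unique (V := NJ1) _ 0 _ _ dv pv)).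
  apply calK_iff in kv. destruct kv as [w ew].
  unfold tangent. rewrite <- ev, ew. f_equal.
  rewrite <- (prol_base xi (fst theta)), <- ev, ew. destruct theta as [[[p u] [v1 v2]] [[v11 v12] v22]]. reflexivity.
Qed.

Lemma flow_calA theta xi X Phi : smooth_near (V := NR2) (W := NR2) (base (fst theta)) X -> vj3 X (base (fst theta)) = xi ->
  local_flow X (base (fst theta)) Phi -> tangent theta xi -> calA theta xi.
Proof.
  intros sX eX fl ht. exists X. cbv zeta. split; [exact sX|]. split; [exact eX|].
  exists (prol xi (fst theta)). split; [|apply calK_iff; now exists (rho30 xi)].
  exists Phi, (section_jet theta).
  assert (sn : smooth_near (V := NR2) (W := NR4) (base (fst theta)) (section_jet theta)) by (apply smooth_near_of, section_jet_smooth).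
  pose proof (section_jet_j2 theta) as ej. apply (f_equal fst) in ej. change (j1 (section_jet theta) (base (fst theta)) = fst theta) in ej.
  split; [exact fl|]. split; [exact sn|]. split; [exact ej|].
  pose proof (prolong_value X _ Phi (section_jet theta) fl sX sn) as h. rewrite ej, eX in h. exact h.
Qed.

(** The two cases cover a horizontal subspace: there the only jet over the zero vector is zero,
    realised by the zero field with the identity flow, and the others admit a straightening
    chart. *)
Lemma tangent_calA theta xi : tangent theta xi -> rho30 xi <> (0, 0) \/ xi = zero -> calA theta xi.
Proof.
  intros ht [h| ->].
  - destruct (flow_exists (base (fst theta)) xi h) as (X & Phi & sX & eX & fl). now apply (flow_calA theta xi X Phi).
  - assert (z1 : forall c : R, d1 (fun _ : R2 => c) = fun _ => 0) by (intros; apply functional_extensionality; intros; apply d1_const).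
    assert (z2 : forall c : R, d2 (fun _ : R2 => c) = fun _ => 0) by (intros; apply functional_extensionality; intros; apply d2_const).
    apply (flow_calA theta _ (fun _ => (0, 0)) (fun _ q => q)); auto.
    + apply smooth_near_of. apply (smooth_const (V := NR2) (W := NR2)).
    + unfold vj3, vj2, vj1, on_R2. cbn [fst snd]. repeat first [rewrite z1 | rewrite z2]. reflexivity.
    + exists (fun _ => True). split; [apply (open_true (T := NR3))|]. split; auto. split.
      { apply (smooth_linear (V := NR3) (W := NR2)). apply is_linear_snd. }
      split; auto. intros t q _. apply (is_derive_const (V := NR2) q).
Qed.

(** * Brackets of 3-jets and the curvature form *)

Definition along (v X Y : R2) : R2 := (fst v * fst X + snd v * fst Y, fst v * snd X + snd v * snd Y).
Definition add2 (v w : R2) : R2 := (fst v + fst w, snd v + snd w).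
Definition sub2 (v w : R2) : R2 := (fst v - fst w, snd v - snd w).

(* The 2-jet of the directional derivative of Y along X. *)
Definition along_jet (xi eta : W3) : W2 :=
  let '(X, (X_1, X_2), (X11, X12, X22), _) := xi in
  let '(_, (Y_1, Y_2), (Y11, Y12, Y22), (Y111, Y112, Y122, Y222)) := eta in
  (along X Y_1 Y_2,
   (add2 (along X_1 Y_1 Y_2) (along X Y11 Y12), add2 (along X_2 Y_1 Y_2) (along X Y12 Y22)),
   (add2 (along X11 Y_1 Y_2) (add2 (along X_1 Y11 Y12) (add2 (along X_1 Y11 Y12) (along X Y111 Y112))),
    add2 (along X12 Y_1 Y_2) (add2 (along X_1 Y12 Y22) (add2 (along X_2 Y11 Y12) (along X Y112 Y122))),
    add2 (along X22 Y_1 Y_2) (add2 (along X_2 Y12 Y22) (add2 (along X_2 Y12 Y22) (along X Y122 Y222))))).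

Definition jet_sub (xi eta : W2) : W2 :=
  let '(X, (X_1, X_2), (X11, X12, X22)) := xi in
  let '(Y, (Y_1, Y_2), (Y11, Y12, Y22)) := eta in
  (sub2 X Y, (sub2 X_1 Y_1, sub2 X_2 Y_2), (sub2 X11 Y11, sub2 X12 Y12, sub2 X22 Y22)).

Definition jet_bracket (xi eta : W3) : W2 := jet_sub (along_jet xi eta) (along_jet eta xi).

Lemma bracket_component (D : R2 -> Prop) (X1 X2 Y1 Y2 f g : R2 -> R) (p : R2) : open2 D -> D p ->
  sm D X1 -> sm D X2 -> sm D Y1 -> sm D Y2 -> sm D f -> sm D g ->
  let L := fun z : R2 => X1 z * d1 g z + X2 z * d2 g z - (Y1 z * d1 f z + Y2 z * d2 f z) in
  d1 L p = (d1 X1 p * d1 g p + d1 X2 p * d2 g p + (X1 p * d1 (d1 g) p + X2 p * d1 (d2 g) p))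
     - (d1 Y1 p * d1 f p + d1 Y2 p * d2 f p + (Y1 p * d1 (d1 f) p + Y2 p * d1 (d2 f) p)) /\
  d2 L p = (d2 X1 p * d1 g p + d2 X2 p * d2 g p + (X1 p * d1 (d2 g) p + X2 p * d2 (d2 g) p))
     - (d2 Y1 p * d1 f p + d2 Y2 p * d2 f p + (Y1 p * d1 (d2 f) p + Y2 p * d2 (d2 f) p)) /\
  d1 (d1 L) p = (d1 (d1 X1) p * d1 g p + d1 (d1 X2) p * d2 g p + (d1 X1 p * d1 (d1 g) p + d1 X2 p * d1 (d2 g) p
       + (d1 X1 p * d1 (d1 g) p + d1 X2 p * d1 (d2 g) p + (X1 p * d1 (d1 (d1 g)) p + X2 p * d1 (d1 (d2 g)) p))))
     - (d1 (d1 Y1) p * d1 f p + d1 (d1 Y2) p * d2 f p + (d1 Y1 p * d1 (d1 f) p + d1 Y2 p * d1 (d2 f) p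
       + (d1 Y1 p * d1 (d1 f) p + d1 Y2 p * d1 (d2 f) p + (Y1 p * d1 (d1 (d1 f)) p + Y2 p * d1 (d1 (d2 f)) p)))) /\
  d1 (d2 L) p = (d1 (d2 X1) p * d1 g p + d1 (d2 X2) p * d2 g p + (d1 X1 p * d1 (d2 g) p + d1 X2 p * d2 (d2 g) p
       + (d2 X1 p * d1 (d1 g) p + d2 X2 p * d1 (d2 g) p + (X1 p * d1 (d1 (d2 g)) p + X2 p * d1 (d2 (d2 g)) p))))
     - (d1 (d2 Y1) p * d1 f p + d1 (d2 Y2) p * d2 f p + (d1 Y1 p * d1 (d2 f) p + d1 Y2 p * d2 (d2 f) p
       + (d2 Y1 p * d1 (d1 f) p + d2 Y2 p * d1 (d2 f) p + (Y1 p * d1 (d1 (d2 f)) p + Y2 p * d1 (d2 (d2 f)) p)))) /\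
  d2 (d2 L) p = (d2 (d2 X1) p * d1 g p + d2 (d2 X2) p * d2 g p + (d2 X1 p * d1 (d2 g) p + d2 X2 p * d2 (d2 g) p
       + (d2 X1 p * d1 (d2 g) p + d2 X2 p * d2 (d2 g) p + (X1 p * d1 (d2 (d2 g)) p + X2 p * d2 (d2 (d2 g)) p))))
     - (d2 (d2 Y1) p * d1 f p + d2 (d2 Y2) p * d2 f p + (d2 Y1 p * d1 (d2 f) p + d2 Y2 p * d2 (d2 f) p
       + (d2 Y1 p * d1 (d2 f) p + d2 Y2 p * d2 (d2 f) p + (Y1 p * d1 (d2 (d2 f)) p + Y2 p * d2 (d2 (d2 f)) p)))).
Proof.
  intros o Dp sX1 sX2 sY1 sY2 sf sg L.
  assert (cm : forall h, sm D h -> forall z, D z -> d2 (d1 h) z = d1 (d2 h) z) by (intros; symmetry; now apply (smooth_d12 D)).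
  assert (cm122 : forall h, sm D h -> forall z, D z -> d2 (d1 (d2 h)) z = d1 (d2 (d2 h)) z).
  { intros h sh z hz. rewrite cm by (auto; smt). reflexivity. }
  set (L1 := fun z : R2 => (d1 X1 z * d1 g z + d1 X2 z * d2 g z + (X1 z * d1 (d1 g) z + X2 z * d1 (d2 g) z))
     - (d1 Y1 z * d1 f z + d1 Y2 z * d2 f z + (Y1 z * d1 (d1 f) z + Y2 z * d1 (d2 f) z))).
  set (L2 := fun z : R2 => (d2 X1 z * d1 g z + d2 X2 z * d2 g z + (X1 z * d1 (d2 g) z + X2 z * d2 (d2 g) z))
     - (d2 Y1 z * d1 f z + d2 Y2 z * d2 f z + (Y1 z * d1 (d2 f) z + Y2 z * d2 (d2 f) z))).
  assert (e1 : forall z, D z -> d1 L z = L1 z).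
  { intros [x y] hz. apply is_derive_unique; cbn [fst snd]. eapply der_eq; [unfold L; der ltac:(idtac; leaf1 D)|]. unfold L1. ring. }
  assert (e2 : forall z, D z -> d2 L z = L2 z).
  { intros [x y] hz. apply is_derive_unique; cbn [fst snd]. eapply der_eq; [unfold L; der ltac:(idtac; leaf2 D)|].
    unfold L2. rewrite !cm by assumption. ring. }
  split; [now apply e1|]. split; [now apply e2|].
  rewrite (d1_ext D _ _ p o Dp e1), (d1_ext D _ _ p o Dp e2), (d2_ext D _ _ p o Dp e2).
  destruct p as [x y]. split; [|split]; apply is_derive_unique; cbn [fst snd].
  - eapply der_eq; [unfold L1; der ltac:(idtac; leaf1 D)|]. ring.
  - eapply der_eq; [unfold L2; der ltac:(idtac; leaf1 D)|]. ring.
  - eapply der_eq; [unfold L2; der ltac:(idtac; leaf2 D)|]. rewrite !cm122 by assumption. rewrite !cm by assumption. ring.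
Qed.

Lemma vj2_lie (X Y : R2 -> R2) (p : R2) : smooth_near p X -> smooth_near p Y ->
  vj2 (lie X Y) p = jet_bracket (vj3 X p) (vj3 Y p).
Proof.
  intros (D & oD & Dp & sX) (D' & oD' & Dp' & sY).
  set (E := fun z => D z /\ D' z). assert (oE : open2 E) by (now apply (open_and (T := NR2))).
  destruct (smooth_R2 (V := NR2) D X sX) as [sX1 sX2]. destruct (smooth_R2 (V := NR2) D' Y sY) as [sY1 sY2].
  assert (EX : exists X1 X2 : R2 -> R, X = fun z => (X1 z, X2 z)).
  { exists (fun z => fst (X z)), (fun z => snd (X z)). apply functional_extensionality; intros z; now destruct (X z). }
  assert (EY : exists Y1 Y2 : R2 -> R, Y = fun z => (Y1 z, Y2 z)).
  { exists (fun z => fst (Y z)), (fun z => snd (Y z)). apply functional_extensionality; intros z; now destruct (Y z). }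
  destruct EX as (X1 & X2 & ->). destruct EY as (Y1 & Y2 & ->). cbn [fst snd] in *.
  assert (s1 : sm E X1) by (eapply smooth_sub; [|exact sX1]; intros z [? ?]; auto).
  assert (s2 : sm E X2) by (eapply smooth_sub; [|exact sX2]; intros z [? ?]; auto).
  assert (s3 : sm E Y1) by (eapply smooth_sub; [|exact sY1]; intros z [? ?]; auto).
  assert (s4 : sm E Y2) by (eapply smooth_sub; [|exact sY2]; intros z [? ?]; auto).
  assert (Ep : E p) by (split; auto).
  destruct (bracket_component E X1 X2 Y1 Y2 X1 Y1 p oE Ep s1 s2 s3 s4 s1 s3) as (b1 & b2 & b3 & b4 & b5).
  destruct (bracket_component E X1 X2 Y1 Y2 X2 Y2 p oE Ep s1 s2 s3 s4 s2 s4) as (c1 & c2 & c3 & c4 & c5).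
  change (lie (fun z : R2 => (X1 z, X2 z)) (fun z : R2 => (Y1 z, Y2 z))) with
    (fun z : R2 => (X1 z * d1 Y1 z + X2 z * d2 Y1 z - (Y1 z * d1 X1 z + Y2 z * d2 X1 z),
              X1 z * d1 Y2 z + X2 z * d2 Y2 z - (Y1 z * d1 X2 z + Y2 z * d2 X2 z))).
  unfold vj2, vj1, on_R2 at 1 2 3 4 5. cbn [fst snd].
  rewrite b1, b2, b3, b4, b5, c1, c2, c3, c4, c5. reflexivity.
Qed.

(* The third derivatives X111, ..., X222 with Ls X111 X112 X122 = r and Ls X112 X122 X222 = s. *)
Definition third_part (r s : R4) : R2 * R2 * R2 * R2 :=
  ((2 * u1 s - u2 r, u1 r), ((u2 s - 2 * u3 r) / 3, u1 s), (- u4 r, (2 * u2 s - u3 r) / 3),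
   (- u4 s, u3 s - 2 * u4 r)).

(* The tangent 3-jets over v with vanishing first derivatives whose second derivatives are a
   symmetric bilinear function of v. *)
Definition flat_lift (theta : J2) (v : R2) : W3 :=
  let '((p, u, (v1, v2)), (v11, v12, v22)) := theta in
  let K11 := (2 * u1 v2 - u2 v1, u1 v1) in
  let K12 := ((u2 v2 - 2 * u3 v1) / 3, u1 v2) in
  let K22 := (- u4 v1, (2 * u2 v2 - u3 v1) / 3) in
  let K222 := (- u4 v2, u3 v2 - 2 * u4 v1) in
  let X11 := along v K11 K12 in let X12 := along v K12 K22 in let X22 := along v K22 K222 in
  let r := lin2 (fst v) (snd v) v11 v12 in let s := lin2 (fst v) (snd v) v12 v22 in
  let m u w := add4 u (lin2 (-1) 0 w w) in
  (v, ((0, 0), (0, 0)), (X11, X12, X22), third_part (m r (Lb X11 X12 u)) (m s (Lb X12 X22 u))).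

Lemma rho30_flat_lift theta v : rho30 (flat_lift theta v) = v.
Proof. now destruct theta as [[[p u] [v1 v2]] [[v11 v12] v22]]. Qed.

Definition comb (a b : R) (xi eta : W3) : W3 :=
  let c (v w : R2) : R2 := (a * fst v + b * fst w, a * snd v + b * snd w) in
  let '(X, (X_1, X_2), (X11, X12, X22), (X111, X112, X122, X222)) := xi in
  let '(Y, (Y_1, Y_2), (Y11, Y12, Y22), (Y111, Y112, Y122, Y222)) := eta in
  (c X Y, (c X_1 Y_1, c X_2 Y_2), (c X11 Y11, c X12 Y12, c X22 Y22), (c X111 Y111, c X112 Y112, c X122 Y122, c X222 Y222)).

Notation NW3 := (prod_NormedModule _ (prod_NormedModule _ (prod_NormedModule _ NR2 (prod_NormedModule _ NR2 NR2))
   (prod_NormedModule _ (prod_NormedModule _ NR2 NR2) NR2))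
   (prod_NormedModule _ (prod_NormedModule _ (prod_NormedModule _ NR2 NR2) NR2) NR2)).

Lemma comb_eq a b (xi eta : W3) : comb a b xi eta = plus (scal a (xi : NW3)) (scal b (eta : NW3)).
Proof.
  destruct xi as [[[X [X_1 X_2]] [[X11 X12] X22]] [[[X111 X112] X122] X222]].
  destruct eta as [[[Y [Y_1 Y_2]] [[Y11 Y12] Y22]] [[[Y111 Y112] Y122] Y222]]. reflexivity.
Qed.

Ltac pairs := repeat lazymatch goal with |- (_, _) = (_, _) => apply f_equal2 end.

(** Given first and second derivatives, tangency in the derivative components amounts to eight
    equations for the eight third derivatives, which [third_part] solves; the tensor [K] takes care
    of the four equations of order zero. *)
Lemma flat_lift_tangent theta v : tangent theta (flat_lift theta v).
Proof.
  destruct theta as [[[p [[[a b] c] d]] [[[[a1 b1] c1] d1] [[[a2 b2] c2] d2]]]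
    [[[[[a11 b11] c11] d11] [[[a12 b12] c12] d12]] [[[a22 b22] c22] d22]]]. destruct v as [v v'].
  cbv beta iota zeta delta [tangent flat_lift prol kvec third_part rho30 add4 Lb Ls lin2 along u1 u2 u3 u4 fst snd].
  pairs; try reflexivity; field.
Qed.

Lemma flat_lift_comb theta s t v w : comb s t (flat_lift theta v) (flat_lift theta w) = flat_lift theta (along (s, t) v w).
Proof.
  destruct theta as [[[p [[[a b] c] d]] [[[[a1 b1] c1] d1] [[[a2 b2] c2] d2]]]
    [[[[[a11 b11] c11] d11] [[[a12 b12] c12] d12]] [[[a22 b22] c22] d22]]]. destruct v as [v v'], w as [w w'].
  cbv beta iota zeta delta [comb flat_lift third_part add4 Lb lin2 along add2 u1 u2 u3 u4 fst snd].
  pairs; field.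
Qed.

(** Since first derivatives vanish, the 1-jet of the bracket is the contraction of [K] with [v] and
    [w] minus the same with [v] and [w] exchanged, which is zero as [K] is symmetric in all lower
    indices. *)
Lemma flat_lift_bracket theta v w : fst (jet_bracket (flat_lift theta v) (flat_lift theta w)) = zero.
Proof.
  destruct theta as [[[p [[[a b] c] d]] [[[[a1 b1] c1] d1] [[[a2 b2] c2] d2]]]
    [[[[[a11 b11] c11] d11] [[[a12 b12] c12] d12]] [[[a22 b22] c22] d22]]]. destruct v as [v v'], w as [w w'].
  change (zero : W1) with ((0, 0), ((0, 0), (0, 0))).
  cbv beta iota zeta delta [jet_bracket jet_sub along_jet flat_lift along add2 sub2 third_part add4 Lb lin2 u1 u2 u3 u4 fst snd].
  pairs; ring.
Qed.

Definition jet_scal (k : R) (xi : W2) : W2 :=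
  let c (v : R2) : R2 := (k * fst v, k * snd v) in
  let '(X, (X_1, X_2), (X11, X12, X22)) := xi in (c X, (c X_1, c X_2), (c X11, c X12, c X22)).

(** The bracket is bilinear and alternating, so on the span of two jets it is determined by a single
    value; this is how the factor dx^1 wedge dx^2 arises. *)
Lemma jet_bracket_comb a b c d xi eta :
  jet_bracket (comb a b xi eta) (comb c d xi eta) = jet_scal (a * d - b * c) (jet_bracket xi eta).
Proof.
  destruct xi as [[[[X X'] [[X1 X1'] [X2 X2']]] [[[X11 X11'] [X12 X12']] [X22 X22']]] [[[[X111 X111'] [X112 X112']] [X122 X122']] [X222 X222']]].
  destruct eta as [[[[Y Y'] [[Y1 Y1'] [Y2 Y2']]] [[[Y11 Y11'] [Y12 Y12']] [Y22 Y22']]] [[[[Y111 Y111'] [Y112 Y112']] [Y122 Y122']] [Y222 Y222']]].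
  cbv beta iota zeta delta [jet_bracket jet_sub along_jet comb along add2 sub2 jet_scal fst snd].
  pairs; ring.
Qed.

Definition jetF1 (theta : J2) : R :=
  let '((_, u, (v1, v2)), (v11, v12, v22)) := theta in
  3 * u1 v22 - 2 * u2 v12 + u3 v11 + 3 * u4 u * u1 v1 - 3 * u3 u * u1 v2
  + 2 * u2 u * u2 v2 - u2 u * u3 v1 - 3 * u1 u * u3 v2 + 6 * u1 u * u4 v1.

Definition jetF2 (theta : J2) : R :=
  let '((_, u, (v1, v2)), (v11, v12, v22)) := theta in
  u2 v22 - 2 * u3 v12 + 3 * u4 v11 - 3 * u1 u * u4 v2 + 3 * u2 u * u4 v1
  - 2 * u3 u * u3 v1 + u3 u * u2 v2 + 3 * u4 u * u2 v1 - 6 * u4 u * u1 v2.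

Definition omega_val (theta : J2) : W2 :=
  (((0, 0), ((0, 0), (0, 0))), ((2 * jetF1 theta / 3, 0), (jetF2 theta / 3, jetF1 theta / 3), (0, 2 * jetF2 theta / 3))).

Lemma pair_inj {A B : Type} (a c : A) (b d : B) : (a, b) = (c, d) -> a = c /\ b = d.
Proof. intros h; now inversion h. Qed.

Lemma bracket_value theta xi eta : tangent theta xi -> tangent theta eta ->
  rho30 xi = (1, 0) -> rho30 eta = (0, 1) -> fst (jet_bracket xi eta) = zero ->
  jet_bracket xi eta = omega_val theta.
Proof.
  (* Tangency and flatness determine all second derivatives; what remains is linear in the third ones. *)
  intros hX hY rX rY hf.
  assert (split1 : jet_bracket xi eta = (fst (jet_bracket xi eta), snd (jet_bracket xi eta))) by (now destruct (jet_bracket xi eta)).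
  rewrite split1, hf. unfold omega_val. apply f_equal2; [reflexivity|]. clear split1.
  destruct xi as [[[[X X'] [[X1 X1'] [X2 X2']]] [[[X11 X11'] [X12 X12']] [X22 X22']]] [[[[X111 X111'] [X112 X112']] [X122 X122']] [X222 X222']]].
  destruct eta as [[[[Y Y'] [[Y1 Y1'] [Y2 Y2']]] [[[Y11 Y11'] [Y12 Y12']] [Y22 Y22']]] [[[[Y111 Y111'] [Y112 Y112']] [Y122 Y122']] [Y222 Y222']]].
  unfold rho30 in rX, rY. cbn [fst snd] in rX, rY. apply pair_inj in rX, rY. destruct rX as [-> ->], rY as [-> ->].
  destruct theta as [[[p [[[a b] c] d]] [[[[a1 b1] c1] d1] [[[a2 b2] c2] d2]]]
    [[[[[a11 b11] c11] d11] [[[a12 b12] c12] d12]] [[[a22 b22] c22] d22]]].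
  cbv beta iota zeta delta [tangent prol kvec rho30 add4 Lb Ls lin2 u1 u2 u3 u4 fst snd] in hX, hY.
  cbv beta iota zeta delta [jet_bracket jet_sub along_jet along add2 sub2 fst snd] in hf |- *.
  change (zero : W1) with ((0, 0), ((0, 0), (0, 0))) in hf.
  cbv beta iota zeta delta [jetF1 jetF2 u1 u2 u3 u4 fst snd].
  repeat match goal with H : (_, _) = (_, _) |- _ => apply pair_inj in H; destruct H end.
  (* Vanishing of the value of the bracket: as the fields have values (1, 0) and (0, 1), this
     equates the x-derivative of the second with the y-derivative of the first. *)
  assert (e : Y1 = X2) by lra. subst Y1.
  assert (e : Y1' = X2') by lra. subst Y1'.
  (* The quadratic terms in the first derivatives of the bracket; its vanishing 1-jet then expresses
     [Y11] and [Y12] through [X12] and [X22]. *)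
  set (q1 := X1 * X2 + X1' * Y2 - X2 * X1 - X2' * X2). set (q1' := X1 * X2' + X1' * Y2' - X2 * X1' - X2' * X2').
  set (q2 := X2 * X2 + X2' * Y2 - Y2 * X1 - Y2' * X2). set (q2' := X2 * X2' + X2' * Y2' - Y2 * X1' - Y2' * X2').
  assert (f1 : Y11 = X12 - q1) by (unfold q1; lra). assert (f1' : Y11' = X12' - q1') by (unfold q1'; lra).
  assert (f2 : Y12 = X22 - q2) by (unfold q2; lra). assert (f2' : Y12' = X22' - q2') by (unfold q2'; lra).
  (* The contributions of [Lb] to the eight tangency equations of order zero, which determine the
     eight second derivatives that are still free. *)
  set (LX1 := (X1 + X2') * a - 3 * X1 * a - X1' * b).
  set (LX2 := (X1 + X2') * b - 3 * X2 * a - 2 * X1 * b - X2' * b - 2 * X1' * c).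
  set (LX3 := (X1 + X2') * c - 2 * X2 * b - X1 * c - 2 * X2' * c - 3 * X1' * d).
  set (LX4 := (X1 + X2') * d - X2 * c - 3 * X2' * d).
  set (LY1 := (X2 + Y2') * a - 3 * X2 * a - X2' * b).
  set (LY2 := (X2 + Y2') * b - 3 * Y2 * a - 2 * X2 * b - Y2' * b - 2 * X2' * c).
  set (LY3 := (X2 + Y2') * c - 2 * Y2 * b - X2 * c - 2 * Y2' * c - 3 * X2' * d).
  set (LY4 := (X2 + Y2') * d - Y2 * c - 3 * Y2' * d).
  (* The right-hand sides of [X22' - 2 * X12 = r] and [2 * X22' - X12 = s], the one pair of
     equations that is not triangular; its determinant accounts for the factor 1/3. *)
  set (r := c1 - LX3). set (s := b2 - LY2 + 2 * q2' - q1).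
  assert (g1 : X11' = a1 - LX1) by (unfold LX1; lra).
  assert (g2 : X22 = LX4 - d1) by (unfold LX4; lra).
  assert (g3 : X12' = a2 - LY1 + q1') by (unfold LY1; lra).
  assert (g4 : X11 = 2 * X12' - b1 + LX2) by (unfold LX2; lra).
  assert (g5 : X22' = (2 * s - r) / 3) by (unfold s, r, LX3, LY2; lra).
  assert (g6 : X12 = (s - 2 * r) / 3) by (unfold s, r, LX3, LY2; lra).
  assert (g7 : Y22 = LY4 - d2) by (unfold LY4; lra).
  assert (g8 : Y22' = c2 - LY3 + 2 * Y12) by (unfold LY3; lra).
  subst Y11 Y11' Y22' Y12 Y12' X11 X11' X22 X12' X22' X12 Y22.
  unfold r, s, LX1, LX2, LX3, LX4, LY1, LY2, LY3, LY4, q1, q1', q2, q2' in *.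
  pairs; lra.
Qed.

(** * Existence of flat horizontal subspaces and the value of [omega] *)

Lemma flat_lift_zero theta : flat_lift theta (0, 0) = zero.
Proof.
  pose proof (flat_lift_comb theta 0 0 (0, 0) (0, 0)) as h.
  assert (z : along (0, 0) (0, 0) (0, 0) = (0, 0)) by (unfold along; cbn [fst snd]; f_equal; ring).
  rewrite z in h. rewrite <- h, comb_eq, !(scal_zero_l (V := NW3)). apply (plus_zero_l (G := NW3)).
Qed.

(** The image of [flat_lift theta] works: this map is linear in the vector, takes tangent values and
    has brackets with zero 1-jet. Existence is what gives the choice in [omega] its defining
    property. *)
Lemma flat_horizontal_exists (theta : J2) : exists (H : W3 -> Prop) (w : W0 -> W0 -> W2),
  flat_horizontal theta H /\ is_omega_H (base (fst theta)) H w.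
Proof.
  set (H := fun xi : W3 => exists v, xi = flat_lift theta v).
  exists H, (fun v w => jet_bracket (flat_lift theta v) (flat_lift theta w)).
  split; [split; [split; [|split]|]|].
  - split; [|split].
    + exists (0, 0). now rewrite flat_lift_zero.
    + intros xi eta [v ->] [w ->]. exists (along (1, 1) v w). rewrite <- flat_lift_comb, comb_eq, !(scal_one (V := NW3)). reflexivity.
    + intros k xi [v ->]. exists (along (k, 0) v v). rewrite <- flat_lift_comb, comb_eq, (scal_zero_l (V := NW3)). symmetry. apply (plus_zero_r (G := NW3)).
  - intros xi [v ->]. apply tangent_calA; [apply flat_lift_tangent|]. rewrite rho30_flat_lift.
    destruct (classic (v = (0, 0))) as [->|h]; [right; apply flat_lift_zero|now left].
  - intros v. exists (flat_lift theta v). split; [split; [now exists v|apply rho30_flat_lift]|].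
    intros xi [[w ->] h]. rewrite rho30_flat_lift in h. now rewrite h.
  - intros X Y sX sY [v hX] [w hY]. rewrite (vj2_lie X Y _ sX sY), hX, hY. apply flat_lift_bracket.
  - intros X Y sX sY [v hX] [w hY]. rewrite (vj2_lie X Y _ sX sY), hX, hY, !rho30_flat_lift. reflexivity.
Qed.

(** Only the lifts of the coordinate vectors have to be examined, by bilinearity. Arbitrary elements
    of [H] are represented by the polynomial fields [field_of], through which the conditions on
    vector fields become conditions on jets. *)
Lemma omega_H_value (theta : J2) (H : W3 -> Prop) (w : W0 -> W0 -> W2) (v v' : W0) :
  flat_horizontal theta H -> is_omega_H (base (fst theta)) H w ->
  w v v' = jet_scal (fst v * snd v' - snd v * fst v') (omega_val theta).
Proof.
  intros [[[_ [Hp Hs]] [HA Hv]] Hf] Hw. set (p := base (fst theta)) in *.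
  destruct (Hv (1, 0)) as (xi & [hx rx] & _). destruct (Hv (0, 1)) as (eta & [hy ry] & _).
  assert (sn : forall z, smooth_near (V := NR2) (W := NR2) p (field_of p z)) by (intros z; apply smooth_near_of, field_of_smooth).
  assert (E : jet_bracket xi eta = omega_val theta).
  { apply bracket_value; auto; try (now apply calA_tangent, HA).
    pose proof (Hf (field_of p xi) (field_of p eta) (sn _) (sn _)) as h.
    rewrite (vj2_lie _ _ _ (sn xi) (sn eta)), !vj3_field_of in h. now apply h. }
  assert (C : forall u : R2, H (comb (fst u) (snd u) xi eta)).
  { intros u. rewrite comb_eq. apply Hp; now apply Hs. }
  assert (rC : forall u : R2, rho30 (comb (fst u) (snd u) xi eta) = u).
  { intros [u u']. destruct xi as [[[X [X_1 X_2]] [[X11 X12] X22]] [[[X111 X112] X122] X222]].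
    destruct eta as [[[Y [Y_1 Y_2]] [[Y11 Y12] Y22]] [[[Y111 Y112] Y122] Y222]].
    unfold rho30 in *. cbn [fst snd comb] in *. rewrite rx, ry. cbn [fst snd]. f_equal; ring. }
  pose proof (Hw _ _ (sn (comb (fst v) (snd v) xi eta)) (sn (comb (fst v') (snd v') xi eta))) as h.
  rewrite (vj2_lie _ _ _ (sn _) (sn _)), !vj3_field_of, !rC, jet_bracket_comb, E in h. now apply h.
Qed.

Lemma omega_value (theta : J2) (v w : W0) :
  omega theta v w = jet_scal (fst v * snd w - snd v * fst w) (omega_val theta).
Proof.
  assert (h : exists w, exists H, flat_horizontal theta H /\ is_omega_H (base (fst theta)) H w).
  { destruct (flat_horizontal_exists theta) as (H & w0 & h). now exists w0, H. }
  destruct (epsilon_spec (inhabits (fun _ _ : W0 => zero : W2)) _ h) as (H & h1 & h2).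
  exact (omega_H_value theta H _ v w h1 h2).
Qed.

Lemma omega_zero_iff (theta : J2) : (forall v w : W0, omega theta v w = zero) <-> jetF1 theta = 0 /\ jetF2 theta = 0.
Proof.
  split.
  - intros h. specialize (h (1, 0) (0, 1)). rewrite omega_value in h. unfold omega_val, jet_scal in h. cbn [fst snd] in h.
    (* The first component of the xx-derivative and the second component of the yy-derivative
       isolate [jetF1] and [jetF2]. *)
    assert (h1 := f_equal (fun xi : W2 => fst (fst (fst (snd xi)))) h).
    assert (h2 := f_equal (fun xi : W2 => snd (snd (snd xi))) h).
    change ((1 * 1 - 0 * 0) * (2 * jetF1 theta / 3) = 0) in h1. change ((1 * 1 - 0 * 0) * (2 * jetF2 theta / 3) = 0) in h2. lra.
  - intros [h1 h2] v w. rewrite omega_value. unfold omega_val, jet_scal. rewrite h1, h2.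
    change (zero : W2) with (((0, 0), ((0, 0), (0, 0))), ((0, 0), (0, 0), (0, 0))).
    cbv beta iota zeta delta [fst snd]. pairs; field.
Qed.

Theorem theorem5p5 (U : R2 -> Prop) (a0 a1 a2 a3 : R2 -> R)
  (hU : open U)
  (h0 : smooth U a0) (h1 : smooth U a1) (h2 : smooth U a2) (h3 : smooth U a3) :
  locally_linearizable U (section_of a0 a1 a2 a3) <->
  (forall p : R2, U p -> forall v w : W0,
     omega (j2 (section_of a0 a1 a2 a3) p) v w = zero).
Proof.
  rewrite (linearizable_iff U a0 a1 a2 a3 hU h0 h1 h2 h3).
  (* [lieF1] and [lieF2] at [p] are convertible to [jetF1] and [jetF2] at the 2-jet of the section,
     so the pointwise criterion applies without rewriting. *)
  split; intros h p Up; apply (omega_zero_iff (j2 (section_of a0 a1 a2 a3) p)); exact (h p Up).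
Qed.
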